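(* Let $\sigma\in S_3$, and for each $n\ge 4$ let $\Pi_n$ be a uniformly random element of $\mathbf{Av}_n(\sigma)$, regarded as a random element of $F(\mathbb{N},\mathbb{N}^* )$. Let $\tilde T$ be a size-biased Geometric$(1/2)$-Galton-Watson tree. Then $\Pi_n$ converges in distribution to $\Phi^\sigma_{\tilde T}$ as $n\to\infty$.
   Context: **Permutations.** $\mathbb{N}=\{1,2,\dots\}$, $[n]=\{1,\dots,n\}$, $S_n$ is the set of permutations of $[n]$. For $n>m$, $\pi\in S_n$ contains $\sigma\in S_m$ if there are indices $i_1<\dots<i_m$ such that for all $j<k$, $\pi(i_j)<\pi(i_k)$ iff $\sigma(j)<\sigma(k)$; otherwise $\pi$ avoids $\sigma$. $\mathbf{Av}_n(\sigma)$ is the set of $\pi\in S_n$ avoiding $\sigma$. Elements of $S_3$ are written in one-line notation: $\mathbf{123},\mathbf{132},\mathbf{213},\mathbf{231},\mathbf{312},\mathbf{321}$. $\mathbb{N}^*=\mathbb{N}\cup\{\infty\}$ is the one-point compactification of $\mathbb{N}$, and $F(\mathbb{N},\mathbb{N}^* )$ is the set of functions $\mathbb{N}\to\mathbb{N}^*$ with the topology of pointwise convergence. $S_n$ is embedded in $F(\mathbb{N},\mathbb{N}^* )$ by $\pi(k)=k$ for $k>n$. **Trees.** $\mathcal{U}=\bigcup_{n\ge0}\{1,2,\dots\}^n$ is the set of finite words over $\{1,2,\dots\}$, with empty word $\emptyset$, concatenation $uv$, length $|u|$, and lexicographic order $\le$ (a proper prefix is smaller than the word). A (rooted ordered) tree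 is a set $\mathbf{t}\subseteq\mathcal{U}$ with $\emptyset\in\mathbf{t}$, closed under taking prefixes, and such that $ui\in\mathbf{t}$ implies $uj\in\mathbf{t}$ for all $1\le j\le i$; the root is $\emptyset$, and the vertices $ui\in \mathbf{t}$ ($i\ge1$) are the children of $u$. $|\mathbf{t}|$ is the number of vertices, and $\mathbf{t}_u=\{v\in\mathbf{t}: v=uw\text{ for some }w\in\mathcal{U}\}$ is the fringe subtree at $u$. For $u\in\mathbf{t}$, $d_{\mathbf{t}}(u)=0\vee\sup\{i:ui\in\mathbf{t}\}$, and $d_{\mathbf{t}}(u)=-1$ for $u\notin\mathbf{t}$. A leaf is a vertex $u\in \mathbf{t}$ with $d_{\mathbf{t}}(u)=0$. $\mathfrak{T}$ is the set of locally finite trees ($d_{\mathbf{t}}(u)<\infty$ for all $u$), with the topology in which $\mathbf{t}_n\to\mathbf{t}$ iff $d_{\mathbf{t}_n}(u)\to d_{\mathbf{t}}(u)$ for every $u\in\mathcal{U}$. $\mathbf{t}^{[k]}$ is the subtree of vertices $u\in \mathbf{t}$ with $|u|\le k$, and $\#_k\mathbf{t}$ is the number of vertices $u\in\mathbf{t}$ with $|u|=k$. The height of $\mathbf t$ is the maximum of $|u|$ over $u\in \mathbf t$. **The class $\mathfrak{T}_\infty$.** $\mathfrak{T}_f$ is the set of finite trees with at least two vertices. An infinite spine in $\mathbf{t}$ is an infinite sequence $\eta_0,\eta_1,\dots$ of vertices with $\eta_0=\emptyset$ and $\eta_{i+1}$ a child of $\eta_i$ for all $i$. $\mathfrak{T}_\infty\subseteq\mathfrak{T}$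 is the set of infinite locally finite trees that have a unique infinite spine, have infinitely many trees attached to the left of the spine and infinitely many attached to the right of it (the trees attached to the spine being the fringe subtrees at the non-spine children of spine vertices, re-rooted at $\emptyset$), and such that infinitely many of those attached to the left are in $\mathfrak{T}_f$ (i.e. have at least two vertices). **The maps $\Phi^\sigma_{\mathbf{t}}$ for $\mathbf{t}\in\mathfrak{T}_\infty$.** Define $v_0=\emptyset$ and $v_i=\min(\mathbf{t}\setminus\{v_0,\dots,v_{i-1}\})$ for $i\ge1$; define $w_1=\max\mathbf{t}$ and $w_i=\max(\mathbf{t}\setminus\{w_1,\dots,w_{i-1}\})$ for $i\ge2$ (min and max in lexicographic order; these exist, and no $w_i$ is on the spine). With the convention $a+\infty=\infty$ for $a\in\mathbb{Z}\cup\{\infty\}$, for $i\in\mathbb{N}$: - $\Phi^{\mathbf{231}}_{\mathbf{t}}(i)=i+|\mathbf{t}_{v_i}|-|v_i|$; - $\Phi^{\mathbf{213}}_{\mathbf{t}}(i)=|\mathbf{t}\setminus\mathbf{t}_{v_i}|-i+|v_i|$; - $\Phi^{\mathbf{312}}_{\mathbf{t}}(i)=i-|\mathbf{t}_{w_i}|+|w_i|$; - $\Phi^{\mathbf{132}}_{\mathbf{t}}(i)=|\mathbf{t}|-i+|\mathbf{t}_{w_i}|-|w_i|=\infty$. Let $l_1<l_2<\cdots$ be the leaves to the left of the infinite spine in increasing lexicographic order, $s_i=|\{v\in\mathbf{t}:v<l_i\}|$ and $p_i=|l_i|$. Then $\Phi^{\mathbf{321}}_{\mathbf{t}}(s_i-p_i+1)=s_i$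 for $i\ge1$, and on $\mathbb{N}\setminus\{s_i-p_i+1:i\ge1\}$ the map $\Phi^{\mathbf{321}}_{\mathbf{t}}$ is the unique increasing bijection from this set onto $\mathbb{N}\setminus\{s_i:i\ge1\}$. Finally $\Phi^{\mathbf{123}}_{\mathbf{t}}(i)=|\mathbf{t}|-\Phi^{\mathbf{321}}_{\mathbf{t}}(i)=\infty$ for all $i$. **Size-biased tree.** For a probability distribution $\xi$ on $\{0,1,2,\dots\}$ with mean $1$ and $\xi(1)<1$, a $\xi$-Galton-Watson tree is a $\mathfrak{T}$-valued random variable $T$ with $\mathbb{P}(T=\mathbf{t})=\prod_{u\in\mathbf{t}}\xi(d_{\mathbf{t}}(u))$ for finite $\mathbf{t}$. A size-biased $\xi$-Galton-Watson tree $\tilde T$ is a random tree whose law $\nu_\xi$ is the unique probability measure on infinite trees in $\mathfrak{T}$ such that for every $k$ and every $\mathbf{t}_0\in\mathfrak{T}$ of height $k$, $\nu_\xi(\{\mathbf{t}:\mathbf{t}^{[k]}=\mathbf{t}_0\})=(\#_k\mathbf{t}_0)\,\mathbb{P}(T^{[k]}=\mathbf{t}_0)$. Geometric$(1/2)$ is $\xi(i)=2^{-i-1}$, $i\ge0$. In this case $\tilde T\in\mathfrak{T}_\infty$ with probability $1$, so $\Phi^\sigma_{\tilde T}$ is almost surely defined. *)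

(* Defs.v *)
From HB Require Import structures.
From mathcomp Require Import all_boot all_order all_algebra all_fingroup finmap.
From mathcomp Require Import all_classical all_reals all_analysis.

Set Implicit Arguments.
Unset Strict Implicit.
Unset Printing Implicit Defensive.

Import Order.TTheory GRing.Theory Num.Theory numFieldNormedType.Exports.

Local Open Scope classical_set_scope.

Definition posnat : Type := {n : nat | (0 < n)%N}.
HB.instance Definition _ := SubChoice.on posnat.
HB.instance Definition _ :=
  [SubChoice_isSubOrder of posnat by <: with Order.NatOrder.nat_display].

Definition mkpos (n : nat) : posnat := exist _ n.+1 (ltn0Sn n).

HB.instance Definition _ := isPointed.Build posnat (mkpos 0).
HB.instance Definition _ :=
  Topological.copy posnat (discrete_topology posnat).

(* [Some i] is i and [None] is the point at infinity. *)
Definition posnat_star : Type := one_point_compactification posnat.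
HB.instance Definition _ := Choice.on posnat_star.
HB.instance Definition _ := Pointed.on posnat_star.
HB.instance Definition _ := Topological.on posnat_star.

Definition fun_space : Type := {ptws posnat -> posnat_star}.
HB.instance Definition _ := Choice.on fun_space.
HB.instance Definition _ := Pointed.on fun_space.
HB.instance Definition _ := Topological.on fun_space.

(* ['S_n] acts on {0, ..., n-1}, so values and indices are shifted by one with
   respect to permutations of {1, ..., n}. *)

Definition contains (n m : nat) (p : 'S_n) (s : 'S_m) : Prop :=
  exists i : 'I_m -> 'I_n,
    (forall j k : 'I_m, (j < k)%N -> (i j < i k)%N) /\
    (forall j k : 'I_m, (j < k)%N -> (p (i j) < p (i k))%N <-> (s j < s k)%N).

Definition Av (n m : nat) (s : 'S_m) : {set 'S_n} :=
  [set p : 'S_n | `[< ~ contains p s >]]%SET.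

Definition embed_perm (n : nat) (p : 'S_n) : fun_space :=
  fun k : posnat => Some
    (if insub (val k).-1 is Some j then mkpos (p j) else k).

Definition one_line (n : nat) (s : 'S_n) : seq nat :=
  [seq (s i).+1 | i <- enum 'I_n].

Definition word : Type := seq posnat.

Definition lexle (u v : word) : bool :=
  ((u : Order.SeqLexiOrder.type Order.NatOrder.nat_display posnat) <= v)%O.
Definition lexlt (u v : word) : bool :=
  ((u : Order.SeqLexiOrder.type Order.NatOrder.nat_display posnat) < v)%O.

Definition children (t : set word) (u : word) : set posnat :=
  [set i | t (rcons u i)].

(* Rooted ordered locally finite trees. *)
Record tree := Tree {
  vertices :> set word;
  tree_root : vertices [::];
  tree_prefix : forall u v : word, vertices (u ++ v) -> vertices u;
  tree_sibling : forall (u : word) (i j : posnat),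
    (val j <= val i)%N -> vertices (rcons u i) -> vertices (rcons u j);
  tree_locally_finite : forall u : word, finite_set (children vertices u) }.

Definition card (T : choiceType) (A : set T) : nat := #|` fset_set A|.

(* The maximum over the empty set is 0. *)
Definition deg (t : set word) (u : word) : int :=
  if `[< t u >] then Posz (\max_(i <- fset_set (children t u)) val i)
  else (-1)%R.

Fact single_vertex_prefix (u v : word) :
  [set [::]] (u ++ v) -> [set ([::] : word)] u.
Proof. by case: u. Qed.

Fact single_vertex_sibling (u : word) (i j : posnat) :
  (val j <= val i)%N -> [set [::]] (rcons u i) -> [set [::]] (rcons u j).
Proof. by case: u. Qed.

Fact single_vertex_finite (u : word) : finite_set (children [set [::]] u).
Proof.
have -> : children [set [::]] u = set0; last exact: finite_set0.
by apply/seteqP; split => // i; case: u.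
Qed.

Definition single_vertex : tree :=
  Tree (erefl [::]) single_vertex_prefix single_vertex_sibling
    single_vertex_finite.

HB.instance Definition _ := gen_eqMixin tree.
HB.instance Definition _ := gen_choiceMixin tree.
HB.instance Definition _ := isPointed.Build tree single_vertex.
(* [t_n] tends to [t] iff [deg t_n u] tends to [deg t u] for every [u]. *)
HB.instance Definition _ := Topological.copy tree
  (initial_topology
     (fun t : tree => deg t : {ptws word -> discrete_topology int})).

Definition fringe (t : set word) (u : word) : set word :=
  [set v | t v /\ exists w, v = u ++ w].

Definition rerooted_fringe (t : set word) (u : word) : set word :=
  [set w | t (u ++ w)].

Definition leaf (t : set word) (u : word) : Prop := t u /\ deg t u = 0%R.

Definition trunc (k : nat) (t : set word) : set word :=
  [set u | t u /\ (size u <= k)%N].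

Definition level (k : nat) (t : set word) : set word :=
  [set u | t u /\ size u = k].

Definition has_height (t : set word) (k : nat) : Prop :=
  (exists2 u, t u & size u = k) /\ (forall u, t u -> (size u <= k)%N).

Definition Tfin : set (set word) :=
  [set t | finite_set t /\ (2 <= card t)%N].

Definition spine (t : set word) (eta : nat -> word) : Prop :=
  [/\ eta 0%N = [::], (forall i, t (eta i)) &
      forall i, exists j : posnat, eta i.+1 = rcons (eta i) j].

(* Roots of the trees attached to the left, resp. right, of the spine. *)
Definition attached_left (t : set word) (eta : nat -> word) : set word :=
  [set u | t u /\ exists (k : nat) (i j : posnat),
     [/\ u = rcons (eta k) i, eta k.+1 = rcons (eta k) j & (val i < val j)%N]].
Definition attached_right (t : set word) (eta : nat -> word) : set word :=
  [set u | t u /\ exists (k : nat) (i j : posnat),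
     [/\ u = rcons (eta k) i, eta k.+1 = rcons (eta k) j & (val j < val i)%N]].

Definition Tinfty : set tree :=
  [set t | infinite_set t /\ exists eta : nat -> word,
    [/\ spine t eta,
        (forall eta', spine t eta' -> eta' = eta),
        infinite_set (attached_left t eta),
        infinite_set (attached_right t eta) &
        infinite_set [set u | attached_left t eta u /\
                              Tfin (rerooted_fringe t u)]]].

(* Least and greatest elements, [[::]] if there is none. *)
Definition lexmin (A : set word) : word :=
  xget [::] [set u | A u /\ forall v, A v -> lexle u v].
Definition lexmax (A : set word) : word :=
  xget [::] [set u | A u /\ forall v, A v -> lexle v u].

(* Extends the list [s] by [n] elements of [A], each one picked among those not
   yet listed. *)
Fixpoint successive (pick : set word -> word) (A : set word) (s : seq word)
    (n : nat) : seq word :=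
  if n is m.+1 then
    let s' := successive pick A s m in rcons s' (pick (A `\` [set` s']))
  else s.

Definition vseq (t : set word) (i : nat) : word :=
  last [::] (successive lexmin t [:: [::]] i).

(* Meaningful for [1 <= i]. *)
Definition wseq (t : set word) (i : nat) : word :=
  last [::] (successive lexmax t [::] i).

Definition ext_card (A : set word) : \bar int :=
  if `[< finite_set A >] then (Posz (card A))%:E else +oo%E.

(* Values outside {1, 2, ...} and +oo do not arise below and are sent to
   infinity. *)
Definition to_posnat_star (x : \bar int) : posnat_star :=
  match x with
  | EFin (Posz n.+1) => Some (mkpos n)
  | _ => None
  end.

Definition zlen (u : word) : \bar int := (Posz (size u))%:E.
Definition zpos (i : posnat) : \bar int := (Posz (val i))%:E.

Definition Phi231 (t : tree) : fun_space := fun i : posnat =>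
  let v := vseq t (val i) in
  to_posnat_star (zpos i + ext_card (fringe t v) - zlen v)%E.

Definition Phi213 (t : tree) : fun_space := fun i : posnat =>
  let v := vseq t (val i) in
  to_posnat_star (ext_card (vertices t `\` fringe t v) - zpos i + zlen v)%E.

Definition Phi312 (t : tree) : fun_space := fun i : posnat =>
  let w := wseq t (val i) in
  to_posnat_star (zpos i - ext_card (fringe t w) + zlen w)%E.

Definition Phi132 (t : tree) : fun_space := fun i : posnat =>
  let w := wseq t (val i) in
  to_posnat_star (ext_card t - zpos i + ext_card (fringe t w) - zlen w)%E.

Definition left_leaves (t : set word) : set word :=
  [set l | leaf t l /\ exists2 eta, spine t eta &
     exists2 u, attached_left t eta u & exists w, l = u ++ w].

(* Meaningful for [1 <= i]. *)
Definition lseq (t : set word) (i : nat) : word :=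
  last [::] (successive lexmin (left_leaves t) [::] i).
Definition sseq (t : set word) (i : nat) : nat :=
  card [set v | t v /\ lexlt v (lseq t i)].
Definition pseq (t : set word) (i : nat) : nat := size (lseq t i).

Definition is_Phi321 (t : tree) (f : posnat -> posnat) : Prop :=
  let D := [set x : posnat | exists2 i : nat, (1 <= i)%N &
              Posz (val x) = (Posz (sseq t i) - Posz (pseq t i) + 1)%R] in
  let E := [set y : posnat | exists2 i : nat, (1 <= i)%N & val y = sseq t i] in
  [/\ (forall (i : nat) (x : posnat), (1 <= i)%N ->
         Posz (val x) = (Posz (sseq t i) - Posz (pseq t i) + 1)%R ->
         val (f x) = sseq t i),
      set_bij (~` D) (~` E) f &
      forall x y : posnat, (~` D) x -> (~` D) y ->
        (val x < val y)%N -> (val (f x) < val (f y))%N].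

(* On [Tinfty] the function specified by [is_Phi321] exists and is unique. *)
Definition Phi321_fun (t : tree) : posnat -> posnat :=
  xget (fun=> mkpos 0) (is_Phi321 t).

Definition Phi321 (t : tree) : fun_space :=
  fun i : posnat => Some (Phi321_fun t i).

Definition Phi123 (t : tree) : fun_space := fun i : posnat =>
  to_posnat_star (ext_card t - zpos (Phi321_fun t i))%E.

(* The last case is 123. *)
Definition Phi (s : 'S_3) : tree -> fun_space :=
  match one_line s with
  | [:: 2; 3; 1] => Phi231
  | [:: 2; 1; 3] => Phi213
  | [:: 3; 1; 2] => Phi312
  | [:: 1; 3; 2] => Phi132
  | [:: 3; 2; 1] => Phi321
  | _ => Phi123
  end.

Definition borel (X : ptopologicalType) : measurableType _ :=
  g_sigma_algebraType (@open X).

Definition uniform_on (d : measure_display) (Om : measurableType d)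
    (R : realType) (P : probability Om R) (T : finType) (X : Om -> T)
    (A : {set T}) : Prop :=
  forall x : T, measurable (X @^-1` [set x]) /\
    P (X @^-1` [set x]) =
      (if x \in A then (#|A|%:R^-1 : R)%:E else 0)%E.

Definition cvg_in_distribution (R : realType) (X : topologicalType)
    (dn : nat -> measure_display) (Omn : forall n, measurableType (dn n))
    (Pn : forall n, probability (Omn n) R) (Yn : forall n, Omn n -> X)
    (d : measure_display) (Om : measurableType d)
    (P : probability Om R) (Y : Om -> X) : Prop :=
  forall g : X -> R, continuous g -> bounded_fun g ->
    ('E_(Pn n)[g \o Yn n] @[n --> \oo] --> 'E_P[g \o Y])%E.

(* [xi] is the offspring distribution. *)
Definition is_GW (R : realType) (xi : nat -> R) (d : measure_display)
    (Om : measurableType d) (P : probability Om R)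
    (T : {RV P >-> borel tree}) : Prop :=
  forall t : tree, finite_set t ->
    P [set w | T w = t] =
      (\prod_(u <- fset_set t) xi (absz (deg t u)))%R%:E.

(* [T'] is size-biased with respect to the Galton-Watson tree [T]; the two may
   live on different probability spaces. *)
Definition is_size_biased (R : realType)
    (d : measure_display) (Om : measurableType d) (P : probability Om R)
    (T : {RV P >-> borel tree})
    (d' : measure_display) (Om' : measurableType d') (P' : probability Om' R)
    (T' : {RV P' >-> borel tree}) : Prop :=
  {ae P', forall w, infinite_set (vertices (T' w))} /\
  forall (k : nat) (t0 : tree), has_height t0 k ->
    P' [set w | trunc k (T' w : tree) = t0] =
      ((card (level k t0))%:R%:E * P [set w | trunc k (T w : tree) = t0])%E.

Definition geometric_half (R : realType) (i : nat) : R := (2 ^- i.+1)%R.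

(* Main.v *)
Require Import Defs.
From HB Require Import structures.
From mathcomp Require Import all_boot all_order all_algebra all_fingroup finmap.
From mathcomp Require Import all_classical all_reals all_analysis measurable_realfun.
From mathcomp Require Import zify ring lra.

(** Why the theorem holds.

    For each of the six patterns there is a bijection between the plane trees
    with [n] edges and the permutations of size [n] that avoid the pattern. For
    231, list the postorder ranks of the non-root vertices in preorder
    ([perm_Av231]). For 321, record how many vertices have been discovered each
    time the contour of the tree completes a vertex: this staircase jumps once
    for every leaf, and it is the running maximum of exactly one permutation that
    avoids 321 ([perm_Av321]). The other four patterns follow by reversing
    positions and complementing values.

    These bijections are local. On finite trees they are given by the formulas
    that define the maps [Phi] on infinite trees, and at an infinite tree with a
    single spine each value either depends on finitely many vertices only, or is
    infinite and becomes large on nearby finite trees. So the permutations of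
    large finite trees that agree with [t] up to a large height are close to
    [Phi sigma t] ([local_encoding_exists]).

    It remains to see that the uniform plane tree with [n] edges converges
    locally to the size-biased tree. A plane tree that begins with a given tree
    [t0] of height [k] is [t0] with a forest grafted on its [lev k t0] highest
    vertices; such forests are counted by ballot numbers, and the ratio of these
    to the Catalan numbers tends to [lev k t0 * wt k t0], where [wt k t0] is the
    probability that the Galton-Watson tree begins with [t0]
    ([cvg_prefix_ratio]). This is the mass that the size-biased law gives to the
    trees that begin with [t0].

    Throughout, only lower bounds on the masses of cylinders are established.
    They suffice: as all laws have total mass 1, lower bounds on finitely many
    disjoint cells that nearly exhaust the limit law determine the expectation of
    a bounded function which is nearly constant on each cell
    ([expectation_approx], [cvg_expectation]). In the same way, the size-biased
    tree has a single spine with infinitely many trees of the required kinds on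
    both sides because the finite trees with a marked path on which a suitable
    pattern occurs have a total mass close to 1 ([mass_ge_good],
    [good_event_full]). *)

Set Implicit Arguments.
Unset Strict Implicit.
Unset Printing Implicit Defensive.

Import Order.TTheory GRing.Theory Num.Theory numFieldNormedType.Exports.

Local Notation card := Defs.card.

(** * Finite plane trees *)

Inductive ptree := Node of seq ptree.

HB.instance Definition _ := gen_eqMixin ptree.
HB.instance Definition _ := gen_choiceMixin ptree.

Definition pleaf := Node [::].
Definition kids (t : ptree) : seq ptree := let: Node s := t in s.

Fixpoint nodes (t : ptree) : nat := let: Node s := t in (sumn (map nodes s)).+1.
Definition fsize (f : seq ptree) : nat := sumn (map nodes f).

Lemma nodesE s : nodes (Node s) = (fsize s).+1. Proof. by []. Qed.
Lemma nodes_gt0 t : 0 < nodes t. Proof. by case: t. Qed.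
Lemma fsize_cons x s : fsize (x :: s) = nodes x + fsize s. Proof. by []. Qed.
Lemma fsize_cat s1 s2 : fsize (s1 ++ s2) = fsize s1 + fsize s2.
Proof. by rewrite /fsize map_cat sumn_cat. Qed.

Lemma size_fsize s : size s <= fsize s.
Proof.
by elim: s => //= x s IH; rewrite fsize_cons -add1n leq_add ?nodes_gt0.
Qed.

Lemma ptree_ind_in (Q : ptree -> Prop) :
  (forall s, (forall x, x \in s -> Q x) -> Q (Node s)) -> forall t, Q t.
Proof.
move=> H t; have [n] := ubnP (nodes t); elim: n t => // n IH [s] lt_s.
apply: H => x /(nthP pleaf)[i lti <-]; apply: IH.
apply: leq_ltn_trans (_ : fsize s < n) => //.
by elim: s i lti {lt_s} => //= y s IHs [|i] /= lti;
  rewrite fsize_cons ?leq_addr // (leq_trans (IHs _ lti)) ?leq_addl.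
Qed.

(** The first-return decomposition of Dyck paths. Preorder and postorder
    statistics are defined along it, so most of their properties are proved by
    this induction. *)
Lemma forest_ind (Q : seq ptree -> Prop) :
  Q [::] -> (forall s1 s, Q s1 -> Q s -> Q (Node s1 :: s)) -> forall s, Q s.
Proof.
move=> H0 H1 s; have [n] := ubnP (fsize s).
elim: n s => // n IH [|[s1] s] //; rewrite fsize_cons nodesE => lt_n.
by apply: H1; apply: IH; lia.
Qed.

Fixpoint lev (k : nat) (t : ptree) : nat :=
  if k is k'.+1 then sumn (map (lev k') (kids t)) else 1.

(** The bound [k] on the heights of the vertices is strict, so that [low 0] is
    empty and truncations at height [k] satisfy [low k.+1]. *)
Fixpoint low (k : nat) (t : ptree) : bool :=
  if k is k'.+1 then all (low k') (kids t) else false.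

Fixpoint truncp (k : nat) (t : ptree) : ptree :=
  if k is k'.+1 then Node (map (truncp k') (kids t)) else pleaf.

Lemma lowS k t : low k t -> low k.+1 t.
Proof.
elim: k t => // k IH t /= /allP H; apply/allP => x /H; exact: IH.
Qed.

Lemma low_leq k l t : k <= l -> low k t -> low l t.
Proof. by move=> /subnK <-; elim: (l - k) => // n IH /IH /lowS. Qed.

Lemma low_nodes t : low (nodes t) t.
Proof.
elim/ptree_ind_in: t => s IH; rewrite nodesE /=; apply/allP => x xs.
apply: low_leq (IH _ xs); elim: s xs {IH} => // y s IHs.
rewrite inE fsize_cons => /orP[/eqP <-|/IHs]; first exact: leq_addr.
by move=> h; apply: leq_trans h (leq_addl _ _).
Qed.

Lemma truncp_id k t : low k.+1 t -> truncp k t = t.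
Proof.
elim: k t => [|k IH] [s].
  by move=> /= /allP H; congr Node; case: s H => // x s /(_ x (mem_head _ _)).
rewrite [low _ _]/= => /allP H /=; congr Node.
by rewrite -[RHS]map_id; apply/eq_in_map => x /H /IH.
Qed.

(** ** Grafting *)

(** Every tree that begins with [t] is obtained from [t], whose highest
    vertices have height [k], by replacing these vertices by the trees of a
    list [l] of length [lev k t]. The local fixpoint is [graftF k'], inlined
    because [graftF] in turn depends on [graft]. *)
Fixpoint graft (k : nat) (t : ptree) (l : seq ptree) : ptree :=
  if k is k'.+1 then
    Node ((fix graftF (s l : seq ptree) : seq ptree :=
       if s is x :: s' then
         graft k' x (take (lev k' x) l) :: graftF s' (drop (lev k' x) l)
       else [::]) (kids t) l)
  else head pleaf l.

Fixpoint graftF (k : nat) (s l : seq ptree) : seq ptree :=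
  if s is x :: s' then
    graft k x (take (lev k x) l) :: graftF k s' (drop (lev k x) l)
  else [::].

Lemma graftS k s l : graft k.+1 (Node s) l = Node (graftF k s l).
Proof. by congr Node; elim: s l => //= x s IH l; rewrite IH. Qed.

Lemma truncp_graft k t l :
  low k.+1 t -> size l = lev k t -> truncp k (graft k t l) = t.
Proof.
elim: k t l => [|k IH] [s] l.
  by move=> /allP H _; rewrite /= /pleaf; case: s H => // x s /(_ x (mem_head _ _)).
rewrite [low _ _]/= graftS /= => H sl; congr Node.
elim: s l H sl => //= x s IHs l /andP[Hx Hs] sl.
by rewrite IH ?IHs // ?size_drop ?size_takel ?sl ?addKn ?leq_addr.
Qed.

Lemma nodes_graft k t l : low k.+1 t -> size l = lev k t ->
  nodes (graft k t l) + lev k t = nodes t + fsize l.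
Proof.
elim: k t l => [|k IH] [s] l.
  move=> /allP H; case: s H => [_|x s /(_ x (mem_head _ _))] //.
  by case: l => // x [] //= _; rewrite /fsize /= addn0 addnC.
rewrite [low _ _]/= graftS !nodesE /= => H sl.
rewrite !addSn; congr _.+1.
elim: s l H sl => /= [|x s IHs] l; first by case: l.
move=> /andP[Hx Hs] sl; have sx : lev k x <= size l by rewrite sl leq_addr.
have := IH x (take (lev k x) l) Hx; rewrite size_takel // => /(_ erefl).
have := IHs (drop (lev k x) l) Hs; rewrite size_drop sl addKn => /(_ erefl).
have : fsize l = fsize (take (lev k x) l) + fsize (drop (lev k x) l).
  by rewrite -fsize_cat cat_take_drop.
rewrite !fsize_cons; lia.
Qed.

Lemma graft_inj k t l l' : low k.+1 t -> size l = lev k t ->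
  size l' = lev k t -> graft k t l = graft k t l' -> l = l'.
Proof.
elim: k t l l' => [|k IH] [s] l l'.
  by move=> _; case: l => // x [] //; case: l' => // y [] //= _ _ ->.
rewrite [low _ _]/= !graftS /= => H sl sl' [].
elim: s l l' H sl sl' => /= [|x s IHs] l l'; first by case: l; case: l'.
move=> /andP[Hx Hs] sl sl' [E1 E2].
rewrite -[l](cat_take_drop (lev k x)) -[l'](cat_take_drop (lev k x)).
congr cat.
  by apply: (IH _ _ _ Hx) => //; rewrite size_takel // ?sl ?sl' leq_addr.
by apply: IHs => //; rewrite size_drop ?sl ?sl' addKn.
Qed.

(** ** Counting forests *)

(** The inverse of cutting the edge from the first root to its first child. *)
Definition sprout (f : seq ptree) : seq ptree :=
  if f is x :: Node s :: r then Node (x :: s) :: r else [::].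

(** The forests with [m] trees and [e] edges. Either the first tree is a
    single vertex, or cutting the edge to its first child leaves a forest with
    one more tree and one edge less. This recursion, rather than the one that
    splits off the first tree, makes the count satisfy the ballot recurrence,
    which has no convolution. *)
Fixpoint forests (m e : nat) {struct e} : seq (seq ptree) :=
  let step (prev : nat -> seq (seq ptree)) (base : seq (seq ptree)) :=
    fix go (m : nat) : seq (seq ptree) :=
      if m is m'.+1 then map (cons pleaf) (go m') ++ map sprout (prev m'.+2)
      else base in
  if e is e'.+1 then step (forests^~ e') [::] m
  else step (fun=> [::]) [:: [::]] m.

Lemma forests00 : forests 0 0 = [:: [::]]. Proof. by []. Qed.
Lemma forestsS0 m : forests m.+1 0 = map (cons pleaf) (forests m 0).
Proof. by rewrite /= cats0. Qed.
Lemma forests0S e : forests 0 e.+1 = [::]. Proof. by []. Qed.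
Lemma forestsSS m e : forests m.+1 e.+1 =
  map (cons pleaf) (forests m e.+1) ++ map sprout (forests m.+2 e).
Proof. by []. Qed.

Lemma mem_forests m e f :
  (f \in forests m e) = (size f == m) && (fsize f == m + e).
Proof.
elim: e m f => [|e IHe].
  elim=> [|m IHm] f; first by rewrite forests00 inE; case: f.
  rewrite forestsS0; apply/mapP/andP => [[g + ->]|[/eqP sf /eqP ff]].
    by rewrite IHm => /andP[/eqP /= -> /eqP]; rewrite fsize_cons /= => ->.
  case: f sf ff => //= -[[|y s]] r /= [sr]; rewrite fsize_cons /= => ff.
    by exists r => //; rewrite IHm sr eqxx /=; apply/eqP; move: ff; rewrite !addn0 add1n => -[].
  have := size_fsize r; have := nodes_gt0 y; lia.
elim=> [|m IHm] f; first by rewrite forests0S; case: f.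
rewrite forestsSS mem_cat; apply/orP/andP.
  case=> /mapP[g + ->].
    by rewrite IHm => /andP[/eqP <- /eqP]; rewrite fsize_cons /= => ->.
  rewrite IHe; case: g => [|x [|[s] r]] //= /andP[/eqP[<-]].
  by rewrite !fsize_cons !nodesE !fsize_cons => /eqP E; split => //; apply/eqP; lia.
move=> [/eqP sf /eqP ff].
case: f sf ff => //= -[[|y s]] r /= [sr]; rewrite fsize_cons nodesE => ff.
  left; apply/mapP; exists r => //; rewrite IHm sr eqxx /=; apply/eqP.
  by move: ff; rewrite /fsize /= add1n => -[->]; lia.
right; apply/mapP; exists (y :: Node s :: r) => //.
rewrite IHe /= sr eqxx /=; apply/eqP; move: ff; rewrite !fsize_cons nodesE; lia.
Qed.

Lemma forests_uniq m e : uniq (forests m e).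
Proof.
elim: e m => [|e IHe]; elim=> [|m IHm] //.
  by rewrite forestsS0 map_inj_uniq // => x y [].
rewrite forestsSS cat_uniq; apply/and3P; split.
- by rewrite map_inj_uniq // => x y [].
- apply/hasPn => f /mapP[g +->]; rewrite mem_forests => /andP[/eqP sg _].
  by apply/mapP => -[h _]; case: g sg => [|x [|[s] r]].
rewrite map_inj_in_uniq // => f g; rewrite !mem_forests.
case: f => [|x [|[s] r]]; case: g => [|y [|[t] q]] //=; rewrite ?andbF //.
by move=> _ _ [-> -> ->].
Qed.

(** The ballot numbers; [ballot 1 n] is the [n]-th Catalan number. *)
Definition ballot (m e : nat) : nat := size (forests m e).

Lemma ballotSS m e : ballot m.+1 e.+1 = ballot m e.+1 + ballot m.+2 e.
Proof. by rewrite /ballot forestsSS size_cat !size_map. Qed.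

Lemma ballot0S e : ballot 0 e.+1 = 0. Proof. by []. Qed.

Lemma ballot_m0 m : ballot m 0 = 1.
Proof. by elim: m => // m IH; rewrite /ballot forestsS0 size_map. Qed.

(** The closed form of the ballot numbers, cleared of its denominator. *)
Lemma ballot_bin m e : ballot m e * (m + 2 * e) = m * 'C(m + 2 * e, e).
Proof.
elim: e m => [|e IHe] m.
  by rewrite ballot_m0 muln0 addn0 bin0 mul1n muln1.
elim: m => [|m IHm] //; rewrite ballotSS.
have EN : m + 2 * e.+1 = m.+2 + 2 * e by lia.
have -> : m.+1 + 2 * e.+1 = (m.+2 + 2 * e).+1 by lia.
rewrite EN in IHm; move: (IHe m.+2) (mul_bin_left (m.+2 + 2 * e) e).
rewrite (_ : m.+2 + 2 * e - e = m.+2 + e); last by lia.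
rewrite binS; move: 'C(_, e.+1) 'C(_, e) IHm => a b H0 H1 H2.
apply/eqP; rewrite -(@eqn_pmul2r (m.+2 + 2 * e)) //; apply/eqP.
have -> : (ballot m e.+1 + ballot m.+2 e) * (m.+2 + 2 * e).+1 * (m.+2 + 2 * e)
        = (m.+2 + 2 * e).+1 * (m * a + m.+2 * b) by rewrite -H0 -H1; lia.
nia.
Qed.

Lemma catalan_rec n : n.+2 * ballot 1 n.+1 = (4 * n + 2) * ballot 1 n.
Proof.
have := ballot_bin 1 n; have := ballot_bin 1 n.+1; rewrite !mul1n.
have := mul_bin_diag (2 * n + 3) n; have := mul_bin_down (2 * n + 2) n.
rewrite (_ : (2 * n + 3).-1 = 2 * n + 2); last by lia.
rewrite (_ : (2 * n + 2).-1 = 1 + 2 * n); last by lia.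
rewrite (_ : 2 * n + 2 - n = n.+2); last by lia.
rewrite (_ : 1 + 2 * n.+1 = 2 * n + 3); last by lia.
move: 'C(1 + _, _) 'C(2 * n + 2, _) 'C(_, n.+1) => a b c Hb Hc H1 H0.
apply/eqP; rewrite -(@eqn_pmul2r (1 + 2 * n)) //; apply/eqP.
rewrite -[RHS]mulnA H0.
apply/eqP; rewrite -(@eqn_pmul2r (2 * n + 3)) //; last by lia.
apply/eqP; nia.
Qed.

(** ** Asymptotics of the ballot numbers *)

Section ballot_asymptotics.
Variable R : realType.
Local Open Scope ring_scope.
Local Open Scope classical_set_scope.

Local Notation cat n := ((ballot 1 n)%:R : R).

Lemma ballot1_gt0 n : (0 < ballot 1 n)%N.
Proof.
have := ballot_bin 1 n; case: ballot => //; rewrite mul0n mul1n => /esym/eqP.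
by rewrite eqn0Ngt bin_gt0; lia.
Qed.

Lemma catalan_neq0 n : cat n != 0.
Proof. by rewrite pnatr_eq0 -lt0n ballot1_gt0. Qed.

Lemma cvg_catalan_ratio : cat n.+1 / cat n @[n --> \oo] --> (4 : R).
Proof.
have -> : (fun n => cat n.+1 / cat n) = (fun n => 4 - 6 * (n.+2%:R)^-1).
  apply/funext => n; have := congr1 (fun k => k%:R : R) (catalan_rec n).
  rewrite !natrM natrD natrM => E.
  have n0 : n.+2%:R != 0 :> R by rewrite pnatr_eq0.
  apply: (mulfI n0); rewrite mulrA E mulfK ?catalan_neq0 //.
  by rewrite mulrBr [X in _ - X]mulrCA divff // -natr1 -natr1; ring.
rewrite -[X in _ --> X]subr0; apply: cvgB; first exact: cvg_cst.
rewrite -[X in _ --> X](mulr0 6); apply: cvgMr.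
have := @cvg_harmonic R; rewrite -(cvg_shiftS (harmonic : R^nat)).
by apply: cvg_trans; apply: near_eq_cvg; apply: nearW.
Qed.

(** The recurrence [ballotSS] gives the ratio for [m.+2] from the ratios for
    [m] and [m.+1], once consecutive Catalan numbers are known to have a ratio
    that tends to 4. *)
Lemma cvg_ballot m :
  (ballot m n)%:R / cat n @[n --> \oo] --> (m%:R * 2 ^+ m / 2 : R).
Proof.
suff: ((ballot m n)%:R / cat n @[n --> \oo] --> (m%:R * 2 ^+ m / 2 : R)) /\
  ((ballot m.+1 n)%:R / cat n @[n --> \oo] --> (m.+1%:R * 2 ^+ m.+1 / 2 : R)).
  by case.
elim: m => [|m [IH0 IH1]].
  split.
    rewrite mul0r mul0r -(cvg_shiftS (fun n => (ballot 0 n)%:R / cat n)).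
    under eq_fun do rewrite ballot0S mul0r.
    exact: cvg_cst.
  rewrite (_ : 1 * 2 ^+ 1 / 2 = 1 :> R); last by field.
  under eq_fun do rewrite divff ?catalan_neq0 //.
  exact: cvg_cst.
split => //.
have E n : (ballot m.+2 n)%:R / cat n =
  ((ballot m.+1 n.+1)%:R / cat n.+1 - (ballot m n.+1)%:R / cat n.+1) *
  (cat n.+1 / cat n).
  rewrite -mulrBl ballotSS natrD addrC addKr mulrA mulfVK ?catalan_neq0 //.
rewrite (funext E).
rewrite [X in _ --> X](_ : _ =
    (m.+1%:R * 2 ^+ m.+1 / 2 - m%:R * 2 ^+ m / 2) * 4); last first.
  by rewrite !exprS -[m.+2%:R]natr1 -[m.+1%:R]natr1; field.
apply: cvgM; last exact: cvg_catalan_ratio.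
apply: cvgB.
  by move: IH1; rewrite -(cvg_shiftS (fun n => (ballot m.+1 n)%:R / cat n)).
by move: IH0; rewrite -(cvg_shiftS (fun n => (ballot m n)%:R / cat n)).
Qed.

Lemma cvg_ballot_shift m E : (ballot m (n - E)%N)%:R / cat n @[n --> \oo]
  --> (m%:R * 2 ^+ m / 2 / 4 ^+ E : R).
Proof.
pose u n : R := (ballot m n)%:R / cat (n + E)%N.
suff cu : u @ \oo --> (m%:R * 2 ^+ m / 2 / 4 ^+ E : R).
  have := cu; rewrite -(cvg_centern E); apply: cvg_trans.
  apply: near_eq_cvg; near=> n.
  by rewrite /u /= subnK //; near: n; exact: nbhs_infty_ge.
rewrite {}/u; elim: E => [|E IH].
  rewrite expr0 divr1; under eq_fun do rewrite addn0; exact: cvg_ballot.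
have -> : (fun n => (ballot m n)%:R / cat (n + E.+1)) =
   (fun n => (ballot m n)%:R / cat (n + E) / (cat (n + E).+1 / cat (n + E)) : R).
  by apply/funext => n; rewrite invf_div addnS mulrA mulfVK ?catalan_neq0.
rewrite [X in _ --> X](_ : _ = m%:R * 2 ^+ m / 2 / 4 ^+ E / 4); last first.
  by rewrite exprS; field; rewrite expf_neq0.
apply: cvgM => //; apply: cvgV => //.
have := cvg_catalan_ratio.
by rewrite -(cvg_shiftn E (fun n => cat n.+1 / cat n)).
Unshelve. all: by end_near. Qed.

End ballot_asymptotics.

(** * Weights of finite trees *)

Section mass.
Variable R : realType.
Local Open Scope ring_scope.
Local Open Scope classical_set_scope.

(** The sum of the nonnegative family [w] over [Q] is at least [c]. The masses
    below are those of probability laws, so that a bound [mass_ge w Q 1] is an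
    equality; working with lower bounds avoids all questions of summability. *)
Definition mass_ge (X : choiceType) (w : X -> R) (Q : pred X) (c : R) : Prop :=
  forall e, 0 < e -> exists F : seq X,
    [/\ uniq F, all Q F & c - e <= \sum_(x <- F) w x].

Section mass_theory.
Variables (X : choiceType) (w : X -> R) (Q : pred X).

Lemma mass_ge_le c c' : c' <= c -> mass_ge w Q c -> mass_ge w Q c'.
Proof.
by move=> cc' H e /H[F [uF QF sF]]; exists F; split => //; rewrite (le_trans _ sF) ?lerB.
Qed.

Lemma mass_ge_sub (Q' : pred X) c :
  (forall x, Q x -> Q' x) -> mass_ge w Q c -> mass_ge w Q' c.
Proof.
move=> QQ' H e /H[F [uF QF sF]]; exists F; split => //.
by apply: sub_all QF => x; exact: QQ'.
Qed.

Lemma mass_ge_lim c :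
  (forall e, 0 < e -> mass_ge w Q (c - e)) -> mass_ge w Q c.
Proof.
move=> H e e0; have e20 : 0 < e / 2 by rewrite divr_gt0.
have [F [uF QF sF]] := H _ e20 _ e20; exists F; split => //.
by apply: le_trans sF; rewrite -addrA -opprD -splitr.
Qed.

Lemma mass_ge0 : mass_ge w Q 0.
Proof. by move=> e e0; exists [::]; rewrite big_nil sub0r oppr_le0 ltW. Qed.

Lemma mass_ge1 x : Q x -> mass_ge w Q (w x).
Proof.
by move=> Qx e e0; exists [:: x]; rewrite big_seq1 /= Qx gerBl ltW.
Qed.

Lemma mass_geD (Q1 Q2 : pred X) c1 c2 :
  (forall x, Q1 x -> Q x) -> (forall x, Q2 x -> Q x) ->
  (forall x, Q1 x -> ~~ Q2 x) ->
  mass_ge w Q1 c1 -> mass_ge w Q2 c2 -> mass_ge w Q (c1 + c2).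
Proof.
move=> sQ1 sQ2 dQ H1 H2 e e0; have e20 : 0 < e / 2 by rewrite divr_gt0.
have [F1 [u1 /allP q1 s1]] := H1 _ e20; have [F2 [u2 /allP q2 s2]] := H2 _ e20.
exists (F1 ++ F2); split.
- rewrite cat_uniq u1 u2 andbT; apply/hasPn => x /q2 Q2x.
  by apply/negP => /q1 /dQ; rewrite Q2x.
- by rewrite all_cat; apply/andP; split; apply/allP => x; [move/q1/sQ1|move/q2/sQ2].
by rewrite big_cat /=; lra.
Qed.

Hypothesis w0 : forall x, 0 <= w x.

Lemma mass_ge_rem c x :
  mass_ge w Q c -> mass_ge w (fun y => Q y && (y != x)) (c - w x).
Proof.
move=> H e /H[F [uF /allP QF sF]]; exists [seq y <- F | y != x]; split.
- exact: filter_uniq.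
- by apply/allP => y; rewrite mem_filter => /andP[-> /QF ->].
suff : \sum_(y <- F) w y <= w x + \sum_(y <- F | y != x) w y.
  by rewrite big_filter; lra.
have [xF|xF] := boolP (x \in F); first by rewrite (bigD1_seq x).
rewrite [leRHS](_ : _ = w x + \sum_(y <- F) w y) ?lerDr //.
congr (_ + _); rewrite [LHS]big_mkcond [RHS]big_seq [LHS]big_seq.
by apply: eq_bigr => y yF; case: eqP => // yx; rewrite -yx yF in xF.
Qed.

End mass_theory.

Lemma mass_ge_map_in (X Y : choiceType) (f : X -> Y) (w : X -> R) (w' : Y -> R)
    (Q : pred X) (Q' : pred Y) c :
  {in Q &, injective f} -> (forall x, Q x -> Q' (f x)) ->
  (forall x, Q x -> w' (f x) = w x) -> mass_ge w Q c -> mass_ge w' Q' c.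
Proof.
move=> fi fQ fw H e /H[F [uF /allP QF sF]]; exists (map f F); split.
- by rewrite map_inj_in_uniq // => x y /QF Qx /QF Qy; exact: fi.
- by rewrite all_map; apply/allP => x /QF /fQ.
rewrite big_map (le_trans sF) // big_seq [leRHS]big_seq ler_sum // => x.
by move=> /QF /fw ->.
Qed.

Lemma mass_ge_map (X Y : choiceType) (f : X -> Y) (w : X -> R) (w' : Y -> R)
    (Q : pred X) (Q' : pred Y) c :
  injective f -> (forall x, Q x -> Q' (f x)) ->
  (forall x, Q x -> w' (f x) = w x) -> mass_ge w Q c -> mass_ge w' Q' c.
Proof. by move=> fi; apply: mass_ge_map_in => x y _ _; exact: fi. Qed.

Lemma mass_geZ (X : choiceType) (w : X -> R) (Q : pred X) a c :
  0 <= a -> mass_ge w Q c -> mass_ge (fun x => a * w x) Q (a * c).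
Proof.
move=> a0 H e e0; have a10 : 0 < a + 1 by rewrite ltr_wpDl.
have [F [uF QF sF]] := H _ (divr_gt0 e0 a10).
exists F; split => //; rewrite -mulr_sumr.
apply: le_trans (ler_wpM2l a0 sF); rewrite mulrBr lerB // mulrCA ger_pMr //.
by rewrite ler_pdivrMr // mul1r lerDl.
Qed.

Lemma mass_geM (X Y : choiceType) (w : X -> R) (w' : Y -> R)
    (Q : pred X) (Q' : pred Y) c c' :
  0 <= c -> 0 <= c' -> mass_ge w Q c -> mass_ge w' Q' c' ->
  mass_ge (fun p : X * Y => w p.1 * w' p.2) (fun p => Q p.1 && Q' p.2) (c * c').
Proof.
rewrite le_eqVlt => /predU1P[<-|c0]; first by rewrite mul0r => *; exact: mass_ge0.
rewrite le_eqVlt => /predU1P[<-|c0']; first by rewrite mulr0 => *; exact: mass_ge0.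
move=> H H' e e0; pose d := Num.min (Num.min c c') (e / (c + c')).
have cc0 : 0 < c + c' by rewrite addr_gt0.
have d0 : 0 < d by rewrite !lt_min c0 c0' divr_gt0.
have [F [uF /allP QF sF]] := H _ d0; have [F' [uF' /allP QF' sF']] := H' _ d0.
exists [seq (x, y) | x <- F, y <- F']; split.
- by apply: allpairs_uniq => // -[x y] [x' y'].
- by apply/allP => _ /allpairsP[[x y] [/QF Qx /QF' Qy ->]] /=; rewrite Qx.
rewrite big_allpairs /=; under eq_bigr do rewrite -mulr_sumr.
rewrite -mulr_suml.
have dc : d <= c by rewrite !ge_min lexx.
have dc' : d <= c' by rewrite !ge_min lexx orbT.
have de : d * (c + c') <= e by rewrite -ler_pdivlMr // !ge_min lexx !orbT.
apply: le_trans (_ : (c - d) * (c' - d) <= _).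
  by rewrite mulrBl !mulrBr; nra.
by apply: ler_pM => //; rewrite subr_ge0.
Qed.

(** A Geometric(1/2) number of independent trees, each of mass [c], has mass
    [1 / (2 - c)], the value at [c] of the generating function. Splitting off
    the first tree turns a lower bound [b] into [1 / 2 + c * b / 2], and the
    iterates of this contraction tend to its fixed point [1 / (2 - c)]. *)
Lemma mass_ge_forest (X : choiceType) (w : X -> R) (Q : pred X) c :
  0 <= c <= 1 -> mass_ge w Q c ->
  mass_ge (fun s => 2^-1 ^+ (size s).+1 * \prod_(x <- s) w x) (all Q) (2 - c)^-1.
Proof.
move=> /andP[c0 c1] H; set W := fun s => _.
have c2 : 2 - c != 0 by rewrite subr_eq0 gt_eqF //; lra.
suff Hn n : mass_ge W (all Q) ((2 - c)^-1 - 2^-1 ^+ n).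
  apply: mass_ge_lim => e e0.
  have : (fun n => 2^-1 ^+ n : R) @ \oo --> (0 : R).
    by apply: cvg_expr; rewrite ger0_norm ?invr_ge0 // invf_lt1 // ltr1n.
  move=> /cvgrPdist_lt/(_ _ e0)[n _ /(_ n (leqnn n))].
  rewrite /= sub0r normrN ger0_norm ?exprn_ge0 // => lt_e.
  by apply: mass_ge_le (Hn n); rewrite lerB // ltW.
have ci : (2 - c)^-1 <= 1 by rewrite invf_le1 ?lerBrDr; lra.
elim: n => [|n IH].
  by apply: mass_ge_le (mass_ge0 _ _); rewrite expr0 subr_le0.
pose b := Num.max 0 ((2 - c)^-1 - 2^-1 ^+ n).
have b0 : 0 <= b by rewrite le_max lexx.
have {}IH : mass_ge W (all Q) b.
  by rewrite /b; case: (leP 0) => _ //; exact: mass_ge0.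
have Wc : mass_ge W (fun s => all Q s && (s != [::])) (2^-1 * (c * b)).
  pose q (p : X * seq X) := p.1 :: p.2.
  pose w' (p : X * seq X) := 2^-1 * (w p.1 * W p.2).
  apply: (@mass_ge_map _ _ q w' _ (fun p => Q p.1 && all Q p.2)).
  - by move=> [x s] [y t] [-> ->].
  - by move=> [x s] /= ->.
  - by move=> [x s] _; rewrite /w' /W /= big_cons exprS -!mulrA [w x * _]mulrCA.
  move=> e e0; have e20 : 0 < e * 2 by rewrite mulr_gt0.
  have [F [uF qF sF]] := mass_geM c0 b0 H IH e20; exists F; split => //.
  by rewrite -mulr_sumr; lra.
have W0 : mass_ge W (pred1 [::]) 2^-1.
  by have := @mass_ge1 _ W (pred1 [::]) [::] (eqxx _); rewrite /W big_nil expr1 mulr1.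
apply: (@mass_ge_le _ _ _ (2^-1 + 2^-1 * (c * b))).
  have : (2 - c)^-1 - 2^-1 ^+ n <= b by rewrite le_max lexx orbT.
  have : (2 - c)^-1 = 2^-1 + 2^-1 * (c * (2 - c)^-1) by field.
  have : 0 <= (2^-1 : R) ^+ n by rewrite exprn_ge0.
  rewrite exprS; move: (2^-1 ^+ n) (2 - c)^-1 => y z y0 zE zb.
  have : c * (z - y) <= c * b by rewrite ler_wpM2l.
  have : c * y <= y by rewrite ler_piMl.
  rewrite mulrBr; lra.
apply: mass_geD W0 Wc => s.
- by move/eqP ->.
- by move=> /andP[].
- by move/eqP ->.
Qed.

(** [wt k t] is the probability that a Geometric(1/2) Galton-Watson tree
    agrees with [t] below height [k]. *)
Fixpoint wt (k : nat) (t : ptree) : R :=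
  if k is k'.+1 then 2^-1 ^+ (size (kids t)).+1 * \prod_(x <- kids t) wt k' x
  else 1.

Lemma wt_ge0 k t : 0 <= wt k t.
Proof.
elim: k t => //= k IH t; rewrite mulr_ge0 ?exprn_ge0 ?invr_ge0 //.
by apply: prodr_ge0 => x _.
Qed.

Lemma wt_low k l t : low k t -> (k <= l)%N -> wt l t = wt k t.
Proof.
elim: k l t => // k IH [//|l] t /= /allP H kl; congr (_ * _).
by rewrite big_seq [RHS]big_seq; apply: eq_bigr => x /H /IH; exact.
Qed.

(** The probability that the Galton-Watson tree is [t]. *)
Definition wfull (t : ptree) : R := wt (nodes t) t.

Lemma wfullE k t : low k t -> wfull t = wt k t.
Proof.
move=> lt; rewrite /wfull.
by case: (leqP k (nodes t)) => h; [|symmetry]; apply: wt_low => //;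
  [exact: low_nodes|exact: ltnW].
Qed.

Lemma wfull_Node s :
  wfull (Node s) = 2^-1 ^+ (size s).+1 * \prod_(x <- s) wfull x.
Proof.
rewrite (wfullE (lowS (low_nodes _))) nodesE.
rewrite [wt _ _]/=; congr (_ * _); rewrite big_seq [RHS]big_seq.
apply: eq_bigr => x xs; rewrite (@wfullE (fsize s).+1 x) //.
by apply: lowS; move: (low_nodes (Node s)); rewrite nodesE => /allP; exact.
Qed.

(** The weight of a graft factorises: this is the branching property. *)
Lemma wfull_graft k t l : low k.+1 t -> size l = lev k t ->
  wfull (graft k t l) = wt k t * \prod_(x <- l) wfull x.
Proof.
elim: k t l => [|k IH] [s] l.
  by move=> _; case: l => // x [] //= _; rewrite big_seq1 mul1r.
rewrite [low _ _]/= graftS wfull_Node /= => H sl.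
have -> : size (graftF k s l) = size s by elim: s l {H sl} => //= x s IHs l; rewrite IHs.
rewrite -mulrA; congr (_ * _).
elim: s l H sl => /= [|x s IHs] l; first by case: l => // _ _; rewrite !big_nil mulr1.
move=> /andP[Hx Hs] sl; rewrite !big_cons IH //; last by rewrite size_takel ?sl ?leq_addr.
rewrite IHs // ?size_drop ?sl ?addKn // -[in RHS](cat_take_drop (lev k x) l).
by rewrite big_cat /= mulrACA.
Qed.

Lemma mass_ge_kids k (Q : pred ptree) c : 0 <= c <= 1 ->
  mass_ge (wt k) Q c -> mass_ge (wt k.+1) (fun t => all Q (kids t)) (2 - c)^-1.
Proof.
move=> c01 H; have := mass_ge_forest c01 H.
by apply: (@mass_ge_map _ _ Node) => // s t [].
Qed.

(** Iterating [x |-> 1 / (2 - x)] from [0] gives the extinction probabilities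
    [h / (h + 1)]. *)
Lemma mass_ge_low h : mass_ge (wt h) (low h) (h%:R / h.+1%:R).
Proof.
elim: h => [|h IH]; first by rewrite mul0r; exact: mass_ge0.
have h0 : (0 : R) <= h%:R by [].
have h01 : 0 <= (h%:R / h.+1%:R : R) <= 1.
  by rewrite divr_ge0 //= ler_pdivrMr ?ltr0n // mul1r ler_nat.
apply: mass_ge_le (@mass_ge_kids _ _ _ h01 IH).
by rewrite -!natr1 le_eqVlt; apply/orP; left; apply/eqP; field; rewrite !gt_eqF //; lra.
Qed.

(** Truncation at height [h] loses no mass: the generating function has the
    fixed point 1. *)
Lemma mass_ge_lowS h : mass_ge (wt h) (low h.+1) 1.
Proof.
elim: h => [|h IH]; first exact: (@mass_ge1 _ _ (low 1) pleaf).
have h01 : 0 <= (1 : R) <= 1 by rewrite ler01 lexx.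
apply: mass_ge_le (@mass_ge_kids _ _ _ h01 IH).
by rewrite (_ : 2 - 1 = 1) ?invr1 //; ring.
Qed.

(** The critical Galton-Watson tree is almost surely finite. *)
Lemma mass_ge_wfull : mass_ge wfull predT 1.
Proof.
apply: mass_ge_lim => e e0; pose h := Num.truncn e^-1.
have he : h.+1%:R^-1 < e.
  by rewrite invf_plt ?posrE ?ltr0n // truncnS_gt.
have [|F [uF QF sF]] := @mass_ge_low h (e - h.+1%:R^-1); first by rewrite subr_gt0.
move=> e' e'0; exists F; split => //; first by apply/allP.
have -> : \sum_(x <- F) wfull x = \sum_(x <- F) wt h x.
  rewrite big_seq [RHS]big_seq; apply: eq_bigr => x /(allP QF); exact: wfullE.
apply: le_trans sF; rewrite (_ : h%:R / h.+1%:R = 1 - h.+1%:R^-1); last first.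
  by rewrite -natr1; field; rewrite natr1 pnatr_eq0.
by rewrite opprB addrA subrK gerBl ltW.
Qed.

Lemma mass_ge_wfulls m :
  mass_ge (fun l => \prod_(x <- l) wfull x) (fun l => size l == m) 1.
Proof.
elim: m => [|m IH].
  have := @mass_ge1 _ (fun l => \prod_(x <- l) wfull x) (fun l => size l == 0%N) [::] isT.
  by rewrite big_nil.
have := mass_geM ler01 ler01 mass_ge_wfull IH; rewrite mulr1.
apply: (@mass_ge_map _ _ (fun p => p.1 :: p.2)).
- by move=> [x s] [y t] [-> ->].
- by move=> [x s] /=.
- by move=> [x s] _ /=; rewrite big_cons.
Qed.

(** By the branching property, the finite trees that begin with [t0] carry the
    whole probability [wt k t0] of that event. *)
Lemma mass_ge_graft k t0 : low k.+1 t0 ->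
  mass_ge wfull (fun t => truncp k t == t0) (wt k t0).
Proof.
move=> lt0; have := mass_geZ (wt_ge0 k t0) (@mass_ge_wfulls (lev k t0)).
rewrite mulr1; apply: (@mass_ge_map_in _ _ (graft k t0)).
- by move=> l l' /eqP sl /eqP sl'; exact: graft_inj.
- by move=> l /eqP sl; rewrite truncp_graft.
- by move=> l /eqP sl; rewrite wfull_graft.
Qed.

(** ** Trees with a marked spine *)

(** A finite tree with a distinguished highest vertex, given by the forests
    that hang to the left and to the right of the path from the root to it. *)
Definition marked : Type := seq (seq ptree * seq ptree).

Fixpoint build (sp : marked) : ptree :=
  if sp is (L, R0) :: sp' then Node (L ++ build sp' :: R0) else pleaf.

(** The trees attached to the path at heights less than [K] stay strictly
    below height [h], the height of the marked vertex, so that all vertices of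
    height [h] share their first [K] steps; the other trees may reach it. *)
Fixpoint shallow (K h : nat) (sp : marked) : bool :=
  match h, sp with
  | 0, [::] => K == 0
  | h'.+1, (L, R0) :: sp' =>
      let l := low (if K is 0 then h'.+1 else h') in
      [&& all l L, all l R0 & shallow K.-1 h' sp']
  | _, _ => false
  end.

Definition forest_pair_wt h (p : seq ptree * seq ptree) : R :=
  wt h.+1 (Node p.1) * wt h.+1 (Node p.2).

Lemma forest_pair_wt_ge0 h p : 0 <= forest_pair_wt h p.
Proof. by rewrite mulr_ge0 ?wt_ge0. Qed.

(** The offspring weight of a vertex of the path splits into those of its left
    and right forests, and the child on the path costs nothing: this is the
    size-biased offspring law. *)
Lemma wt_build h p sp :
  wt h.+1 (build (p :: sp)) = forest_pair_wt h p * wt h (build sp).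
Proof.
case: p => L R0; rewrite /forest_pair_wt /= size_cat /= big_cat big_cons /=.
by rewrite addnS -addSn -addnS exprD; ring.
Qed.

Lemma mass_ge_pair h (Q : pred ptree) c : 0 <= c <= 1 -> mass_ge (wt h) Q c ->
  mass_ge (forest_pair_wt h) (fun p => all Q p.1 && all Q p.2) ((2 - c)^-1 ^+ 2).
Proof.
move=> c01 H; have c20 : 0 <= (2 - c)^-1 by rewrite invr_ge0; lra.
have HN : mass_ge (fun s => wt h.+1 (Node s)) (all Q) (2 - c)^-1 by exact: mass_ge_forest.
by have := mass_geM c20 c20 HN HN.
Qed.

(** Masses multiply along the path, one step at a time. *)
Lemma mass_ge_cons h (Q : pred (seq ptree * seq ptree)) (Q1 Q2 : pred marked) c c' :
  0 <= c -> 0 <= c' -> (forall p sp, Q p -> Q1 sp -> Q2 (p :: sp)) ->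
  mass_ge (forest_pair_wt h) Q c -> mass_ge (fun sp => wt h (build sp)) Q1 c' ->
  mass_ge (fun sp => wt h.+1 (build sp)) Q2 (c * c').
Proof.
move=> c0 c0' QQ H1 H2; have := mass_geM c0 c0' H1 H2.
apply: (@mass_ge_map _ _ (fun p => p.1 :: p.2)).
- by move=> [x s] [y t] [-> ->].
- by move=> [p sp] /andP[]; exact: QQ.
- by move=> [p sp] _; exact: wt_build.
Qed.

(** The size-biased law has total mass one, seen on trees with a marked vertex
    of height [h]. *)
Lemma mass_ge_shallow0 h : mass_ge (fun sp => wt h (build sp)) (shallow 0 h) 1.
Proof.
elim: h => [|h IH]; first exact: (@mass_ge1 _ (fun sp => wt 0 (build sp)) (shallow 0 0) [::]).
have h01 : 0 <= (1 : R) <= 1 by rewrite ler01 lexx.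
have := @mass_ge_pair _ _ _ h01 (@mass_ge_lowS h); rewrite (_ : (2 - 1)^-1 ^+ 2 = 1 :> R); last by field.
move=> H; rewrite -[1]mulr1; apply: mass_ge_cons H IH => //.
by move=> [L R0] sp /= /andP[-> ->].
Qed.

End mass.

(** ** The mass of regular spines *)

Section spine_mass.
Variable R : realType.
Local Open Scope ring_scope.
Local Open Scope classical_set_scope.

Let wb h (sp : marked) : R := wt R h (build sp).

(** A critical tree reaches height [h] with probability of order [1 / h], so
    the trees attached to a given vertex of the path rarely do. *)
Lemma mass_ge_pair_low e : 0 < e -> exists h0, forall h, (h0 <= h)%N ->
  mass_ge (@forest_pair_wt R h) (fun p => all (low h) p.1 && all (low h) p.2)
    (1 - e).
Proof.
move=> e0; exists (Num.truncn (2 / e)).+1 => h h0h.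
have he : 2 / e < h.+1%:R.
  by rewrite (lt_le_trans (truncnS_gt _)) // ler_nat ltnW.
have hp : (0 : R) < h.+1%:R by rewrite ltr0n.
have h01 : 0 <= (h%:R / h.+1%:R : R) <= 1.
  by rewrite divr_ge0 //= ler_pdivrMr ?ltr0n // mul1r ler_nat.
apply: mass_ge_le (@mass_ge_pair R _ _ _ h01 (@mass_ge_low R h)).
have -> : (2 - h%:R / h.+1%:R)^-1 = 1 - (h.+2%:R)^-1 :> R.
  have h2 : (0 : R) < h.+2%:R by rewrite ltr0n.
  have E2 : h.+2%:R = h%:R + 1 + 1 :> R by rewrite !natr1.
  rewrite -[h.+1%:R]natr1 E2 in hp h2 *.
  by field; rewrite !gt_eqF.
apply: le_trans (_ : 1 - 2 * h.+2%:R^-1 <= _); last first.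
  have : 0 <= (h.+2%:R^-1 : R) ^+ 2 by [].
  by rewrite sqrrB expr1n mul1r; move: (h.+2%:R^-1 : R) => a; lra.
rewrite lerB // ler_pdivrMr ?ltr0n // mulrC -ler_pdivrMr // ltW //.
by rewrite (lt_le_trans he) // ler_nat.
Qed.

Lemma mass_ge_shallow K e : 0 < e -> exists h0, forall h, (h0 <= h)%N ->
  mass_ge (wb h) (shallow K h) (1 - e).
Proof.
elim: K e => [|K IH] e e0.
  exists 0%N => h _; apply: mass_ge_le (@mass_ge_shallow0 R h).
  by rewrite gerBl ltW.
pose d := Num.min e 1 / 2.
have d0 : 0 < d by rewrite divr_gt0 // lt_min e0 ltr01.
have d1 : d <= 2^-1 by rewrite ler_pdivrMr // mulVf // ge_min lexx orbT.
have de : d * 2 <= e by rewrite mulfVK // ge_min lexx.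
have [h1 H1] := IH _ d0; have [h2 H2] := mass_ge_pair_low d0.
exists (maxn h1 h2).+1 => -[|h] //; rewrite ltnS geq_max => /andP[hh1 hh2].
have d2 : 0 <= 1 - d by lra.
have M := @mass_ge_cons R h _ _ (shallow K.+1 h.+1) _ _ d2 d2 _ (H2 _ hh2) (H1 _ hh1).
apply: mass_ge_le (M _); first by nra.
by move=> [L R0] sp /= /andP[-> ->].
Qed.

(** The smallest configuration of spine neighbours that witnesses all three
    infinities asked of the limit tree: to the left, a tree with two vertices,
    to the right, a single vertex. *)
Definition pattern : seq ptree * seq ptree :=
  ([:: Node [:: pleaf]], [:: pleaf]).

Lemma wt_pattern h : forest_pair_wt R h.+2 pattern = 2^-1 ^+ 8.
Proof.
by rewrite /forest_pair_wt /=; do 3?rewrite /= !(big_cons, big_nil); ring.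
Qed.

Let c : R := 2^-1 ^+ 8.
Let c01 : 0 < c < 1.
Proof.
rewrite /c exprn_gt0 ?invr_gt0 //= exprn_ilt1 //; lra.
Qed.

(** Each of the first [j] vertices of the path shows the pattern with
    probability [c], independently of the others: split the event that one of
    them does according to the first vertex. *)
Lemma mass_ge_pattern j e : 0 < e -> exists h0, forall h, (h0 <= h)%N ->
  mass_ge (wb h) (fun sp => shallow j h sp && (pattern \in take j sp))
    (1 - (1 - c) ^+ j - e).
Proof.
have /andP[c0 c1] := c01.
elim: j e => [|j IH] e e0.
  exists 0%N => h _; apply: mass_ge_le (mass_ge0 _ _).
  by rewrite expr0 subrr sub0r oppr_le0 ltW.
pose d := Num.min (e / 2) (1 - c).
have d0 : 0 < d by rewrite lt_min divr_gt0 //= subr_gt0.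
have d1 : d <= 1 - c by rewrite ge_min lexx orbT.
have de : d * 2 <= e by rewrite -ler_pdivlMr // ge_min lexx.
have [h1 H1] := IH _ d0; have [h2 H2] := mass_ge_pair_low d0.
have [h3 H3] := mass_ge_shallow j d0.
exists (maxn (maxn h1 h2) h3).+3 => -[|[|[|h]]] //.
rewrite !ltnS !geq_max => /andP[/andP[hh1 hh2] hh3].
have d2 : 0 <= 1 - d by lra.
set z := 1 - (1 - c) ^+ j.
have z1 : z <= 1 by rewrite gerBl exprn_ge0 // subr_ge0 ltW.
pose b := Num.max 0 (z - d).
have b0 : 0 <= b by rewrite le_max lexx.
have b1 : b <= 1 by rewrite ge_max ler01; lra.
have bz : z - d <= b by rewrite le_max lexx orbT.
have leh h' : (h' <= h)%N -> (h' <= h.+2)%N by move=> *; lia.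
have {H1 IH}Hb : mass_ge (wb h.+2)
    (fun sp => shallow j h.+2 sp && (pattern \in take j sp)) b.
  by rewrite /b; case: (leP 0) => _; [exact: H1 (leh _ hh1)|exact: mass_ge0].
have P1 : mass_ge (@forest_pair_wt R h.+2) (pred1 pattern) c.
  by have := @mass_ge1 R _ (@forest_pair_wt R h.+2) (pred1 pattern) pattern (eqxx _); rewrite wt_pattern.
have P2 := @mass_ge_rem R _ _ _ (@forest_pair_wt_ge0 R h.+2) _ pattern (H2 _ (leh _ hh2)).
rewrite wt_pattern -/c in P2.
have c1d : 0 <= 1 - d - c by lra.
pose Q1 (sp : marked) := if sp is p :: sp' then (p == pattern) && shallow j h.+2 sp' else false.
pose Q2 (sp : marked) := if sp is p :: sp' then
  [&& all (low h.+2) p.1, all (low h.+2) p.2, p != pattern, shallow j h.+2 sp'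
    & pattern \in take j sp'] else false.
have M1 := @mass_ge_cons R h.+2 _ _ Q1 _ _ (ltW c0) d2 _ P1 (H3 _ (leh _ hh3)).
have M2 := @mass_ge_cons R h.+2 _ _ Q2 _ _ c1d b0 _ P2 Hb.
apply: (@mass_ge_le _ _ _ _ (c * (1 - d) + (1 - d - c) * b)).
  rewrite exprS; move: bz b1 d0 de; rewrite /z.
  move: ((1 - c) ^+ j) => y bz b1 d0 de.
  have : (1 - c) * (1 - y - d) <= (1 - c) * b by rewrite ler_wpM2l // subr_ge0 ltW.
  have : d * b <= d by rewrite ler_piMr // ltW.
  by rewrite !mulrBl !mulrBr; lra.
apply: mass_geD (M1 _) (M2 _).
- by move=> [|p sp] //= /andP[/eqP -> ->]; rewrite in_cons eqxx.
- move=> [|[L R0] sp] //= /and5P[-> -> _ -> H].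
  by rewrite in_cons H orbT.
- by move=> [|p sp] //= /andP[/eqP -> _]; rewrite eqxx !andbF.
- by move=> p sp /eqP -> H; rewrite /Q1 eqxx.
- by move=> p sp /andP[/andP[pL pR] pn] /andP[ss st]; apply/and5P.
Qed.

(** With probability close to 1, the pattern occurs on a bounded stretch of the
    path above height [J], and the beginning of the path up to there is common
    to all vertices of height [h]. *)
Lemma mass_ge_good J e : 0 < e -> exists j h0, forall h, (h0 <= h)%N ->
  mass_ge (wb h)
    (fun sp => shallow (J + j) h sp && (pattern \in take j (drop J sp))) (1 - e).
Proof.
have /andP[c0 c1] := c01.
elim: J e => [|J IH] e e0.
  have e20 : 0 < e / 2 by rewrite divr_gt0.
  have : (fun n => (1 - c) ^+ n : R) @ \oo --> (0 : R).
    by apply: cvg_expr; rewrite ger0_norm ?subr_ge0 ?gtrBl // ltW.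
  move=> /cvgrPdist_lt/(_ _ e20)[j _ /(_ j (leqnn j))].
  rewrite /= sub0r normrN ger0_norm ?exprn_ge0 ?subr_ge0 ?(ltW c1) // => lt_e.
  have [h0 H] := mass_ge_pattern j e20; exists j, h0 => h /H.
  rewrite add0n => {}H; apply: (@mass_ge_le _ _ _ _ (1 - (1 - c) ^+ j - e / 2)).
    by lra.
  by apply: mass_ge_sub H => sp; rewrite drop0.
pose d := Num.min e 1 / 2.
have d0 : 0 < d by rewrite divr_gt0 // lt_min e0 ltr01.
have d1 : d <= 2^-1 by rewrite ler_pdivrMr // mulVf // ge_min lexx orbT.
have de : d * 2 <= e by rewrite mulfVK // ge_min lexx.
have [j [h1 H1]] := IH _ d0; have [h2 H2] := mass_ge_pair_low d0.
exists j, (maxn h1 h2).+1 => -[|h] //; rewrite ltnS geq_max => /andP[hh1 hh2].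
have d2 : 0 <= 1 - d by lra.
have M := @mass_ge_cons R h _ _ (fun sp => shallow (J.+1 + j) h.+1 sp &&
  (pattern \in take j (drop J.+1 sp))) _ _ d2 d2 _ (H2 _ hh2) (H1 _ hh1).
apply: mass_ge_le (M _); first by nra.
by move=> [L R0] sp /= /andP[-> ->].
Qed.

End spine_mass.

(** * Words and the lexicographic order *)

Section words.
Local Notation lexi := (Order.SeqLexiOrder.type Order.NatOrder.nat_display posnat).

Lemma val_mkpos n : val (mkpos n) = n.+1. Proof. by []. Qed.
Lemma mkposK (i : posnat) : mkpos (val i).-1 = i.
Proof. by apply: val_inj; rewrite /= prednK //; case: i. Qed.
Lemma mkpos_inj : injective mkpos.
Proof. by move=> i j /(congr1 val) []. Qed.
Lemma val_posnat_gt0 (i : posnat) : 0 < val i. Proof. by case: i. Qed.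

Lemma lexlt_cons (i j : posnat) (u v : word) :
  lexlt (i :: u) (j :: v) = (val i < val j) || (i == j) && lexlt u v.
Proof.
rewrite /lexlt; change ((i <= j)%O && ((j <= i)%O ==> ((u : lexi) < v)%O) =
  (val i < val j) || (i == j) && ((u : lexi) < v)%O).
have -> : (i <= j)%O = (val i <= val j)%N by [].
have -> : (j <= i)%O = (val j <= val i)%N by [].
rewrite -(inj_eq val_inj); case: ltngtP => //= ->.
Qed.

Lemma lexlt0 (u : word) : lexlt [::] u = (u != [::]). Proof. by case: u. Qed.
Lemma lexltn0 (u : word) : lexlt u [::] = false. Proof. by case: u. Qed.
Lemma lexltxx (u : word) : lexlt u u = false.
Proof. exact: (@ltxx _ (lexi : orderType _)). Qed.
Lemma lexlt_trans (v u w : word) : lexlt u v -> lexlt v w -> lexlt u w.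
Proof. exact: (@lt_trans _ (lexi : orderType _)). Qed.
Lemma lexle_eqVlt (u v : word) : lexle u v = (u == v) || lexlt u v.
Proof. exact: (@le_eqVlt _ (lexi : orderType _)). Qed.
Lemma lexleNgt (u v : word) : lexle u v = ~~ lexlt v u.
Proof. exact: (@leNgt _ (lexi : orderType _)). Qed.
Lemma lexlt_cat (u v w : word) : lexlt (u ++ v) (u ++ w) = lexlt v w.
Proof. by elim: u => //= i u IH; rewrite lexlt_cons ltnn eqxx. Qed.

Lemma lexle_prefix (u v : word) : prefix u v -> lexle u v.
Proof.
move=> /prefixP[w ->]; rewrite -{1}[u]cats0 lexle_eqVlt lexlt_cat lexlt0.
by case: w => [|x w]; rewrite ?eqxx ?orbT.
Qed.

(** The three lemmas below say that the words that extend [e] form an interval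
    of the lexicographic order, in the form of the comparisons it implies. *)
Lemma lexlt_prefix_l (e u v : word) :
  lexlt u e -> prefix e v -> lexlt u v.
Proof.
move=> ue /lexle_prefix; rewrite lexle_eqVlt => /predU1P[<- //|].
exact: lexlt_trans.
Qed.

Lemma lexlt_prefix_r (e u v : word) :
  lexlt e u -> ~~ prefix e u -> prefix e v -> lexlt v u.
Proof.
elim: e u v => [|i e IH] [|j u] [|k v] //=.
rewrite !lexlt_cons; case: (eqVneq i k) => [<-|//] /=.
by case: (eqVneq i j) => [-> |_]; rewrite ?ltnn //= => /IH H /H; exact.
Qed.

Lemma lexlt_nprefix_l (e u v : word) :
  lexlt u e -> ~~ prefix u e -> prefix u v -> lexlt v e.
Proof.
elim: u e v => [|i u IH] [|j e] [|k v] //=.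
rewrite !lexlt_cons; case: (eqVneq i k) => [<-|//] /=.
by case: (eqVneq i j) => [<-|_]; rewrite ?ltnn //= => /IH H /H; exact.
Qed.

End words.

(** * Trees as sets of words *)

Section finite_cards.
Local Open Scope classical_set_scope.

Lemma finite_set_seq (T : choiceType) (A : set T) (l : seq T) :
  (forall x, A x -> x \in l) -> finite_set A.
Proof. by move=> H; apply: sub_finite_set (finite_seq l) => x /H. Qed.

Lemma perm_fset_set (T : choiceType) (A : set T) (l : seq T) :
  uniq l -> (forall x, A x <-> x \in l) -> perm_eq (fset_set A) l.
Proof.
move=> ul H; have fA : finite_set A by apply: (@finite_set_seq _ _ l) => x /H.
apply: uniq_perm => // x.
by rewrite in_fset_set //; apply/idP/idP; [move/set_mem/H|move/H/mem_set].
Qed.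

Lemma card_seq (T : choiceType) (A : set T) (l : seq T) :
  uniq l -> (forall x, A x <-> x \in l) -> card A = size l.
Proof. by move=> ul H; apply: perm_size; exact: perm_fset_set. Qed.

Lemma card_enum (T : choiceType) (A : set T) : finite_set A ->
  exists2 l : seq T, uniq l & forall x, A x <-> x \in l.
Proof.
move=> fA; exists (fset_set A) => // x; rewrite in_fset_set //.
by split => [/mem_set|/set_mem].
Qed.

Lemma leq_card_set (T : choiceType) (A B : set T) :
  finite_set B -> A `<=` B -> card A <= card B.
Proof.
move=> fB AB; have fA : finite_set A by exact: sub_finite_set fB.
apply: uniq_leq_size => // x; rewrite !in_fset_set // => /set_mem /AB ?.
exact: mem_set.
Qed.

Lemma size_leq_card (T : choiceType) (A : set T) (l : seq T) :
  finite_set A -> uniq l -> (forall x, x \in l -> A x) -> size l <= card A.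
Proof.
move=> fA ul H; rewrite -(@card_seq _ [set` l] l) //.
by apply: leq_card_set.
Qed.

End finite_cards.

Section treelike.
Local Open Scope classical_set_scope.

(** The axioms of a tree as a property of its set of vertices, which passes to
    branches and to the sets coded by finite plane trees. *)
Record treelike (A : set word) : Prop := Treelike {
  tl_root : A [::];
  tl_prefix : forall u v, A (u ++ v) -> A u;
  tl_sibling : forall u (i j : posnat),
    (val j <= val i)%N -> A (rcons u i) -> A (rcons u j);
  tl_finite : forall u, finite_set (children A u) }.

Lemma tree_treelike (t : tree) : treelike t.
Proof. by case: t. Qed.

Lemma tree_ext (s t : tree) : vertices s = vertices t -> s = t.
Proof.
case: s t => A a1 a2 a3 a4 [B b1 b2 b3 b4] /= AB; subst B.
by congr Tree; exact: Prop_irrelevance.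
Qed.

Definition branch (A : set word) (i : posnat) : set word := [set u | A (i :: u)].

Lemma treelike_branch A i : treelike A -> A [:: i] -> treelike (branch A i).
Proof.
case=> A0 Ap As Af Ai; split => //.
- by move=> u v; exact: (Ap (i :: u)).
- by move=> u j k; exact: (As (i :: u)).
- by move=> u; exact: (Af (i :: u)).
Qed.

(** The number of children, by [childE]; [deg] is its extension by -1 outside
    the tree. *)
Definition arity (A : set word) (u : word) : nat :=
  \max_(i <- fset_set (children A u)) val i.

Lemma arity_cons A i u : arity A (i :: u) = arity (branch A i) u.
Proof. by []. Qed.

Lemma bigmax_posnat_attained (s : seq posnat) :
  0 < \max_(i <- s) val i -> exists2 j, j \in s & \max_(i <- s) val i = val j.
Proof.
elim: s => [|x s IH]; first by rewrite big_nil.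
rewrite big_cons; case: (leqP (\max_(i <- s) val i) (val x)) => [xs|xs].
  by exists x; rewrite ?mem_head //; apply/maxn_idPl.
have [|j js ->] := IH; first exact: leq_ltn_trans xs.
by exists j; rewrite ?in_cons ?js ?orbT.
Qed.

Lemma childE A u (i : posnat) : treelike A ->
  A (rcons u i) <-> val i <= arity A u.
Proof.
move=> [_ _ As Af]; rewrite /arity; split => [Ai|ile].
  by rewrite (big_rem i) ?leq_maxl // in_fset_set //; exact: mem_set.
have [|j] := @bigmax_posnat_attained (fset_set (children A u)).
  exact: leq_trans (val_posnat_gt0 i) ile.
rewrite in_fset_set // => /set_mem /= Aj Ej; apply: As Aj.
by move: ile; rewrite Ej.
Qed.

Lemma arity_eq A u n : (forall i : posnat, A (rcons u i) <-> val i <= n) ->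
  arity A u = n.
Proof.
move=> H; have fA : finite_set (children A u).
  apply: (@finite_set_seq _ _ [seq mkpos i | i <- iota 0 n]) => i /= /H.
  rewrite -{2}[i]mkposK => ile; apply: map_f; rewrite mem_iota /=.
  by rewrite add0n prednK // val_posnat_gt0.
apply/eqP; rewrite eqn_leq /arity; apply/andP; split.
  by apply/bigmax_leqP_seq => i; rewrite in_fset_set // => /set_mem /H.
case: n H => // n H.
rewrite (big_rem (mkpos n)) ?leq_maxl // in_fset_set //; apply: mem_set.
exact/H.
Qed.

Lemma degE A u : A u -> deg A u = Posz (arity A u).
Proof. by move=> Au; rewrite /deg; case: asboolP. Qed.

(** ** Finite plane trees as sets of words *)

Fixpoint inpt (t : ptree) (u : word) : bool :=
  if u is i :: u' then
    ((val i).-1 < size (kids t)) && inpt (nth pleaf (kids t) (val i).-1) u'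
  else true.

Lemma inpt_cons s i u : inpt (Node s) (mkpos i :: u) =
  (i < size s) && inpt (nth pleaf s i) u.
Proof. by []. Qed.

Lemma treelike_inpt t : treelike [set u | inpt t u].
Proof.
split => //=.
- by move=> u v; elim: u t => //= i u IH t /andP[-> /IH].
- move=> u i j ij; rewrite /mkset; elim: u t => [|k u IH] t /=.
    move=> /andP[lti _]; apply/andP; split => //; apply: leq_ltn_trans lti.
    by rewrite -!subn1 leq_sub2r.
  by move=> /andP[-> /IH].
move=> u; elim: u t => [|k u IH] t.
  apply: (@finite_set_seq _ _ [seq mkpos i | i <- iota 0 (size (kids t))]) => i.
  by rewrite /children /mkset /= andbT => lti; rewrite -[i]mkposK map_f // mem_iota.
apply: sub_finite_set (IH (nth pleaf (kids t) (val k).-1)) => i.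
rewrite /children /mkset /=.
by move=> /andP[_].
Qed.

Definition tree_of (t : ptree) : tree :=
  let: Treelike h1 h2 h3 h4 := treelike_inpt t in Tree h1 h2 h3 h4.

Lemma tree_ofE t : vertices (tree_of t) = [set u | inpt t u].
Proof. by rewrite /tree_of; case: treelike_inpt. Qed.

Lemma arity_inpt_nil t : arity [set u | inpt t u] [::] = size (kids t).
Proof.
by apply: arity_eq => i /=; rewrite andbT -[i]mkposK.
Qed.

Lemma branch_inpt s i : i < size s ->
  branch [set u | inpt (Node s) u] (mkpos i) = [set u | inpt (nth pleaf s i) u].
Proof. by move=> lti; apply/seteqP; split => u; rewrite /branch /mkset inpt_cons lti. Qed.

Lemma inpt_inj t t' : (forall u, inpt t u = inpt t' u) -> t = t'.
Proof.
elim/ptree_ind_in: t t' => s IH [s'] H; congr Node.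
have ss : size s = size s'.
  rewrite -[s]/(kids (Node s)) -[s']/(kids (Node s')) -!arity_inpt_nil.
  by congr arity; apply/funext => u /=; rewrite H.
apply: (@eq_from_nth _ pleaf) => // i lti.
apply: IH; first exact: mem_nth.
by move=> u; have := H (mkpos i :: u); rewrite !inpt_cons -ss lti.
Qed.

(** ** The finite tree seen from the root up to a given height *)

(** The truncation of a tree as an inductive object. Equality of codes, rather
    than of sets of words, expresses that two trees agree up to height [k]; there
    are countably many codes, and they can be compared with finite plane trees. *)
Fixpoint code (k : nat) (A : set word) : ptree :=
  if k is k'.+1 then
    Node [seq code k' (branch A (mkpos i)) | i <- iota 0 (arity A [::])]
  else pleaf.

Lemma inpt_code k A u : treelike A ->
  inpt (code k A) u <-> A u /\ size u <= k.
Proof.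
elim: k A u => [|k IH] A [|i u] tA.
- by split => //; have := tl_root tA.
- by split => // -[].
- by split => //; have := tl_root tA.
rewrite [inpt _ _]/= size_map size_iota.
have [lti|lti] := ltnP (val i).-1 (arity A [::]).
  have Ai : A [:: i].
    by apply/(childE [::] i tA); rewrite -[i]mkposK.
  rewrite (nth_map 0) ?size_iota // nth_iota // add0n mkposK.
  by rewrite IH //; exact: treelike_branch.
split => // -[Ai _]; move: lti; rewrite leqNgt => /negP; case.
have : A [:: i] by apply: (@tl_prefix _ tA [:: i] u).
by move=> /(childE [::] i tA); rewrite -{1}[i]mkposK.
Qed.

Lemma inpt_truncp k t u : inpt (truncp k t) u = inpt t u && (size u <= k).
Proof.
elim: k t u => [|k IH] t [|i u] //=; first by rewrite andbF.
rewrite size_map; case: ltnP => //= lti.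
by rewrite (nth_map pleaf) // IH.
Qed.

Lemma code_inpt k t : code k [set u | inpt t u] = truncp k t.
Proof.
apply: inpt_inj => u; rewrite inpt_truncp; apply/idP/andP.
  by move/(inpt_code _ _ (treelike_inpt t)).
by move=> H; apply/(inpt_code _ _ (treelike_inpt t)).
Qed.

Lemma code_tree_of k t : code k (tree_of t) = truncp k t.
Proof. by rewrite tree_ofE code_inpt. Qed.

Lemma code_eqP k (s t : tree) :
  code k s = code k t <-> (forall u, size u <= k -> vertices s u <-> vertices t u).
Proof.
split => [E u uk|H].
  have := inpt_code k u (tree_treelike s); rewrite E.
  have := inpt_code k u (tree_treelike t); tauto.
apply: inpt_inj => u.
have Hs := inpt_code k u (tree_treelike s).
have Ht := inpt_code k u (tree_treelike t).
by apply/idP/idP => [/Hs[su uk]|/Ht[tu uk]]; [apply/Ht|apply/Hs]; split => //; apply/H.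
Qed.

Lemma code_le k l (s t : tree) : k <= l -> code l s = code l t -> code k s = code k t.
Proof.
move=> kl /code_eqP H; apply/code_eqP => u uk; apply: H; exact: leq_trans kl.
Qed.

Lemma trunc_code k (t : tree) : trunc k t = [set u | inpt (code k t) u].
Proof.
apply/seteqP; split => u /=; first by move/(inpt_code _ _ (tree_treelike t)).
by move/(inpt_code _ _ (tree_treelike t)).
Qed.

(** ** Levels and preorder *)

Fixpoint levels (k : nat) (t : ptree) : seq word :=
  if k is k'.+1 then
    [seq mkpos i :: u | i <- iota 0 (size (kids t)),
                        u <- levels k' (nth pleaf (kids t) i)]
  else [:: [::]].

Lemma mem_levels k t u : (u \in levels k t) = inpt t u && (size u == k).
Proof.
elim: k t u => [|k IH] t u; first by case: u => //= i u; rewrite andbF.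
rewrite /=; apply/allpairsPdep/andP => [[i [v []]]|[]].
  by rewrite mem_iota /= IH => lti /andP[Hv /eqP vk] -> /=; rewrite lti Hv vk.
case: u => // i u /= /andP[lti Hu] /eqP[uk].
exists (val i).-1, u; rewrite mem_iota mkposK; split => //.
by rewrite IH Hu uk eqxx.
Qed.

Lemma levels_uniq k t : uniq (levels k t).
Proof.
elim: k t => //= k IH t; apply: allpairs_uniq_dep => //; first exact: iota_uniq.
by move=> [i u] [j v] _ _ /= [] ij ->; rewrite ij.
Qed.

Lemma size_levels k t : size (levels k t) = lev k t.
Proof.
elim: k t => //= k IH [s]; rewrite size_allpairs_dep /=.
congr sumn; rewrite -[in RHS](mkseq_nth pleaf s) -map_comp.
by apply: eq_map => i /=; exact: IH.
Qed.

Lemma card_level k t : card (level k (tree_of t)) = lev k t.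
Proof.
rewrite -size_levels; apply: card_seq (levels_uniq _ _) _ => u.
rewrite tree_ofE mem_levels; split; first by move=> [/= -> ->]; rewrite eqxx.
by move=> /andP[? /eqP].
Qed.

(** The local fixpoint is [preorderF], inlined because of the nested
    recursion. *)
Fixpoint preorder (t : ptree) : seq word :=
  let: Node s := t in [::] ::
    (fix go (k : nat) (s : seq ptree) : seq word :=
      if s is x :: s' then map (cons (mkpos k)) (preorder x) ++ go k.+1 s'
      else [::]) 0 s.

Fixpoint preorderF (k : nat) (s : seq ptree) : seq word :=
  if s is x :: s' then map (cons (mkpos k)) (preorder x) ++ preorderF k.+1 s'
  else [::].

Lemma preorderE s : preorder (Node s) = [::] :: preorderF 0 s.
Proof. by []. Qed.

Lemma preorderF_cons k s1 s : preorderF k (Node s1 :: s) =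
  [:: mkpos k] :: map (cons (mkpos k)) (preorderF 0 s1) ++ preorderF k.+1 s.
Proof. by []. Qed.

Lemma size_preorderF k s : size (preorderF k s) = fsize s.
Proof.
elim/forest_ind: s k => // s1 s IH1 IH k.
by rewrite preorderF_cons /= size_cat size_map IH IH1.
Qed.

Lemma size_preorder t : size (preorder t) = nodes t.
Proof. by case: t => s; rewrite preorderE /= size_preorderF. Qed.

Lemma mem_preorderF k s u : u \in preorderF k s =
  if u is i :: v then
    (k < val i <= k + size s) && inpt (nth pleaf s ((val i).-1 - k)) v
  else false.
Proof.
elim/forest_ind: s k u => [|s1 s IH1 IH] k u.
  by case: u => //= i u; rewrite addn0; case: ltngtP.
rewrite preorderF_cons in_cons mem_cat IH.
case: u => [|i u].
  by rewrite orbF; apply/negbTE/negP => /mapP[].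
have [E|ik] := eqVneq i (mkpos k).
  rewrite E val_mkpos ltnn orbF leqnn /= addnS ltnS leq_addr subnn /=.
  rewrite mem_map; last by move=> ? ? [].
  rewrite IH1 eqseq_cons eqxx /=; case: u => //= j u.
  by rewrite subn0 add0n val_posnat_gt0 /= prednK // val_posnat_gt0.
rewrite eqseq_cons (negbTE ik) (_ : (_ \in map _ _) = false) /=; last first.
  by apply/negbTE/negP => /mapP[v _ [E _]]; rewrite E eqxx in ik.
case: i ik => n n0 ik /=; rewrite addSnnS.
have [ki|ki|ki] := ltngtP k.+1 n.
- rewrite /=; congr (_ && inpt _ _).
  by have -> : n.-1 - k = (n.-1 - k.+1).+1 by lia.
- by [].
- by case/eqP: ik; apply: val_inj; rewrite /= -ki.
Qed.

Lemma mem_preorder t u : (u \in preorder t) = inpt t u.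
Proof.
case: t => s; rewrite preorderE in_cons mem_preorderF; case: u => //= i u.
by rewrite subn0 add0n val_posnat_gt0 /= prednK // val_posnat_gt0.
Qed.

Lemma lexlt_trans_rel : transitive lexlt.
Proof. by move=> v u w; exact: lexlt_trans. Qed.

Lemma sorted_preorderF k s : sorted lexlt (preorderF k s).
Proof.
elim/forest_ind: s k => // s1 s IH1 IH k; rewrite preorderF_cons.
have H2 := IH k.+1; have H3 := mem_preorderF k.+1 s.
have P : path lexlt [::] (preorderF 0 s1).
  case: (preorderF 0 s1) (IH1 0) (mem_preorderF 0 s1 [::]) => //= x l -> H.
  by rewrite andbT lexlt0; case: x H.
rewrite /= cat_path; apply/andP; split.
  rewrite -[[:: mkpos k]]/((cons (mkpos k)) [::]) path_map.
  by apply: sub_path P => u v /=; rewrite lexlt_cons ltnn eqxx.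
rewrite (path_sortedE lexlt_trans_rel) H2 andbT; apply/allP => u; rewrite H3.
case: u => // i u /andP[/andP[ki _] _].
by rewrite -[[:: mkpos k]]/((cons (mkpos k)) [::]) last_map lexlt_cons ki.
Qed.

Lemma sorted_preorder t : sorted lexlt (preorder t).
Proof.
case: t => s; have := sorted_preorderF 0 [:: Node s].
rewrite preorderF_cons cats0 -/(map (cons (mkpos 0)) ([::] :: preorderF 0 s)).
rewrite -preorderE sorted_map; apply: sub_sorted => u v /=.
by rewrite lexlt_cons ltnn eqxx.
Qed.

Lemma preorder_uniq t : uniq (preorder t).
Proof.
apply: sorted_uniq (sorted_preorder t); first exact: lexlt_trans_rel.
by move=> u; rewrite lexltxx.
Qed.

Lemma finite_tree_of t : finite_set (tree_of t).
Proof.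
by apply: (@finite_set_seq _ _ (preorder t)) => u; rewrite tree_ofE mem_preorder.
Qed.

End treelike.

(** * Topology of trees and of sequences *)

Section topology_facts.
Local Open Scope classical_set_scope.

Lemma open_deg u (c : int) : open [set t : tree | deg t u = c].
Proof.
pose degf (t : tree) : {ptws word -> discrete_topology int} := deg t.
have cdeg : continuous (degf : tree -> {ptws word -> discrete_topology int}).
  exact: (@initial_continuous tree _ degf).
have cproj : continuous (fun f : {ptws word -> discrete_topology int} => f u).
  exact: (@proj_continuous word (fun=> discrete_topology int) u).
have := @discrete_open (discrete_topology int) [set c].
move/(open_comp (fun x _ => cproj x))/(open_comp (fun x _ => cdeg x)).
by [].
Qed.

Lemma open_degs (l : seq word) (c : word -> int) :
  open [set t : tree | forall u, u \in l -> deg t u = c u].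
Proof.
elim: l => [|u l IH].
  by rewrite (_ : [set _ | _] = setT); [exact: openT|apply/seteqP; split].
rewrite (_ : [set _ | _] = [set t : tree | deg t u = c u] `&`
   [set t : tree | forall u, u \in l -> deg t u = c u]).
  by apply: openI => //; exact: open_deg.
apply/seteqP; split => t /= H.
  by split; [apply: H; exact: mem_head|move=> v vl; apply: H; rewrite in_cons vl orbT].
by case: H => H1 H2 v; rewrite in_cons => /predU1P[->|/H2].
Qed.

(** The shape of a tree up to height [k] only involves finitely many degrees. *)
Lemma open_cylinder k (t0 : ptree) : open [set t : tree | code k t = t0].
Proof.
have [[t1 t10]|H] := pselect (exists t1 : tree, code k t1 = t0); last first.
  rewrite (_ : [set _ | _] = set0); first exact: open0.
  by apply/seteqP; split => t // /= tt0; case: H; exists t.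
rewrite (_ : [set _ | _] = [set t : tree | forall u,
    u \in [seq u <- preorder t0 | size u < k] -> deg t u = deg t1 u]).
  exact: open_degs.
apply/seteqP; split => t /=; rewrite -t10.
  move=> /code_eqP H u; rewrite mem_filter mem_preorder => /andP[uk].
  move=> /(inpt_code _ _ (tree_treelike t1)) [t1u _].
  have tu : vertices t u by apply/H => //; exact: ltnW.
  rewrite !degE //; congr Posz; apply: arity_eq => i.
  by rewrite H ?size_rcons //; apply: childE; exact: tree_treelike.
move=> H; apply/code_eqP => u; elim/last_ind: u => [|u i IH].
  by move=> _; split => _; exact: tree_root.
rewrite size_rcons => uk.
have {}IH := IH (ltnW uk).
have [t1u|t1u] := pselect (vertices t1 u); last first.
  have tu : ~ vertices t u by move/IH.
  by split; rewrite -cats1 => /tree_prefix.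
have tu : vertices t u by apply/IH.
have : deg t u = deg t1 u.
  apply: H; rewrite mem_filter uk mem_preorder.
  by apply/(inpt_code _ _ (tree_treelike t1)); split => //; exact: ltnW.
rewrite !degE // => -[E].
by rewrite !childE ?E //; exact: tree_treelike.
Qed.

(** The neighbourhoods in a product are generated by those of the
    coordinates. *)
Lemma cvg_fun_space (F : set_system fun_space) (l : fun_space) : Filter F ->
  (forall i U, nbhs (l i : posnat_star) U -> F [set f : fun_space | U (f i)]) ->
  F --> l.
Proof.
move=> FF H.
apply/(@cvg_sup _ _ (fun i => Topological.class
  (initial_topology (@proj posnat (fun=> posnat_star) i)))) => i.
move=> W /= [V [[B oB <-] /= Bl] VW]; apply: filterS VW _.
by apply: H; apply: open_nbhs_nbhs.
Qed.

(** The sets [M k] shrink as [k] grows and generate a filter; convergence of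
    [f] along it is checked one argument at a time. Here [M k] will consist of
    the functions that come from trees with a given shape up to height [k]. *)
Lemma agree_cvg_fun_space (I : Type) (M : nat -> set I) (f : I -> fun_space)
    (l : fun_space) :
  (forall k k', (k <= k')%N -> M k' `<=` M k) ->
  (forall i U, nbhs (l i : posnat_star) U ->
     exists k, forall s, M k s -> U (f s i)) ->
  forall W, nbhs l W -> exists k, forall s, M k s -> W (f s).
Proof.
move=> Mle H.
pose F : set_system fun_space := [set W | exists k, forall s, M k s -> W (f s)].
have FF : Filter F.
  split.
  - by exists 0%N.
  - move=> A B [k HA] [k' HB]; exists (maxn k k') => s Ms; split.
      by apply: HA; apply: Mle Ms; rewrite leq_maxl.
    by apply: HB; apply: Mle Ms; rewrite leq_maxr.
  - by move=> A B AB [k HA]; exists k => s /HA /AB.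
by have := @cvg_fun_space F l FF H.
Qed.

(** The complement of a neighbourhood of infinity lies in a compact set of a
    discrete space, which is finite. *)
Lemma nbhs_infinity (U : set posnat_star) : nbhs (None : posnat_star) U ->
  U None /\ exists m, forall n, (m <= n)%N -> U (Some (mkpos n)).
Proof.
move=> /[dup] /nbhs_singleton UN [W [cW _] WU]; split => //.
have : @cover_compact posnat W by rewrite -compact_cover.
move=> /(_ posnat W (fun x => [set x])) [] //.
- by move=> i _; exact: (@discrete_open (discrete_topology posnat)).
- by move=> x Wx; exists x.
move=> D _ WD; exists (\max_(i <- D) val i)%N => n nm; apply: WU; left.
exists (mkpos n) => // /WD[j /= jD nj].
have : (val j <= \max_(i <- D) val i)%N by rewrite (big_rem j) //= leq_maxl.
by rewrite -nj val_mkpos => /leq_trans /(_ nm); rewrite ltnn.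
Qed.

End topology_facts.

(** * Lower bounds on the laws of the Galton-Watson and size-biased trees *)

Section sums.
Variable R : realType.
Local Open Scope ring_scope.
Local Open Scope classical_set_scope.

Lemma ler_sum_sub (X : eqType) (s1 s2 : seq X) (F : X -> R) :
  uniq s1 -> uniq s2 -> {subset s1 <= s2} -> (forall x, 0 <= F x) ->
  \sum_(x <- s1) F x <= \sum_(x <- s2) F x.
Proof.
move=> u1 u2 s12 F0; rewrite [leRHS](bigID (mem s1)) /= -[X in _ <= X + _]big_filter.
rewrite [X in _ <= X + _](perm_big s1); first by rewrite lerDl sumr_ge0.
apply: uniq_perm => //; first exact: filter_uniq.
by move=> x; rewrite mem_filter; case: (boolP (x \in s1)) => // /s12.
Qed.

Lemma sum_le_measure d (Om : measurableType d) (mu : {measure set Om -> \bar R})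
    (X : eqType) (F : seq X) (A : X -> set Om) (B : set Om) :
  uniq F -> measurable B -> (forall x, x \in F -> measurable (A x)) ->
  (forall x, x \in F -> A x `<=` B) ->
  (forall x y w, x \in F -> y \in F -> A x w -> A y w -> x = y) ->
  (\sum_(x <- F) mu (A x) <= mu B)%E.
Proof.
elim: F B => [|x F IH] B; first by rewrite big_nil.
move=> /= /andP[xF uF] mB mA AB dA; rewrite big_cons.
have xxF := mem_head x F; have sF y : y \in F -> y \in x :: F.
  by rewrite in_cons => ->; rewrite orbT.
have mAx := mA _ xxF.
rewrite -[B in (_ <= mu B)%E](setDUK (AB _ xxF)).
rewrite measureU //; last first.
- by apply/seteqP; split => w // -[Axw [_]].
- exact: measurableD.
apply: leeD2l; apply: IH => //.
- exact: measurableD.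
- by move=> y /sF; exact: mA.
- move=> y yF w Ayw; split; first exact: (AB y (sF _ yF)).
  by move=> Axw; case/negP: xF; rewrite (dA x y w) // ?sF.
- by move=> y z w yF zF; apply: dA; exact: sF.
Qed.

End sums.

Section laws.
Variable R : realType.
Local Open Scope ring_scope.
Local Open Scope classical_set_scope.

Section cylinders.
Variables (d : measure_display) (Om : measurableType d) (P : probability Om R).
Variable T : {RV P >-> borel tree}.

Definition cyl k (t0 : ptree) : set Om := [set w | code k (T w : tree) = t0].

Lemma measurable_cyl k t0 : measurable (cyl k t0).
Proof.
rewrite (_ : cyl k t0 = T @^-1` [set t : tree | code k t = t0]) //.
apply: measurable_funPTI => //; apply: sub_sigma_algebra; exact: open_cylinder.
Qed.

(** There are only countably many codes. *)
Lemma measurable_code k (Q : set ptree) :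
  measurable [set w | Q (code k (T w : tree))].
Proof.
rewrite (_ : [set _ | _] = \bigcup_n \big[setU/set0]_(t0 <- [seq t <-
    flatten [seq f | f <- forests 1 n] | `[< Q t >]]) cyl k t0).
  apply: bigcup_measurable => n _; apply: bigsetU_measurable => t0 _.
  exact: measurable_cyl.
apply/seteqP; split => [w Qw|w [n _]].
  exists (nodes (code k (T w : tree))).-1 => //.
  rewrite -bigcup_seq; exists (code k (T w : tree)) => //=.
  rewrite mem_filter; apply/andP; split; first exact/asboolP.
  apply/flattenP; exists [:: code k (T w : tree)]; last exact: mem_head.
  rewrite map_id mem_forests; apply/andP; split => //; apply/eqP.
  by rewrite /fsize /= addn0 add1n prednK ?nodes_gt0.
rewrite -bigcup_seq => -[t0 /=]; rewrite mem_filter => /andP[/asboolP Qt0 _].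
by rewrite /cyl /= => ->.
Qed.

(** Lower bounds on the masses of disjoint cylinders add up. *)
Lemma mass_ge_cyl (Q : pred ptree) (w : ptree -> R) k c (E : set Om) :
  measurable E ->
  (forall t0, Q t0 -> (w t0)%:E <= P (cyl k t0))%E ->
  (forall t0 om, Q t0 -> cyl k t0 om -> E om) ->
  mass_ge w Q c -> (c%:E <= P E)%E.
Proof.
move=> mE wP QE H; apply/lee_addgt0Pr => e e0.
have [F [uF /allP QF sF]] := H e e0.
rewrite -leeBlDr // -EFinB; apply: (@le_trans _ _ (\sum_(x <- F) w x)%:E).
  by rewrite lee_fin.
apply: (@le_trans _ _ (\sum_(x <- F) P (cyl k x))%E).
  rewrite -sumEFin big_seq [leRHS]big_seq; apply: lee_sum => x /QF; exact: wP.
apply: sum_le_measure => //.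
- by move=> x _; exact: measurable_cyl.
- by move=> x /QF Qx om; exact: QE.
- by move=> x y om _ _; rewrite /cyl /= => <-.
Qed.

End cylinders.

Lemma prod_preorderF (F : word -> R) k s :
  \prod_(u <- preorderF k s) F u =
  \prod_(j < size s) \prod_(u <- preorder (nth pleaf s j)) F (mkpos (k + j) :: u).
Proof.
elim: s k => [|[s1] s IH] k; first by rewrite big_nil big_ord0.
rewrite preorderF_cons -cat1s catA big_cat IH big_ord_recl /= addn0.
rewrite -/(map (cons (mkpos k)) ([::] :: preorderF 0 s1)) -preorderE big_map.
by congr (_ * _); apply: eq_bigr => j _; rewrite /= addSnnS.
Qed.

Lemma prod_preorder t :
  \prod_(u <- preorder t) geometric_half R (absz (deg [set u | inpt t u] u)) =
  wfull R t.
Proof.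
transitivity (\prod_(u <- preorder t)
    geometric_half R (arity [set u | inpt t u] u)).
  rewrite big_seq [RHS]big_seq; apply: eq_bigr => u; rewrite mem_preorder => tu.
  by rewrite degE.
elim/ptree_ind_in: t => s IH; rewrite preorderE big_cons wfull_Node.
rewrite arity_inpt_nil /geometric_half exprVn; congr (_ * _).
rewrite prod_preorderF (big_nth pleaf) big_mkord; apply: eq_bigr => j _.
rewrite -IH; last exact: mem_nth.
by apply: eq_bigr => u _; rewrite add0n arity_cons branch_inpt.
Qed.

Lemma low_inpt k t u : low k t -> inpt t u -> (size u < k)%N.
Proof.
elim: k t u => // k IH t [|i u] //= /allP H /andP[lti Hu].
by apply: IH Hu; apply: H; exact: mem_nth.
Qed.

Lemma trunc_tree_of k (t : tree) t0 : trunc k t = tree_of t0 <-> code k t = t0.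
Proof.
rewrite trunc_code tree_ofE; split => [H|-> //].
by apply: inpt_inj => u; apply/idP/idP => Hu; [rewrite -[is_true _]/([set u | inpt t0 u] u) -H|
  rewrite -[is_true _]/([set u | inpt (code k t) u] u) H].
Qed.

(** Marking the vertex of height [h] at the end of the spine turns the factor
    [lev h t0] of the size-biased law into a sum over marked trees. *)
Fixpoint mark_path (sp : marked) : word :=
  if sp is (L, R0) :: sp' then mkpos (size L) :: mark_path sp' else [::].

Lemma build_mark_inj sp sp' : build sp = build sp' ->
  mark_path sp = mark_path sp' -> sp = sp'.
Proof.
elim: sp sp' => [|[L R0] sp IH] [|[L' R0'] sp'] // + [sL Em].
move=> -[] /eqP; rewrite eqseq_cat // => /andP[/eqP -> /eqP [Eb ->]].
by rewrite (IH sp').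
Qed.

Lemma shallow_build K h sp : shallow K h sp ->
  low h.+1 (build sp) /\ mark_path sp \in levels h (build sp).
Proof.
elim: h K sp => [|h IH] K [|[L R0] sp] //=.
move=> /and3P[HL HR /IH[Hb Hm]]; split.
  have wk s : all (low (if K is 0 then h.+1 else h)) s -> all (low h.+1) s.
    by apply: sub_all => x; case: K {HL HR} => // _; exact: lowS.
  by rewrite all_cat /= (wk _ HL) (wk _ HR) andbT; exact: Hb.
apply/allpairsPdep; exists (size L), (mark_path sp); split => //.
  by rewrite mem_iota size_cat /= addnS ltnS leq_addr.
by rewrite nth_cat ltnn subnn.
Qed.

Lemma mass_ge_marked h K (Q : pred marked) c : (forall sp, Q sp -> shallow K h sp) ->
  mass_ge (fun sp => wt R h (build sp)) Q c ->
  mass_ge (fun t => (lev h t)%:R * wt R h t)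
    (fun t => `[< exists2 sp, Q sp & t = build sp >]) c.
Proof.
move=> QK H e /H[F [uF /allP QF sF]]; exists (undup (map build F)); split.
- exact: undup_uniq.
- apply/allP => t; rewrite mem_undup => /mapP[sp /QF Qsp ->].
  by apply/asboolP; exists sp.
apply: le_trans sF _; set G := undup _.
pose S1 := [seq (build sp, mark_path sp) | sp <- F].
pose S2 := [seq (t, v) | t <- G, v <- levels h t].
have -> : \sum_(sp <- F) wt R h (build sp) = \sum_(p <- S1) wt R h p.1.
  by rewrite big_map.
have -> : \sum_(t <- G) (lev h t)%:R * wt R h t = \sum_(p <- S2) wt R h p.1.
  rewrite big_allpairs_dep; apply: eq_bigr => t _ /=.
  by rewrite big_const_seq count_predT size_levels iter_addr_0 mulr_natl.
apply: ler_sum_sub.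
- by rewrite map_inj_uniq // => sp sp' [] /build_mark_inj; exact.
- apply: allpairs_uniq_dep; first exact: undup_uniq.
    by move=> t _; exact: levels_uniq.
  by move=> [t v] [t' v'] _ _ /= [-> ->].
- move=> _ /mapP[sp spF ->]; apply/allpairsPdep; exists (build sp), (mark_path sp).
  split => //; first by rewrite mem_undup; exact: map_f.
  by have [_] := shallow_build (QK _ (QF _ spF)).
- by move=> p; exact: wt_ge0.
Qed.


(** The size-biased law has total mass 1 at every height. *)
Lemma mass_ge_lev k : mass_ge (fun t => (lev k t)%:R * wt R k t) (low k.+1) 1.
Proof.
have := mass_ge_marked (fun sp => id) (@mass_ge_shallow0 R k).
by apply: mass_ge_sub => t /asboolP[sp /shallow_build[lt _] ->].
Qed.

Section GW.
Variables (d : measure_display) (Om : measurableType d) (P : probability Om R).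
Variables (T : {RV P >-> borel tree}) (hT : is_GW (@geometric_half R) T).

Lemma GW_point t : (P [set w | T w = tree_of t :> tree] = (wfull R t)%:E)%E.
Proof.
rewrite hT; last exact: finite_tree_of.
congr EFin; rewrite -prod_preorder -tree_ofE.
apply: perm_big; apply: perm_fset_set (preorder_uniq t) _ => u.
by rewrite tree_ofE mem_preorder.
Qed.

(** The law of the Galton-Watson tree is only given on finite trees; those that
    extend [t0] already have total mass [wt k t0]. *)
Lemma GW_cyl_ge k t0 : low k.+1 t0 -> ((wt R k t0)%:E <= P (cyl T k t0))%E.
Proof.
move=> lt0; pose A t := [set w | (T w : tree) = tree_of t].
have mA t : measurable (A t).
  rewrite (_ : A t = cyl T (nodes t) t); first exact: measurable_cyl.
  apply/seteqP; split => w; rewrite /A /cyl /=.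
    by move=> ->; rewrite code_tree_of truncp_id //; apply/lowS/low_nodes.
  move=> H; apply: tree_ext; rewrite tree_ofE; apply/seteqP; split => u /=.
    move=> Tu; apply/negPn/negP => tu.
    have [n sun] := ubnP (size u); elim: n u Tu tu sun => // n IH u Tu tu sun.
    case/lastP: u Tu tu sun => // u i Tu tu; rewrite size_rcons ltnS => sun.
    have Tu' : vertices (T w : tree) u by move: Tu; rewrite -cats1; exact: tree_prefix.
    have [tu'|tu'] := boolP (inpt t u); last exact: (IH u).
    have su := low_inpt (low_nodes t) tu'.
    case/negP: tu; rewrite -H; apply/(inpt_code _ _ (tree_treelike _)).
    by rewrite size_rcons.
  by rewrite -{1}H => /(inpt_code _ _ (tree_treelike _))[].
apply/lee_addgt0Pr => e e0.
have [F [uF /allP QF sF]] := @mass_ge_graft R k t0 lt0 e e0.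
rewrite -leeBlDr // -EFinB; apply: (@le_trans _ _ (\sum_(x <- F) wfull R x)%:E).
  by rewrite lee_fin.
rewrite -sumEFin; under eq_bigr do rewrite -GW_point.
apply: (@sum_le_measure R _ _ P _ F A) => //.
- exact: measurable_cyl.
- by move=> t /QF /eqP <- w; rewrite /A /cyl /= => ->; rewrite code_tree_of.
move=> s t w _ _; rewrite /A /= => -> E; apply: inpt_inj => u.
have := congr1 vertices E; rewrite !tree_ofE => /seteqP[h1 h2].
by apply/idP/idP; [exact: h1|exact: h2].
Qed.

Variables (d' : measure_display) (Om' : measurableType d') (P' : probability Om' R).
Variables (T' : {RV P' >-> borel tree}) (hT' : is_size_biased T T').

Lemma size_biased_cyl_ge k t0 : low k.+1 t0 ->
  (((lev k t0)%:R * wt R k t0)%:E <= P' (cyl T' k t0))%E.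
Proof.
move=> lt0; have [l0|l0] := posnP (lev k t0); first by rewrite l0 mul0r.
have Hh : has_height (tree_of t0) k.
  split.
    move: l0; rewrite -size_levels; case E : (levels k t0) => [//|u l] _.
    have := mem_levels k t0 u; rewrite E mem_head => /esym/andP[tu /eqP uk].
    by exists u => //; rewrite tree_ofE.
  by move=> u; rewrite tree_ofE /= => /(low_inpt lt0).
have := hT'.2 k (tree_of t0) Hh; rewrite card_level.
have cE (Q : {RV P >-> borel tree}) : [set w | trunc k (Q w : tree) = tree_of t0] = cyl Q k t0.
  by apply/seteqP; split => w /= /trunc_tree_of.
have cE' (Q : {RV P' >-> borel tree}) : [set w | trunc k (Q w : tree) = tree_of t0] = cyl Q k t0.
  by apply/seteqP; split => w /= /trunc_tree_of.
rewrite cE cE' => ->; rewrite EFinM lee_pmul2l ?lte_fin ?ltr0n //.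
exact: GW_cyl_ge.
Qed.

Lemma size_biased_marked_ge h K (Q : pred marked) c (E : set Om') :
  measurable E -> (forall sp, Q sp -> shallow K h sp) ->
  (forall sp w, Q sp -> cyl T' h (build sp) w -> E w) ->
  mass_ge (fun sp => wt R h (build sp)) Q c -> (c%:E <= P' E)%E.
Proof.
move=> mE QK QE H.
apply: (@mass_ge_cyl _ _ P' T' (fun t => `[< exists2 sp, Q sp & t = build sp >])
  (fun t => (lev h t)%:R * wt R h t) h c E) => //.
- move=> t0 /asboolP[sp /QK /shallow_build[Hb _] ->]; exact: size_biased_cyl_ge.
- by move=> t0 om /asboolP[sp Qsp ->]; exact: QE.
exact: (mass_ge_marked QK H).
Qed.

End GW.
End laws.

(** * The spine of the size-biased tree *)

(** A stronger and more explicit form of membership in [Tinfty]: all vertices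
    of large height descend from [eta J], for every [J], so the spine [eta] is
    unique, and the recurrent pattern occurs infinitely often along it. The
    event that the size-biased tree is good is seen on codes, hence measurable,
    and the continuity of the six maps is proved at good trees. *)
Record good (t : set word) (eta : nat -> word) : Prop := Good {
  good_size : forall j, size (eta j) = j;
  good_in : forall j, t (eta j);
  good_take : forall i j, i <= j -> take i (eta j) = eta i;
  good_sep : forall J, exists k, forall u, t u -> k <= size u -> take J u = eta J;
  good_pattern : forall J, exists2 i, J <= i &
    [/\ eta i.+1 = rcons (eta i) (mkpos 1), t (rcons (eta i) (mkpos 2)) &
        forall v, t (rcons (eta i) (mkpos 0) ++ v) <-> v \in [:: [::]; [:: mkpos 0]]] }.

Section good_trees.
Local Open Scope classical_set_scope.

Lemma unbounded_infinite (A : set word) :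
  (forall n, exists2 u, A u & n <= size u) -> infinite_set A.
Proof.
move=> H /card_enum[l _ Al]; have [u /Al ul] := H (\max_(u <- l) size u).+1.
by rewrite (big_rem u) //= ltnNge leq_maxl.
Qed.

Lemma good_prefix t eta i j : good t eta -> i <= j -> prefix (eta i) (eta j).
Proof.
move=> g ij; rewrite -(good_take g ij); exact: prefix_take.
Qed.

Lemma spine_size t eta i : spine t eta -> size (eta i) = i.
Proof.
case=> e0 _ eS; elim: i => [|i IH]; first by rewrite e0.
by have [j ->] := eS i; rewrite size_rcons IH.
Qed.

Lemma spine_take t eta i j : spine t eta -> i <= j -> take i (eta j) = eta i.
Proof.
move=> s; have [e0 _ eS] := s; move=> /subnK <-; elim: (j - i) => [|k IH].
  by rewrite take_oversize // (spine_size _ s).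
have [x ->] := eS (k + i); rewrite -cats1 takel_cat //.
by rewrite (spine_size _ s) leq_addl.
Qed.

Lemma good_spine t eta : good t eta -> spine t eta.
Proof.
move=> g; split; [exact/size0nil/(good_size g)|exact: good_in g|] => i.
have := good_size g i.+1; have := good_take g (leqnSn i).
case/lastP: (eta i.+1) => // u j; rewrite size_rcons => + [su].
rewrite -cats1 takel_cat ?su // take_oversize ?su // => ->.
by exists j; rewrite cats1.
Qed.

Lemma good_spine_unique t eta eta' : good t eta -> spine t eta' -> eta' = eta.
Proof.
move=> g s; apply/funext => J; have [k H] := good_sep g J.
have [_ s1 _] := s.
rewrite -(H (eta' (k + J))) ?(spine_size _ s) ?leq_addr //.
by rewrite (spine_take s) // leq_addl.
Qed.

Lemma good_Tinfty (t : tree) eta : good t eta -> Tinfty t.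
Proof.
move=> g; split.
  by apply: unbounded_infinite => n; exists (eta n); rewrite ?(good_size g) //; exact: good_in.
exists eta; have pat n := good_pattern g n; split.
- exact: good_spine.
- by move=> eta'; exact: good_spine_unique.
- apply: unbounded_infinite => n; have [i ni [e1 _ t1]] := pat n.
  exists (rcons (eta i) (mkpos 0)); last by rewrite size_rcons (good_size g) leqW.
  split; last by exists i, (mkpos 0), (mkpos 1).
  by rewrite -[rcons _ _]cats0; apply/t1; rewrite inE eqxx.
- apply: unbounded_infinite => n; have [i ni [e1 t2 _]] := pat n.
  exists (rcons (eta i) (mkpos 2)); last by rewrite size_rcons (good_size g) leqW.
  by split => //; exists i, (mkpos 2), (mkpos 1).
apply: unbounded_infinite => n; have [i ni [e1 _ t1]] := pat n.
exists (rcons (eta i) (mkpos 0)); last by rewrite size_rcons (good_size g) leqW.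
split.
  split; last by exists i, (mkpos 0), (mkpos 1).
  by rewrite -[rcons _ _]cats0; apply/t1; rewrite inE eqxx.
split; first by apply: finite_set_seq => x /t1; exact.
by rewrite (@card_seq _ _ [:: [::]; [:: mkpos 0]]).
Qed.

Lemma size_mark_path K h sp : shallow K h sp -> size (mark_path sp) = h /\ K <= h.
Proof.
elim: h K sp => [|h IH] K [|[L R0] sp] //=; first by case: K.
by move=> /and3P[_ _ /IH[-> Kh]]; split => //; case: K Kh.
Qed.

Lemma shallow_take K h sp u : shallow K h sp -> inpt (build sp) u ->
  size u = h -> take K u = take K (mark_path sp).
Proof.
elim: h K sp u => [|h IH] [|K] [|[L R0] sp] // [|i u] //=; rewrite ?take0 //.
move=> /and3P[/allP HL /allP HR Hs] /andP[lti Hu] [su].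
have Hlow x : low h x -> inpt x u -> False.
  by move=> lx /(low_inpt lx); rewrite su ltnn.
have [E|ni] := eqVneq (val i).-1 (size L).
  move: Hu; rewrite nth_cat E ltnn subnn /= => /(IH _ _ _ Hs) -> //.
  by rewrite -E mkposK.
exfalso; case: i lti Hu ni => m m0 /=; set p := m.-1.
rewrite size_cat nth_cat /= addnS ltnS.
case: (ltnP p (size L)) => [lt _ Hx _|ge lti].
  by apply: Hlow Hx; apply: HL; exact: mem_nth.
case E : (p - size L) => [|n] /= Hx ni; first by case/eqP: ni; lia.
have ltn : n < size R0 by lia.
by apply: Hlow Hx; apply: HR; exact: mem_nth.
Qed.

Lemma inpt_build_drop i sp v : i <= size sp ->
  inpt (build sp) (take i (mark_path sp) ++ v) = inpt (build (drop i sp)) v.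
Proof.
elim: i sp => [|i IH] [|[L R0] sp] //= lti.
by rewrite size_cat /= addnS ltnS leq_addr nth_cat ltnn subnn /= IH.
Qed.

Lemma size_mark sp : size (mark_path sp) = size sp.
Proof. by elim: sp => [|[L R0] sp IH] //=; rewrite IH. Qed.

Lemma take_mark_pattern i sp : i < size sp -> nth ([::], [::]) sp i = pattern ->
  take i.+1 (mark_path sp) = rcons (take i (mark_path sp)) (mkpos 1).
Proof.
elim: i sp => [|i IH] [|[L R0] sp] //= lti; first by move=> -[-> _]; rewrite take0.
by move=> /(IH _ lti) <-.
Qed.

(** A code of height [h] that reveals the spine up to height [J + j] and an
    occurrence of the pattern between heights [J] and [J + j]. *)
Definition good_mark J j h (sp : marked) :=
  [&& J + j + 3 <= h, shallow (J + j) h sp & pattern \in take j (drop J sp)].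

(** Above height [h] the tree is arbitrary, but its vertices there descend from
    vertices of height [h], which share their first [J + j] steps with the mark;
    the margin 3 leaves room for the pattern and the absence of vertices below
    it. *)
Lemma good_mark_tree (t : tree) J j h sp : good_mark J j h sp ->
  code h t = build sp ->
  let b := mark_path sp in
  [/\ vertices t b, size b = h,
      forall u, vertices t u -> h <= size u -> take (J + j) u = take (J + j) b &
      exists2 i, J <= i < J + j &
        [/\ take i.+1 b = rcons (take i b) (mkpos 1),
            vertices t (rcons (take i b) (mkpos 2)) &
            forall v, vertices t (rcons (take i b) (mkpos 0) ++ v) <->
              v \in [:: [::]; [:: mkpos 0]]]].
Proof.
move=> /and3P[hJ Hs Hp] E b; have [sb _] := size_mark_path Hs.
have ssp : size sp = h by rewrite -size_mark.
have tE u : size u <= h -> vertices t u <-> inpt (build sp) u.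
  by move=> uh; rewrite -E inpt_code; [tauto|exact: tree_treelike].
have bin : inpt (build sp) b.
  by have := @inpt_build_drop h sp [::]; rewrite cats0 take_oversize ?sb ?ssp // => ->.
split => //.
- by apply/tE; rewrite ?sb.
- move=> u tu hu; rewrite -(shallow_take Hs (u := take h u)) ?size_takel //.
    by rewrite take_takel //; lia.
  apply/tE; rewrite ?size_takel //.
  by apply: (@tree_prefix t _ (drop h u)); rewrite cat_take_drop.
have := Hp; move/(nthP ([::], [::])) => [i0]; rewrite size_take_min size_drop leq_min.
move=> /andP[ij iJ]; rewrite nth_take // nth_drop => Hi.
exists (J + i0); first by rewrite leq_addr ltn_add2l.
have lti : J + i0 < size sp by lia.
have inb v : inpt (build sp) (take (J + i0) b ++ v) = inpt (build (pattern :: drop (J + i0).+1 sp)) v.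
  by rewrite inpt_build_drop ?(ltnW lti) // (drop_nth ([::], [::])) // Hi.
have st : size (take (J + i0) b) = J + i0 by rewrite size_takel // sb; lia.
split; first exact: take_mark_pattern.
  by rewrite -cats1; apply/tE; rewrite ?inb // size_cat st /=; lia.
have H0 v : size v <= 2 -> vertices t (rcons (take (J + i0) b) (mkpos 0) ++ v) <->
    v \in [:: [::]; [:: mkpos 0]].
  move=> sv; rewrite tE; last by rewrite size_cat size_rcons st; lia.
  rewrite cat_rcons inb /= !inE; case: v {sv} => [|x [|y v]] //=.
  - rewrite andbT eqseq_cons eqxx andbT /= ltnS leqn0 -(inj_eq val_inj).
    by case: x => -[|[|n]].
  - split => //; case: x => -[|[|n]] //=.
move=> v; have [sv|sv] := leqP (size v) 2; first exact: H0.
split => [tv|]; last by rewrite !inE => /orP[] /eqP E2; rewrite E2 in sv.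
have : vertices t (rcons (take (J + i0) b) (mkpos 0) ++ take 2 v).
  by apply: (@tree_prefix t _ (drop 2 v)); rewrite -catA cat_take_drop.
rewrite H0 ?size_takel // ?(ltnW sv) //.
by case: v sv {tv} => [|x [|y v]].
Qed.

Lemma good_marks_good (t : tree) :
  (forall J, exists j h sp, good_mark J j h sp /\ code h t = build sp) ->
  exists eta, good t eta.
Proof.
move=> H.
have /choice[b Hb] : forall J, exists b : word, exists j h, [/\ J + j + 3 <= h,
      vertices t b, size b = h,
      forall u, vertices t u -> h <= size u -> take (J + j) u = take (J + j) b &
      exists2 i, J <= i < J + j &
        [/\ take i.+1 b = rcons (take i b) (mkpos 1),
            vertices t (rcons (take i b) (mkpos 2)) &
            forall v, vertices t (rcons (take i b) (mkpos 0) ++ v) <->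
              v \in [:: [::]; [:: mkpos 0]]]].
  move=> J; have [j [h [sp [gm E]]]] := H J.
  have [b1 b2 b3 b4] := good_mark_tree gm E.
  by exists (mark_path sp), j, h; split => //; case/and3P: gm.
have tall n : exists2 u, vertices t u & n <= size u.
  by have [j [h [h1 h2 h3 _ _]]] := Hb n; exists (b n) => //; lia.
pose eta J := take J (b J).
have sep J : exists k, forall u, vertices t u -> k <= size u -> take J u = eta J.
  have [j [h [h1 h2 h3 h4 _]]] := Hb J; exists h => u tu hu.
  have := congr1 (take J) (h4 u tu hu).
  by rewrite !take_takel ?leq_addr.
have seta J : size (eta J) = J.
  by have [j [h [h1 h2 h3 _ _]]] := Hb J; rewrite size_takel //; lia.
exists eta; split => //.
- move=> J; have [j [h [h1 h2 h3 h4 _]]] := Hb J.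
  by apply: (@tree_prefix t _ (drop J (b J))); rewrite cat_take_drop.
- move=> i j ij; have [k Hk] := sep i; have [k' Hk'] := sep j.
  have [u tu ku] := tall (maxn k k'); rewrite geq_max in ku.
  have /andP[ku1 ku2] := ku.
  by rewrite -(Hk u) // -(Hk' u) // take_takel.
- move=> J; have [j [h [h1 h2 h3 h4 [i /andP[Ji ij] P]]]] := Hb J.
  exists i => //.
  have E i' : i' <= J + j -> take i' (b J) = eta i'.
    move=> i'j; have [k Hk] := sep i'; have [u tu] := tall (maxn k h).
    rewrite geq_max => /andP[ku hu]; rewrite -(Hk u) //.
    by have := congr1 (take i') (h4 u tu hu); rewrite !take_takel.
  by move: P; rewrite !E //; exact: ltnW.
Qed.

End good_trees.

Section good_almost_surely.
Variables (R : realType).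
Variables (d : measure_display) (Om : measurableType d) (P : probability Om R).
Variables (T : {RV P >-> borel tree}) (hT : is_GW (@geometric_half R) T).
Variables (d' : measure_display) (Om' : measurableType d') (P' : probability Om' R).
Variables (T' : {RV P' >-> borel tree}) (hT' : is_size_biased T T').
Local Open Scope classical_set_scope.

Let goodJh J h : set Om' :=
  [set w | exists j sp, good_mark J j h sp /\ code h (T' w : tree) = build sp].

Let measurable_goodJh J h : measurable (goodJh J h).
Proof.
exact: (@measurable_code _ _ _ P' T' h
  [set t | exists j sp, good_mark J j h sp /\ t = build sp]).
Qed.

Definition good_event : set Om' := \bigcap_J \bigcup_h goodJh J h.

Lemma measurable_good_event : measurable good_event.
Proof. by apply: bigcapT_measurable => J; apply: bigcupT_measurable. Qed.

Lemma good_event_good w : good_event w -> exists eta, good (T' w : tree) eta.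
Proof.
move=> G; apply: good_marks_good => J; have [h _ [j [sp H]]] := G J I.
by exists j, h, sp.
Qed.

(** For each [J], good codes of large height have a mass close to 1. *)
Lemma good_event_full : (P' (~` good_event) = 0)%E.
Proof.
rewrite setC_bigcap; apply/eqP; rewrite eq_le measure_ge0 andbT.
have z J : P' (~` \bigcup_h goodJh J h) = 0%E.
  have mJ : measurable (\bigcup_h goodJh J h) by exact: bigcupT_measurable.
  rewrite probability_setC // (_ : P' _ = 1%E) ?subee //.
  apply/eqP; rewrite eq_le probability_le1 //=; apply/lee_addgt0Pr => e e0.
  have [j [h0 H]] := @mass_ge_good R J e e0.
  pose h := maxn h0 (J + j + 3).
  have := @size_biased_marked_ge R _ _ _ T hT _ _ _ T' hT' h (J + j)
    (good_mark J j h) (1 - e)%R (\bigcup_h goodJh J h).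
  rewrite EFinB leeBlDr //; apply => //.
  - by move=> sp /and3P[].
  - by move=> sp w gm E; exists h => //; exists j, sp.
  apply: mass_ge_sub (H h (leq_maxl _ _)) => sp /andP[s1 s2].
  by apply/and3P; split => //; exact: leq_maxr.
have mJ J : measurable (~` \bigcup_h goodJh J h).
  by apply: measurableC; exact: bigcupT_measurable.
have := measure_sigma_subadditive P' mJ (bigcupT_measurable _ mJ) (@subset_refl _ _).
move=> /le_trans; apply.
by rewrite eseries0 // => J _ _; exact: z.
Qed.

End good_almost_surely.

(** * Permutations, words and patterns *)

Section patterns.
Local Open Scope group_scope.

(** The one-line notation of a permutation of {1, ..., n}. *)
Definition pword n (p : 'S_n) : seq nat := [seq (p i).+1 | i <- enum 'I_n].

Lemma size_pword n (p : 'S_n) : size (pword p) = n.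
Proof. by rewrite size_map size_enum_ord. Qed.

Lemma nth_pword n (p : 'S_n) (i : 'I_n) : nth 0 (pword p) i = (p i).+1.
Proof. by rewrite (nth_map i) ?size_enum_ord // nth_ord_enum. Qed.

Lemma pword_inj n : injective (@pword n).
Proof.
move=> p q H; apply/permP => i; apply: val_inj.
by apply: succn_inj; rewrite -!nth_pword H.
Qed.

Lemma perm_pword n (p : 'S_n) : perm_eq (pword p) (iota 1%N n).
Proof.
have u : uniq (pword p).
  by rewrite map_inj_uniq ?enum_uniq // => i j [] /val_inj /perm_inj.
apply: uniq_perm => //; first exact: iota_uniq.
have [] := @uniq_min_size _ (pword p) (iota 1 n) u; rewrite ?size_pword ?size_iota //.
by move=> _ /mapP[i _ ->]; rewrite mem_iota add1n /= ltnS.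
Qed.

Lemma pword_onto n (l : seq nat) : perm_eq l (iota 1%N n) ->
  exists p : 'S_n, pword p = l.
Proof.
move=> Hl; have sl : size l = n by rewrite (perm_size Hl) size_iota.
have ul : uniq l by rewrite (perm_uniq Hl) iota_uniq.
have lt i : i < n -> 0 < nth 0 l i <= n.
  move=> ltin; have : nth 0 l i \in l by rewrite mem_nth ?sl.
  by rewrite (perm_mem Hl) mem_iota add1n ltnS.
have lt' (i : 'I_n) : (nth 0 l i).-1 < n.
  by have := lt i (ltn_ord i); case: (nth 0 l i).
pose f (i : 'I_n) := Ordinal (lt' i).
have fi : injective f.
  move=> i j /(congr1 val) /= E; apply: val_inj; apply/eqP.
  have il : i < size l by rewrite sl.
  have jl : j < size l by rewrite sl.
  rewrite -(nth_uniq 0 il jl ul).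
  move: E (lt i (ltn_ord i)) (lt j (ltn_ord j)).
  by case: (nth 0 l i) => // a; case: (nth 0 l j) => // b /= ->.
exists (perm fi); apply: (@eq_from_nth _ 0); first by rewrite size_pword.
move=> i; rewrite size_pword => ltin.
rewrite (nth_pword _ (Ordinal ltin)) permE /= prednK //.
by have /andP[] := lt i ltin.
Qed.

(** With three entries, containment no longer quantifies over functions. *)
Lemma contains3 n (p : 'S_n) (s : 'S_3) : contains p s <->
  exists i0 i1 i2 : 'I_n, [/\ i0 < i1, i1 < i2,
    (p i0 < p i1) = (s ord0 < s (inord 1)),
    (p i0 < p i2) = (s ord0 < s (inord 2)) &
    (p i1 < p i2) = (s (inord 1) < s (inord 2))].
Proof.
have v1 : val (inord 1 : 'I_3) = 1%N by rewrite val_insubd.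
have v2 : val (inord 2 : 'I_3) = 2%N by rewrite val_insubd.
split=> [[i [imon ip]]|[i0 [i1 [i2 [h1 h2 p01 p02 p12]]]]].
  exists (i ord0), (i (inord 1)), (i (inord 2)).
  have l01 : (ord0 : 'I_3) < (inord 1 : 'I_3) by rewrite v1.
  have l02 : (ord0 : 'I_3) < (inord 2 : 'I_3) by rewrite v2.
  have l12 : (inord 1 : 'I_3) < (inord 2 : 'I_3) by rewrite v1 v2.
  by split; first [exact: imon|apply/idP/idP => H; apply/ip].
pose i (j : 'I_3) := if val j == 0 then i0 else if val j == 1%N then i1 else i2.
have J (j : 'I_3) : [\/ j = ord0, j = inord 1 | j = inord 2].
  case: j => -[|[|[|j]]] lt //; [apply: Or31|apply: Or32|apply: Or33];
    by apply: val_inj; rewrite /= ?v1 ?v2.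
have e0 : i ord0 = i0 by [].
have e1 : i (inord 1) = i1 by rewrite /i v1.
have e2 : i (inord 2) = i2 by rewrite /i v2.
exists i; split => j k.
  by case: (J j) (J k) => -> [] ->; rewrite ?v1 ?v2 ?e0 ?e1 ?e2 // => _; exact: ltn_trans h2.
by case: (J j) (J k) => -> [] ->; rewrite ?v1 ?v2 ?e0 ?e1 ?e2 ?p01 ?p02 ?p12.
Qed.

(** As permutations are composed from left to right, [rev_perm n * p] reverses
    the positions of [p] and [p * rev_perm n] complements its values. *)
Definition rev_perm n : 'S_n := perm (@rev_ord_inj n).

Lemma rev_permE n (i : 'I_n) : rev_perm n i = rev_ord i.
Proof. by rewrite permE. Qed.

Lemma rev_permK n : rev_perm n * rev_perm n = 1.
Proof. by apply/permP => i; rewrite permM !rev_permE rev_ordK perm1. Qed.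

Lemma rev_ord_lt n (i j : 'I_n) : (rev_ord i < rev_ord j) = (j < i).
Proof. by rewrite /= ltn_sub2lE // ltnS. Qed.

Lemma contains_rev n m (p : 'S_n) (s : 'S_m) :
  contains (rev_perm n * p) (rev_perm m * s) <-> contains p s.
Proof.
have H (q : 'S_n) (r : 'S_m) : contains q r -> contains (rev_perm n * q) (rev_perm m * r).
  move=> [i [imon ip]]; exists (fun j => rev_ord (i (rev_ord j))); split => j k jk.
    by rewrite rev_ord_lt; apply: imon; rewrite rev_ord_lt.
  rewrite !permM !rev_permE !rev_ordK.
  have kj : rev_ord k < rev_ord j by rewrite rev_ord_lt.
  have := ip _ _ kj.
  case: (ltngtP (q (i (rev_ord k))) (q (i (rev_ord j)))) => [lt H1|gt H1|/val_inj/perm_inj E _].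
  - by split => // H2; have := H1.1 isT; rewrite ltnNge (ltnW H2).
  - split => // _; rewrite ltn_neqAle leqNgt; apply/andP; split; last by apply/negP => /H1.
    by rewrite (inj_eq val_inj) (inj_eq perm_inj) (inj_eq rev_ord_inj) neq_ltn jk.
  - by have := imon _ _ kj; rewrite E ltnn.
split; last exact: H.
by move=> /H; rewrite !mulgA !rev_permK !mul1g.
Qed.

Lemma contains_compl n m (p : 'S_n) (s : 'S_m) :
  contains (p * rev_perm n) (s * rev_perm m) <-> contains p s.
Proof.
have H (q : 'S_n) (r : 'S_m) : contains q r -> contains (q * rev_perm n) (r * rev_perm m).
  move=> [i [imon ip]]; exists i; split => // j k jk.
  rewrite !permM !rev_permE !rev_ord_lt.
  have := ip _ _ jk; have := imon _ _ jk.
  case: (ltngtP (q (i j)) (q (i k))) => [lt _ H1|gt _ H1|/val_inj/perm_inj ->].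
  - by split => // H2; have := H1.1 isT; rewrite ltnNge (ltnW H2).
  - split => // _; rewrite ltn_neqAle leqNgt; apply/andP; split; last by apply/negP => /H1.
    by rewrite (inj_eq val_inj) (inj_eq perm_inj) eq_sym neq_ltn jk.
  - by rewrite ltnn.
split; last exact: H.
by move=> /H; rewrite -!mulgA !rev_permK !mulg1.
Qed.

Lemma mem_Av n m (s : 'S_m) (p : 'S_n) : p \in Av n s <-> ~ contains p s.
Proof. by rewrite inE; split => [/asboolP|/asboolP]. Qed.

Lemma perm_Av_rev n m (s : 'S_m) (l : seq 'S_n) :
  perm_eq l (enum (Av n s)) ->
  perm_eq [seq rev_perm n * p | p <- l] (enum (Av n (rev_perm m * s))).
Proof.
move=> H; apply: uniq_perm.
- by rewrite map_inj_uniq ?(perm_uniq H) ?enum_uniq //; exact: mulgI.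
- exact: enum_uniq.
move=> p; rewrite mem_enum; apply/mapP/idP => [[q + ->]|].
  by rewrite (perm_mem H) mem_enum !mem_Av contains_rev.
move=> pA; exists (rev_perm n * p); last by rewrite mulgA rev_permK mul1g.
rewrite (perm_mem H) mem_enum; apply/mem_Av; move/mem_Av: pA.
by rewrite -(contains_rev _ s) mulgA rev_permK mul1g.
Qed.

Lemma perm_Av_compl n m (s : 'S_m) (l : seq 'S_n) :
  perm_eq l (enum (Av n s)) ->
  perm_eq [seq p * rev_perm n | p <- l] (enum (Av n (s * rev_perm m))).
Proof.
move=> H; apply: uniq_perm.
- by rewrite map_inj_uniq ?(perm_uniq H) ?enum_uniq //; exact: mulIg.
- exact: enum_uniq.
move=> p; rewrite mem_enum; apply/mapP/idP => [[q + ->]|].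
  by rewrite (perm_mem H) mem_enum !mem_Av contains_compl.
move=> pA; exists (p * rev_perm n); last by rewrite -mulgA rev_permK mulg1.
rewrite (perm_mem H) mem_enum; apply/mem_Av; move/mem_Av: pA.
by rewrite -(contains_compl _ s) -mulgA rev_permK mulg1.
Qed.

End patterns.

(** * Trees and 231-avoiding permutations *)

Definition plane_trees n : seq ptree := map (head pleaf) (forests 1 n).

Lemma mem_plane_trees n t : (t \in plane_trees n) = (nodes t == n.+1).
Proof.
apply/mapP/eqP => [[f]|tn].
  rewrite mem_forests; case: f => [|x []] //= /eqP.
  by rewrite /fsize /= addn0 => + ->.
by exists [:: t] => //; rewrite mem_forests /fsize /= addn0 tn eqxx.
Qed.

Lemma plane_trees_uniq n : uniq (plane_trees n).
Proof.
rewrite map_inj_in_uniq ?forests_uniq // => f g; rewrite !mem_forests.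
by case: f => [|x []] //; case: g => [|y []] //= _ _ ->.
Qed.

Lemma size_plane_trees n : size (plane_trees n) = ballot 1 n.
Proof. by rewrite size_map. Qed.

Definition avoids231 (l : seq nat) : Prop := forall i j k, i < j -> j < k ->
  k < size l -> ~~ ((nth 0 l k < nth 0 l i) && (nth 0 l i < nth 0 l j)).

Lemma avoids231_cons x l : avoids231 (x :: l) <-> avoids231 l /\
  forall j k, j < k -> k < size l -> ~~ ((nth 0 l k < x) && (x < nth 0 l j)).
Proof.
split=> [H|[H1 H2] [|i] [|j] [|k] //=]; last first.
- by rewrite !ltnS; exact: H1.
- by rewrite !ltnS => _; exact: H2.
split=> [i j k ij jk kl|j k jk kl]; first exact: (H i.+1 j.+1 k.+1).
exact: (H 0 j.+1 k.+1).
Qed.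

Lemma avoids231_cat l1 l2 : avoids231 (l1 ++ l2) -> avoids231 l1 /\ avoids231 l2.
Proof.
move=> H; split => i j k ij jk kl.
  have := H i j k ij jk; rewrite size_cat !nth_cat kl.
  by rewrite (ltn_trans jk kl) (ltn_trans ij (ltn_trans jk kl)) => /(_ (ltn_addr _ kl)).
have := H (size l1 + i) (size l1 + j) (size l1 + k).
rewrite !ltn_add2l size_cat !nth_cat !ltnNge !leq_addr /= !addKn -!ltnNge.
by rewrite ltn_add2l; exact.
Qed.

Lemma avoids231_map (f : nat -> nat) l :
  {in l &, {mono f : x y / x < y}} -> avoids231 (map f l) <-> avoids231 l.
Proof.
move=> fm; split => H i j k ij jk; have := H i j k ij jk;
  rewrite size_map => {}H kl; have := H kl; have jl := ltn_trans jk kl;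
  have il := ltn_trans ij jl;
  by rewrite !(nth_map 0) // !fm // mem_nth.
Qed.

(** The postorder ranks of the non-root vertices, listed in preorder. The first
    child [x] of the root has rank [nodes x], being completed right after its
    descendants; the ranks to its right are shifted by as much. *)
Fixpoint postranks (t : ptree) : seq nat := let: Node s := t in
  (fix go (s : seq ptree) : seq nat :=
    if s is x :: s' then
      nodes x :: postranks x ++ map (addn (nodes x)) (go s')
    else [::]) s.

Lemma postranks_cons x s : postranks (Node (x :: s)) =
  nodes x :: postranks x ++ map (addn (nodes x)) (postranks (Node s)).
Proof. by []. Qed.

Lemma size_postranks t : (size (postranks t)).+1 = nodes t.
Proof.
case: t => s; elim/forest_ind: s => // s1 s IH1 IH.
rewrite postranks_cons [RHS]nodesE fsize_cons -IH1; congr _.+1.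
rewrite -cat1s !size_cat size_map add1n addSn; congr (_ + _).+1.
by move: IH; rewrite nodesE => -[].
Qed.

Lemma perm_postranks t : perm_eq (postranks t) (iota 1 (nodes t).-1).
Proof.
case: t => s; elim/forest_ind: s => // s1 s IH1 IH.
rewrite postranks_cons; set x := Node s1.
have -> : (nodes (Node (x :: s))).-1 = (nodes x).-1 + (1 + fsize s).
  by rewrite add1n addnS -addSn prednK ?nodes_gt0.
rewrite iotaD -cat1s perm_catCA; apply: perm_cat => //.
rewrite add1n prednK ?nodes_gt0 // iotaD; apply: perm_cat => //.
by rewrite iotaDl; apply: perm_map.
Qed.

Lemma postranks_lt t y : y \in postranks t -> 0 < y < nodes t.
Proof.
rewrite (perm_mem (perm_postranks t)) mem_iota add1n.
by rewrite prednK ?nodes_gt0.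
Qed.

(** If [u] and [v] come after [w] in preorder, in this order, and [v] is
    completed before [w], then [v] is a descendant of [w], hence so is [u],
    which is completed before [w] as well. *)
Lemma postranks_avoids t : avoids231 (postranks t).
Proof.
case: t => s; elim/forest_ind: s => [|s1 s IH1 IH]; first by move=> i j k.
rewrite postranks_cons; set x := Node s1; set l1 := postranks x.
set l2 := map _ _.
have H2 : avoids231 l2.
  by apply/avoids231_map => // a b _ _; rewrite ltn_add2l.
have lt1 i : i < size l1 -> nth 0 l1 i < nodes x.
  by move=> /(mem_nth 0) /postranks_lt /andP[].
have lt2 i : i < size l2 -> nodes x < nth 0 l2 i.
  move=> /(mem_nth 0) /mapP[y /postranks_lt /andP[y0 _] ->].
  by rewrite -addn1 leq_add2l.
apply/avoids231_cons; split.
  move=> i j k ij jk; rewrite size_cat !nth_cat => kl.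
  case: (ltnP k (size l1)) => [kl1|kl1].
    by rewrite (ltn_trans jk kl1) (ltn_trans ij (ltn_trans jk kl1)); exact: IH1.
  have kl2 : k - size l1 < size l2 by rewrite ltn_subLR.
  case: (ltnP i (size l1)) => [il1|il1].
    by rewrite negb_and -leqNgt (ltnW (ltn_trans (lt1 _ il1) (lt2 _ kl2))).
  have jl1 := leq_trans il1 (ltnW ij).
  by rewrite [j < size l1]ltnNge jl1 /=; apply: H2; rewrite ?ltn_sub2rE.
move=> j k jk; rewrite size_cat !nth_cat => kl.
case: (ltnP k (size l1)) => kl1.
  by rewrite (ltn_trans jk kl1) negb_and orbC -leqNgt ltnW // lt1 // (ltn_trans jk).
by rewrite negb_and -leqNgt ltnW // lt2 // ltn_subLR.
Qed.

Lemma postranks_inj t t' : postranks t = postranks t' -> t = t'.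
Proof.
case: t => s; case: t' => s'; elim/forest_ind: s s' => [|s1 s IH1 IH] [|[s1'] s'] //.
rewrite !postranks_cons => H.
have E : nodes (Node s1) = nodes (Node s1') := congr1 (head 0) H.
have /eqP := congr1 behead H; rewrite /behead eqseq_cat; last first.
  by apply: succn_inj; rewrite !size_postranks.
rewrite E => /andP[/eqP /IH1 [->] /eqP /(inj_map (@addnI _)) /IH [->]].
by [].
Qed.

(** Below its first entry [x], a word that avoids 231 has all the values
    smaller than [x] before the larger ones: a larger value followed by a smaller
    one would complete the pattern. *)
Lemma split_at_pivot x l : x \notin l ->
  (forall j k, j < k -> k < size l -> ~~ ((nth 0 l k < x) && (x < nth 0 l j))) ->
  l = [seq y <- l | y < x] ++ [seq y <- l | x < y].
Proof.
elim: l => //= y l IH; rewrite in_cons negb_or => /andP[xy xl] H.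
have {}IH : l = [seq y <- l | y < x] ++ [seq y <- l | x < y].
  by apply: IH => // j k jk kl; exact: (H j.+1 k.+1).
case: (ltngtP y x) xy => // [yx _|xy _]; first by rewrite /= -IH.
have Hl : all (fun z => x < z) l.
  apply/(all_nthP 0) => i il; have := H 0 i.+1 isT il.
  rewrite /= xy andbT -leqNgt leq_eqVlt => /predU1P[E|//].
  by rewrite E mem_nth in xl.
rewrite [[seq y <- l | y < x]](_ : _ = [::]) /=.
  by congr cons; apply/esym/all_filterP.
apply/eqP; rewrite -(negbK (_ == _)) -has_filter -all_predC.
by apply: sub_all Hl => z /= xz; rewrite -leqNgt ltnW.
Qed.

(** The first entry of the word is the size of the first subtree; the values
    below it code this subtree and those above it the rest of the tree. *)
Lemma postranks_onto n l : perm_eq l (iota 1 n) -> avoids231 l ->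
  exists2 t, nodes t = n.+1 & postranks t = l.
Proof.
elim/ltn_ind: n l => n IH [|x l] Hl Al.
  by exists pleaf => //; rewrite -(size_iota 1 n) -(perm_size Hl).
have [A1 A2] := (avoids231_cons x l).1 Al.
have ul : uniq (x :: l) by rewrite (perm_uniq Hl) iota_uniq.
have := split_at_pivot (andP ul).1 A2.
set l1 := [seq y <- l | y < x]; set l2 := [seq y <- l | x < y] => El.
have xn : 0 < x <= n.
  by have := mem_head x l; rewrite (perm_mem Hl) mem_iota add1n ltnS.
have lmem y : (y \in x :: l) = (0 < y <= n).
  by rewrite (perm_mem Hl) mem_iota add1n ltnS.
have xl y : y != x -> (y \in l) = (y \in x :: l).
  by rewrite in_cons => /negbTE ->.
have H1 : perm_eq l1 (iota 1 x.-1).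
  apply: uniq_perm; [exact/filter_uniq/(andP ul).2|exact: iota_uniq|] => y.
  rewrite mem_filter mem_iota add1n; case: (ltngtP y x) => [yx|yx|->] /=.
  - by rewrite xl ?lmem ?neq_ltn ?yx // prednK ?yx ?andbT; lia.
  - by lia.
  - by lia.
have H2 : perm_eq (map (subn^~ x) l2) (iota 1 (n - x)).
  have im : {in l2 &, injective (subn^~ x)}.
    by move=> y z; rewrite !mem_filter => /andP[xy _] /andP[xz _] /=; lia.
  apply: uniq_perm; [|exact: iota_uniq|] => [|y].
    by rewrite map_inj_in_uniq //; exact/filter_uniq/(andP ul).2.
  rewrite mem_iota; apply/mapP/idP => [[z + ->]|yn].
    rewrite mem_filter => /andP[xz zl]; have : z \in x :: l by rewrite in_cons zl orbT.
    by rewrite lmem; lia.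
  exists (y + x); last by rewrite addnK.
  by rewrite mem_filter xl ?lmem; lia.
have Al12 : avoids231 (l1 ++ l2) by rewrite -El.
have [B1 B2] := avoids231_cat Al12.
have [|||t1 n1 E1] := IH x.-1 _ l1 => //; first by lia.
have B2' : avoids231 (map (subn^~ x) l2).
  apply/avoids231_map => // y z; rewrite !mem_filter => /andP[xy _] /andP[xz _] /=; lia.
have [|||[s] n2 E2] := IH (n - x) _ (map (subn^~ x) l2) => //; first by lia.
have n1' : nodes t1 = x by lia.
exists (Node (t1 :: s)).
  by move: n2; rewrite !nodesE fsize_cons n1'; lia.
rewrite postranks_cons n1' E1 E2 El; congr (_ :: _ ++ _).
rewrite -map_comp -[RHS]map_id; apply/eq_in_map => y.
by rewrite mem_filter /= => /andP[xy _]; lia.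
Qed.

(** ** Subtrees and the preorder *)

Fixpoint subp (t : ptree) (u : word) : ptree :=
  if u is i :: u' then subp (nth pleaf (kids t) (val i).-1) u' else t.

Lemma inpt_cat t u v : inpt t (u ++ v) = inpt t u && inpt (subp t u) v.
Proof. by elim: u t => //= i u IH t; rewrite IH andbA. Qed.

Lemma card_fringe t u : inpt t u -> card (fringe (tree_of t) u) = nodes (subp t u).
Proof.
move=> tu; rewrite -size_preorder -(size_map (cat u)); apply: card_seq.
  rewrite map_inj_uniq ?preorder_uniq // => v w /eqP.
  by rewrite eqseq_cat // => /andP[_ /eqP].
move=> v; rewrite /fringe tree_ofE /mkset; split=> [[+ [w E]]|/mapP[w + ->]].
  by rewrite E inpt_cat tu /= => Hw; rewrite map_f // mem_preorder.
by rewrite mem_preorder => Hw; split; [rewrite inpt_cat tu|exists w].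
Qed.

(** The vertices completed up to and including [u] are those discovered before
    [u], except its strict ancestors, and those of the subtree at [u]; [i] does
    not count the root, which is one of these ancestors. The [k] leaves in front
    of [s] only account for the shift of the labels in [preorderF k s]. *)
Lemma nth_postranksF k s i : i < fsize s ->
  nth 0 (postranks (Node s)) i + size (nth [::] (preorderF k s) i) =
  i.+1 + nodes (subp (Node (nseq k pleaf ++ s)) (nth [::] (preorderF k s) i)).
Proof.
elim/forest_ind: s k i => // s1 s IH1 IH k [|i].
  move=> _; rewrite preorderF_cons postranks_cons /=.
  by rewrite nth_cat size_nseq ltnn subnn /= addn1 add1n.
rewrite fsize_cons preorderF_cons postranks_cons nodesE addSn ltnS => lti.
rewrite /= !nth_cat size_map size_preorderF.
have := size_postranks (Node s1); rewrite nodesE => -[->].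
case: ltnP => [lt1|ge1].
  rewrite (nth_map [::]) ?size_preorderF //= nth_cat size_nseq ltnn subnn /=.
  by have := IH1 0 i lt1; rewrite /= => H; rewrite addnS H.
have lt2 : i - fsize s1 < fsize s by rewrite ltn_subLR.
have := IH k.+1 _ lt2.
rewrite (nth_map 0); last first.
  by have := size_postranks (Node s); rewrite nodesE => -[->].
have : nth [::] (preorderF k.+1 s) (i - fsize s1) \in preorderF k.+1 s.
  by rewrite mem_nth ?size_preorderF.
rewrite mem_preorderF; case: (nth [::] _ _) => // -[j j0] v.
move=> /andP[/andP[/= kj _] _].
have -> : j.-1 = (k + (j.-1 - k.+1)).+1 by lia.
rewrite /= -addnS !nth_cat !size_nseq !ltnNge !leq_addr !addKn /=; lia.
Qed.

Lemma nth_postranks t i : 0 < i < nodes t ->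
  nth 0 (postranks t) i.-1 + size (nth [::] (preorder t) i) =
  i + card (fringe (tree_of t) (nth [::] (preorder t) i)).
Proof.
move=> /andP[i0 it].
rewrite card_fringe; last by rewrite -mem_preorder mem_nth ?size_preorder.
case: t it => s; rewrite nodesE ltnS preorderE; case: i i0 => // i _ it.
exact: (@nth_postranksF 0).
Qed.

Lemma contains231 n (p : 'S_n) (s : 'S_3) :
  (s ord0 < s (inord 1)) -> (s (inord 2) < s ord0) ->
  contains p s <-> ~ avoids231 (pword p).
Proof.
move=> s01 s20; rewrite contains3 s01.
have -> : (s ord0 < s (inord 2)) = false by rewrite ltnNge (ltnW s20).
have -> : (s (inord 1) < s (inord 2)) = false by rewrite ltnNge (ltnW (ltn_trans s20 s01)).
split=> [[i0 [i1 [i2 [h1 h2 p01 p02 p12]]]] A|].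
  have := A i0 i1 i2 h1 h2; rewrite size_pword !nth_pword !ltnS => /(_ (ltn_ord _)).
  rewrite p01 andbT => /negP; apply.
  rewrite ltn_neqAle leqNgt p02 andbT (inj_eq val_inj) (inj_eq perm_inj).
  by rewrite neq_ltn (ltn_trans h1 h2) orbT.
move=> nA; apply: contrapT => H; apply: nA => i j k ij jk.
rewrite size_pword => kn; have jn := ltn_trans jk kn; have iN := ltn_trans ij jn.
rewrite (nth_pword p (Ordinal kn)) (nth_pword p (Ordinal jn)) (nth_pword p (Ordinal iN)).
rewrite !ltnS; apply/negP => /andP[ki ij']; apply: H.
exists (Ordinal iN), (Ordinal jn), (Ordinal kn); split => //.
  by rewrite ltnNge (ltnW ki).
by rewrite ltnNge (ltnW (ltn_trans ki ij')).
Qed.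

(** The identity stands for the trees that do not have [n] edges. *)
Definition perm231 n (t : ptree) : 'S_n :=
  odflt 1%g [pick p : 'S_n | pword p == postranks t].

Lemma pword_perm231 n t : nodes t = n.+1 -> pword (perm231 n t) = postranks t.
Proof.
move=> tn; rewrite /perm231; case: pickP => [p /eqP //|H].
have [p Hp] : exists p : 'S_n, pword p = postranks t.
  by apply: pword_onto; have := perm_postranks t; rewrite tn.
by have := H p; rewrite Hp eqxx.
Qed.

Lemma perm_Av231 n (s : 'S_3) :
  (s ord0 < s (inord 1)) -> (s (inord 2) < s ord0) ->
  perm_eq (map (perm231 n) (plane_trees n)) (enum (Av n s)).
Proof.
move=> s01 s20; apply: uniq_perm; rewrite ?enum_uniq //.
  rewrite map_inj_in_uniq ?plane_trees_uniq // => t t'.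
  rewrite !mem_plane_trees => /eqP tn /eqP tn' /(congr1 (@pword n)).
  by rewrite !pword_perm231 //; exact: postranks_inj.
move=> p; rewrite mem_enum; apply/mapP/idP => [[t + ->]|/mem_Av].
  rewrite mem_plane_trees => /eqP tn; apply/mem_Av.
  rewrite contains231 // pword_perm231 //.
  by have := @postranks_avoids t; tauto.
rewrite contains231 // => /contrapT A.
have [t tn E] := postranks_onto (perm_pword p) A.
exists t; first by rewrite mem_plane_trees tn.
by apply: pword_inj; rewrite pword_perm231.
Qed.

(** * Trees and 321-avoiding permutations *)

(** Position 0 counts as a jump as soon as the first entry is positive. *)
Definition jump (M : seq nat) (j : nat) : bool := nth 0 (0 :: M) j < nth 0 M j.

(** Dyck paths of length [2 * n], as weakly increasing sequences of column
    heights that stay above the diagonal. *)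
Record is_stair (n : nat) (M : seq nat) : Prop := IsStair {
  stair_size : size M = n;
  stair_mono : forall i j, i <= j -> j < n -> nth 0 M i <= nth 0 M j;
  stair_ge : forall j, j < n -> j < nth 0 M j;
  stair_le : forall j, j < n -> nth 0 M j <= n }.

(** The contour of a tree as a staircase: entry [j] is the number of vertices
    discovered when the vertex of postorder rank [j + 1] is completed. *)
Fixpoint stairs (t : ptree) : seq nat := let: Node s := t in
  (fix go (s : seq ptree) : seq nat :=
    if s is x :: s' then
      map S (stairs x) ++ nodes x :: map (addn (nodes x)) (go s')
    else [::]) s.

Arguments stairs : simpl never.

Lemma stairs_cons x s : stairs (Node (x :: s)) =
  map S (stairs x) ++ nodes x :: map (addn (nodes x)) (stairs (Node s)).
Proof. by []. Qed.

Lemma size_stairs s : size (stairs (Node s)) = fsize s.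
Proof.
elim/forest_ind: s => // s1 s IH1 IH.
rewrite stairs_cons size_cat size_map IH1 -cat1s size_cat size_map IH.
by rewrite fsize_cons nodesE add1n addnS addSn.
Qed.

Lemma nth_stairs s1 s j : nth 0 (stairs (Node (Node s1 :: s))) j =
  if j < fsize s1 then (nth 0 (stairs (Node s1)) j).+1
  else if j == fsize s1 then (fsize s1).+1
  else if j < fsize (Node s1 :: s) then
    (fsize s1).+1 + nth 0 (stairs (Node s)) (j - (fsize s1).+1) else 0.
Proof.
rewrite stairs_cons nth_cat size_map size_stairs.
case: ltnP => [lt|ge]; first by rewrite (nth_map 0) ?size_stairs.
case: eqP => [->|/eqP ne]; first by rewrite subnn.
have -> : j - fsize s1 = (j - (fsize s1).+1).+1 by lia.
rewrite fsize_cons nodesE [nth _ (_ :: _) _]/=.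
case: ltnP => lt; last by rewrite nth_default // size_map size_stairs; lia.
by rewrite (nth_map 0) // size_stairs; lia.
Qed.

Lemma stairs_stair s : is_stair (fsize s) (stairs (Node s)).
Proof.
elim/forest_ind: s => [|s1 s [_ m1 g1 l1] [_ m2 g2 l2]]; first by split.
split; first exact: size_stairs.
- move=> i j ij jn; rewrite !nth_stairs jn (leq_ltn_trans ij jn).
  case: (ltnP j (fsize s1)) => j1.
    by rewrite (leq_ltn_trans ij j1) ltnS; exact: m1.
  case: (ltnP i (fsize s1)) => i1.
    case: eqP => _; first by rewrite ltnS; exact: l1.
    by rewrite (leq_trans _ (leq_addr _ _)) // ltnS; exact: l1.
  case: (i =P fsize s1) => [_|/eqP i2].
    by case: eqP => _ //; exact: leq_addr.
  case: (j =P fsize s1) => [|/eqP j2]; first by move=> E; lia.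
  by rewrite leq_add2l; apply: m2; move: jn; rewrite ?fsize_cons ?nodesE; lia.
- move=> j jn; rewrite nth_stairs jn.
  case: (ltnP j (fsize s1)) => j1; first by rewrite ltnS; exact: ltnW (g1 _ j1).
  case: eqP => [-> //|/eqP j2].
  have := g2 (j - (fsize s1).+1); move: jn; rewrite fsize_cons nodesE; lia.
move=> j jn; rewrite nth_stairs jn fsize_cons nodesE.
case: (ltnP j (fsize s1)) => j1; first by have := l1 _ j1; lia.
case: eqP => [_|/eqP j2]; first by lia.
have := l2 (j - (fsize s1).+1); move: jn; rewrite fsize_cons nodesE; lia.
Qed.

Lemma stairs_inj s s' : stairs (Node s) = stairs (Node s') -> s = s'.
Proof.
elim/forest_ind: s s' => [|s1 s IH1 IH] [|[s1'] s'] //.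
- by move/(congr1 size); rewrite !size_stairs fsize_cons nodesE.
- by move/(congr1 size); rewrite !size_stairs fsize_cons nodesE.
move=> H.
have E : fsize s1 = fsize s1'.
  have := congr1 (fun l => nth 0 l (fsize s1)) H.
  have := congr1 (fun l => nth 0 l (fsize s1')) H.
  rewrite /= !nth_stairs !ltnn !eqxx.
  have g1 := stair_ge (stairs_stair s1); have g1' := stair_ge (stairs_stair s1').
  case: (ltngtP (fsize s1) (fsize s1')) => // [lt _ [E]|gt [E]].
    by have := g1' _ lt; rewrite -E ltnn.
  by have := g1 _ gt; rewrite E ltnn.
move: H; rewrite !stairs_cons => /eqP; rewrite eqseq_cat ?size_map ?size_stairs //.
rewrite eqseq_cons !nodesE E eqxx => /andP[/eqP /(inj_map succn_inj) /IH1 ->].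
by move=> /eqP /(inj_map (@addnI _)) /IH ->.
Qed.

(** The first column that only just passes the diagonal ends the contour of the
    first subtree. *)
Lemma stairs_onto n M : is_stair n M -> exists2 s, fsize s = n & stairs (Node s) = M.
Proof.
elim/ltn_ind: n M => n IH M [sM mM gM lM].
have [n0|n0] := posnP n.
  by exists [::] => //; apply/esym/size0nil; rewrite sM.
have ex : exists j, (j < n) && (nth 0 M j == j.+1).
  exists n.-1; rewrite prednK // leqnn /= eqn_leq.
  have := gM n.-1; have := lM n.-1; rewrite prednK // leqnn => -> // -> //.
pose a := ex_minn ex.
have [/andP[an /eqP Ma] amin] : (a < n) && (nth 0 M a == a.+1) /\
    forall j, j < a -> j.+1 < nth 0 M j.
  rewrite /a; case: ex_minnP => a' Ha' min'; split => // j ja'.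
  have jn : j < n by case/andP: Ha' => ? _; exact: ltn_trans ja' _.
  rewrite ltn_neqAle eq_sym gM // andbT; apply: contraL ja' => Mj.
  by rewrite -leqNgt min' // jn.
pose M1 := [seq x.-1 | x <- take a M]; pose M2 := [seq x - a.+1 | x <- drop a.+1 M].
have s1 : size M1 = a by rewrite size_map size_takel // sM ltnW.
have s2 : size M2 = n - a.+1 by rewrite size_map size_drop sM.
have n1 j : j < a -> nth 0 M1 j = (nth 0 M j).-1.
  by move=> ja; rewrite (nth_map 0) ?nth_take // size_takel // sM ltnW.
have n2 j : j < n - a.+1 -> nth 0 M2 j = nth 0 M (a.+1 + j) - a.+1.
  by move=> ja; rewrite (nth_map 0) ?nth_drop // size_drop sM.
have [||f1 f1s E1] := IH a _ M1 => //.
  split => // [i j ij ja|j ja|j ja]; rewrite ?n1 ?(leq_ltn_trans ij ja) //.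
  - by have := mM i j ij (ltn_trans ja an); lia.
  - by have := amin _ ja; lia.
  - by have := mM j a (ltnW ja) an; rewrite Ma; lia.
have [||f2 f2s E2] := IH (n - a.+1) _ M2; first by lia.
  split => // [i j ij ja|j ja|j ja]; rewrite ?n2 ?(leq_ltn_trans ij ja) //.
  - by have := mM (a.+1 + i) (a.+1 + j); lia.
  - by have := gM (a.+1 + j); lia.
  - by have := lM (a.+1 + j); lia.
exists (Node f1 :: f2); first by rewrite fsize_cons nodesE f1s f2s; lia.
rewrite stairs_cons nodesE f1s E1 E2 -[RHS](cat_take_drop a); congr (_ ++ _).
  rewrite -map_comp -[RHS]map_id; apply/eq_in_map => x /(nthP 0)[j].
  rewrite size_takel ?sM ?(ltnW an) // => ja; rewrite nth_take // => <- /=.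
  by rewrite prednK // (leq_ltn_trans _ (gM _ (ltn_trans ja an))).
rewrite (drop_nth 0) ?sM // Ma; congr cons.
rewrite -map_comp -[RHS]map_id; apply/eq_in_map => x /(nthP 0)[j].
rewrite size_drop sM nth_drop => ja <- /=; rewrite subnKC //.
have := gM (a.+1 + j); lia.
Qed.

(** ** Leaves are the jumps of the staircase *)

Lemma size_nth_preorderF k s i : i < fsize s ->
  0 < size (nth [::] (preorderF k s) i) <= i.+1.
Proof.
elim/forest_ind: s k i => // s1 s IH1 IH k [|i] //.
rewrite fsize_cons nodesE addSn ltnS preorderF_cons /= => lti.
rewrite nth_cat size_map size_preorderF; case: (ltnP i (fsize s1)) => [lt1|ge1].
  by rewrite (nth_map [::]) ?size_preorderF //=; have := IH1 0 i lt1; lia.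
by have := IH k.+1 (i - fsize s1); lia.
Qed.

Lemma nth_nseq_cat k (s : seq ptree) m :
  nth pleaf (nseq k pleaf ++ s) (k + m) = nth pleaf s m.
Proof. by rewrite nth_cat size_nseq ltnNge leq_addr addKn. Qed.

(** A vertex is a leaf if its discovery is immediately followed by its
    completion. For a leaf of preorder rank [i.+1], the staircase then jumps to
    the value [i.+1], at the column given by the number of vertices completed
    before; these are the vertices discovered before, except the ancestors. *)
Lemma leaf_jumpF k s i j : i < fsize s -> j < fsize s ->
  (kids (subp (Node (nseq k pleaf ++ s)) (nth [::] (preorderF k s) i)) == [::]) &&
  (i.+1 == j + size (nth [::] (preorderF k s) i)) =
  jump (stairs (Node s)) j && (nth 0 (stairs (Node s)) j == i.+1).
Proof.
elim/forest_ind: s k i j => // s1 s IH1 IH k i j iN jN.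
have [_ m g l] := stairs_stair (Node s1 :: s).
have [_ m1 g1 l1] := stairs_stair s1.
have [_ m2 g2 l2] := stairs_stair s.
have szF := size_nth_preorderF.
set M := stairs _; have jumpE : jump M j = (nth 0 (0 :: M) j < nth 0 M j) by [].
have Mj : nth 0 M j = _ := nth_stairs s1 s j; rewrite jN in Mj.
case: i iN => [_|i].
  rewrite preorderF_cons /= nth_cat size_nseq ltnn subnn /= addn1 eqSS.
  rewrite [0 == j]eq_sym; case: j jN Mj jumpE => [jN Mj jumpE|j jN Mj jumpE].
    rewrite andbT jumpE /= Mj; have [E|lt0] := posnP (fsize s1).
      by have := size_fsize s1; rewrite E leqn0 size_eq0 => ->.
    rewrite ltn0Sn eqSS -[nth _ _ 0 == 0]negbK -lt0n (g1 0 lt0) andbF.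
    by apply/negP => /eqP s10; rewrite s10 in lt0.
  rewrite andbF jumpE; apply/esym/negbTE; apply/negP => /andP[/= H /eqP E].
  by have := g j (ltnW jN); rewrite -/M; lia.
rewrite fsize_cons nodesE addSn ltnS => lti.
rewrite preorderF_cons /= nth_cat size_map size_preorderF.
have -> : jump M j = [|| j == 0, j == (fsize s1).+1 |
    if j < fsize s1 then jump (stairs (Node s1)) j
    else (fsize s1 < j) && jump (stairs (Node s)) (j - (fsize s1).+1)].
  rewrite jumpE; case: j jN Mj {jumpE} => [|j] jN Mj.
    by rewrite /=; have := g 0 jN.
  rewrite eqSS /=; have := nth_stairs s1 s j; rewrite -/M (ltnW jN) => Mj'.
  rewrite Mj Mj'; have [lt|ge] := ltnP j.+1 (fsize s1).
    by rewrite (ltnW lt) ltnS [j == _](_ : _ = false) //; lia.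
  have [E|/eqP ne] := j.+1 =P fsize s1.
    rewrite -E ltnSn ltnn [j == _](_ : _ = false) /=; last by lia.
    by have := g1 j; rewrite -E => /(_ (ltnSn _)) ?; lia.
  have gt : fsize s1 <= j by lia.
  rewrite [j < fsize s1]ltnNge gt /=; have [E|/eqP ne'] := j =P fsize s1.
    rewrite E subnn; have := g2 0; move: jN; rewrite fsize_cons nodesE -E; lia.
  have -> : j.+1 - (fsize s1).+1 = (j - (fsize s1).+1).+1 by lia.
  by rewrite ltn_add2l ltnS gt.
clearbody M.
case: (ltnP i (fsize s1)) => [lt1|ge1].
  rewrite (nth_map [::]) ?size_preorderF //= nth_cat size_nseq ltnn subnn /=.
  rewrite addnS eqSS Mj; case: (ltnP j (fsize s1)) => [jl|jl].
    have := IH1 0 i j lt1 jl; rewrite /= => ->; rewrite eqSS.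
    have -> : (j == (fsize s1).+1) = false by lia.
    case: (j =P 0) => [->|_] //=.
    by rewrite /jump /= (g1 0 (leq_ltn_trans (leq0n _) lt1)).
  rewrite [X in _ && X](_ : _ = false); last by have := szF 0 s1 i lt1; lia.
  rewrite andbF; apply/esym/negbTE; case: (j =P fsize s1) => [E|/eqP ne].
    have -> : (j == 0) = false by lia.
    have -> : (j == (fsize s1).+1) = false by lia.
    by rewrite E ltnn.
  have := g2 (j - (fsize s1).+1); move: jN; rewrite fsize_cons nodesE => jN lt.
  have {}lt := lt ltac:(lia).
  by rewrite negb_and orbC [_ == _](_ : _ = false) //; lia.
have lt2 : i - fsize s1 < fsize s by lia.
have := mem_preorderF k.+1 s (nth [::] (preorderF k.+1 s) (i - fsize s1)).
rewrite mem_nth ?size_preorderF //.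
have szv := szF k.+1 s _ lt2; have IHv := IH k.+1 (i - fsize s1).
case: (nth [::] _ _) szv IHv => // -[v v0] w szv IHv.
move=> /esym /andP[/andP[/= kv _] _]; move: IHv; rewrite /=.
have -> : v.-1 = (k + (v.-1 - k.+1)).+1 by lia.
rewrite /= -addnS !nth_nseq_cat /= => IHv.
have [jl|jl] := leqP j (fsize s1).
  rewrite [X in _ && X = _](_ : _ = false); last by move: szv => /=; lia.
  rewrite andbF Mj; apply/esym/negbTE; rewrite negb_and.
  case: (ltnP j (fsize s1)) => [jl'|jl'].
    by have lj := l1 _ jl'; rewrite [X in _ || ~~ X](_ : _ = false) ?orbT //; lia.
  have -> : j == fsize s1 by lia.
  by rewrite [X in _ || ~~ X](_ : _ = false) ?orbT //; lia.
rewrite [j < fsize s1]ltnNge (ltnW jl) /=.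
have lt2' : j - (fsize s1).+1 < fsize s by move: jN; rewrite fsize_cons nodesE; lia.
have := IHv _ lt2 lt2'; rewrite Mj [j < fsize s1]ltnNge (ltnW jl) /= => H.
have -> : (j == fsize s1) = false by lia.
have -> : (j == 0) = false by lia.
have -> : (i.+2 == j + (size w).+1) = ((i - fsize s1).+1 == j - (fsize s1).+1 + (size w).+1) by lia.
rewrite H /=; have -> : ((fsize s1).+1 + nth 0 (stairs (Node s)) (j - (fsize s1).+1) == i.+2) =
    (nth 0 (stairs (Node s)) (j - (fsize s1).+1) == (i - fsize s1).+1) by lia.
case: (j =P (fsize s1).+1) => [->|//]; rewrite subnn /jump /=.
have s0 : 0 < fsize s by lia.
by rewrite (g2 _ s0).
Qed.

Lemma leaf_jump t i j : 0 < i < nodes t -> j.+1 < nodes t ->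
  (kids (subp t (nth [::] (preorder t) i)) == [::]) &&
  (i == j + size (nth [::] (preorder t) i)) =
  jump (stairs t) j && (nth 0 (stairs t) j == i).
Proof.
case: t i => s [|i] //; rewrite nodesE !ltnS => /andP[_ iN] jN.
exact: (@leaf_jumpF 0 s i j iN jN).
Qed.

(** ** Words that fill a staircase *)

(** [l] takes the values of [M] at its jumps and is increasing elsewhere. A
    permutation avoids 321 if and only if it fills its running maximum in this
    sense: two decreasing entries among the non-records would form a 321 with an
    earlier record. *)
Definition fills (M l : seq nat) : Prop :=
  (forall j, j < size l -> jump M j -> nth 0 l j = nth 0 M j) /\
  (forall i j, i < j -> j < size l -> ~~ jump M i -> ~~ jump M j ->
    nth 0 l i < nth 0 l j).

Definition jumps n M := [seq j <- iota 0 n | jump M j].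
Definition flats n M := [seq j <- iota 0 n | ~~ jump M j].

Lemma perm_jumps_flats n M : perm_eq (jumps n M ++ flats n M) (iota 0 n).
Proof. exact/permPl/perm_filterC. Qed.

Lemma map_nth_jumps n M l : size l = n -> fills M l ->
  map (nth 0 l) (jumps n M) = map (nth 0 M) (jumps n M).
Proof.
move=> sl [H _]; apply/eq_in_map => j; rewrite mem_filter mem_iota add0n.
by move=> /andP[jj jn]; apply: H => //; rewrite sl.
Qed.

Lemma perm_split_fills n M l : size l = n -> fills M l ->
  perm_eq l (map (nth 0 M) (jumps n M) ++ map (nth 0 l) (flats n M)).
Proof.
move=> sl Hl; rewrite -(map_nth_jumps sl Hl) -map_cat perm_sym.
apply: (perm_trans (perm_map _ (perm_jumps_flats n M))).
by rewrite -sl map_nth_iota0 // take_size.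
Qed.

Lemma fills_unique n M l l' : perm_eq l (iota 1 n) -> perm_eq l' (iota 1 n) ->
  fills M l -> fills M l' -> l = l'.
Proof.
move=> pl pl' Hl Hl'.
have sl : size l = n by rewrite (perm_size pl) size_iota.
have sl' : size l' = n by rewrite (perm_size pl') size_iota.
have sorted_flats k : size k = n -> fills M k -> sorted ltn (map (nth 0 k) (flats n M)).
  move=> sk [_ H]; rewrite sorted_map.
  apply: (@sub_in_sorted _ (mem (flats n M)) ltn) => [i j||].
  - rewrite !mem_filter !mem_iota add0n => /andP[fi _] /andP[fj jn] ij.
    by apply: H => //; rewrite sk.
  - exact/allP.
  - by apply: sorted_filter; [exact: ltn_trans|exact: iota_ltn_sorted].
have E : map (nth 0 l) (flats n M) = map (nth 0 l') (flats n M).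
  apply: (irr_sorted_eq ltn_trans ltnn); [exact: sorted_flats|exact: sorted_flats|].
  apply: perm_mem; rewrite -(perm_cat2l (map (nth 0 M) (jumps n M))).
  rewrite -(permPl (perm_split_fills sl Hl)) -(permPr (perm_split_fills sl' Hl')).
  by rewrite (permPl pl) perm_sym.
apply: (@eq_from_nth _ 0); rewrite ?sl ?sl' // => j jn.
have [jj|jj] := boolP (jump M j).
  by rewrite Hl.1 ?sl // Hl'.1 ?sl'.
have : j \in flats n M by rewrite mem_filter jj mem_iota.
by move/eq_in_map: E; exact.
Qed.

Lemma jump_lt n M i j : is_stair n M -> i < j -> j < n -> jump M j ->
  nth 0 M i < nth 0 M j.
Proof.
move=> [sM mM _ _]; case: j => // j ij jn; apply: leq_ltn_trans.
by apply: mM => //; exact: ltnW.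
Qed.

Lemma fills_exists n M : is_stair n M ->
  exists2 l, perm_eq l (iota 1 n) & fills M l.
Proof.
move=> H; have [sM mM gM lM] := H.
pose E := map (nth 0 M) (jumps n M); pose Ec := [seq y <- iota 1 n | y \notin E].
have uE : uniq E.
  rewrite map_inj_in_uniq ?filter_uniq ?iota_uniq // => i j.
  rewrite !mem_filter !mem_iota !add0n => /andP[ji iN] /andP[jj jN] EM.
  case: (ltngtP i j) => // lt.
    by have := jump_lt H lt jN jj; rewrite EM ltnn.
  by have := jump_lt H lt iN ji; rewrite EM ltnn.
have pE : perm_eq (E ++ Ec) (iota 1 n).
  apply: uniq_perm; [|exact: iota_uniq|] => [|y].
    rewrite cat_uniq uE filter_uniq ?iota_uniq // andbT.
    by apply/hasPn => y; rewrite mem_filter => /andP[].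
  rewrite mem_cat mem_filter; case: (boolP (y \in E)) => //=.
  move=> /mapP[j]; rewrite mem_filter !mem_iota !add0n => /andP[_ jN] ->.
  by rewrite add1n ltnS lM // andbT (leq_ltn_trans _ (gM _ jN)).
have sEc : size Ec = size (flats n M).
  apply: (@addnI (size (jumps n M))).
  rewrite -{1}(size_map (nth 0 M)) -!size_cat (perm_size pE).
  by rewrite (perm_size (perm_jumps_flats n M)) !size_iota.
pose f j := if jump M j then nth 0 M j else nth 0 Ec (index j (flats n M)).
have fj : map f (jumps n M) = E.
  by apply/eq_in_map => j; rewrite mem_filter /f => /andP[->].
have ff : map f (flats n M) = Ec.
  apply: (@eq_from_nth _ 0); rewrite size_map // => i iN.
  rewrite (nth_map 0) // /f index_uniq ?filter_uniq ?iota_uniq //.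
  by have := mem_nth 0 iN; rewrite mem_filter => /andP[/negbTE ->].
have nf j : j < n -> nth 0 (map f (iota 0 n)) j = f j.
  by move=> jn; rewrite (nth_map 0) ?size_iota // nth_iota.
exists (map f (iota 0 n)).
  apply: perm_trans pE; rewrite -fj -ff -map_cat perm_sym.
  exact/perm_map/perm_jumps_flats.
split=> [j|i j ij]; rewrite size_map size_iota => jn.
  by rewrite nf // /f => ->.
rewrite !nf ?(ltn_trans ij) // /f => /[dup] ni /negbTE -> /[dup] nj /negbTE ->.
have im : i \in flats n M by rewrite mem_filter ni mem_iota (ltn_trans ij).
have jm : j \in flats n M by rewrite mem_filter nj mem_iota.
have srt : sorted ltn (flats n M).
  by apply: sorted_filter; [exact: ltn_trans|exact: iota_ltn_sorted].
have srtE : sorted ltn Ec.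
  by apply: sorted_filter; [exact: ltn_trans|exact: iota_ltn_sorted].
apply: (sorted_ltn_nth ltn_trans) => //; rewrite ?inE ?sEc ?index_mem //.
rewrite ltnNge; apply/negP; rewrite leq_eqVlt => /predU1P[E0|lt].
  by move: ij; rewrite -(nth_index 0 im) -E0 nth_index ?ltnn.
have := sorted_ltn_nth ltn_trans 0 srt (index j (flats n M)) (index i (flats n M)).
rewrite !inE !index_mem => /(_ jm im lt); rewrite !nth_index //.
by move=> /(ltn_trans ij); rewrite ltnn.
Qed.

(** The running maximum recovers the staircase from a word that fills it. *)
Definition runmax (l : seq nat) (j : nat) : nat := \max_(i < j.+1) nth 0 l i.

Lemma runmaxS l j : runmax l j.+1 = maxn (runmax l j) (nth 0 l j.+1).
Proof. by rewrite /runmax big_ord_recr. Qed.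

Lemma leq_runmax l i j : i <= j -> nth 0 l i <= runmax l j.
Proof.
move=> ij.
exact: (@leq_bigmax _ (fun k : 'I_j.+1 => nth 0 l k) (Ordinal (ij : i < j.+1))).
Qed.

Lemma runmax_attained l j : exists2 k, k < j.+1 & nth 0 l k = runmax l j.
Proof.
elim: j => [|j [k kj E]]; first by exists 0; rewrite // /runmax big_ord1.
rewrite runmaxS; case: (leqP (runmax l j) (nth 0 l j.+1)) => _.
  by exists j.+1; rewrite ?ltnSn.
by exists k; rewrite // ltnW.
Qed.

(** A flat entry of a fill cannot exceed the staircase: all later entries
    would exceed it as well, leaving too few positions for the small values. *)
Lemma fills_le n M l j : is_stair n M -> perm_eq l (iota 1 n) -> fills M l ->
  j < n -> nth 0 l j <= nth 0 M j.
Proof.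
move=> H pl [Hj Hf] jn; have sl : size l = n by rewrite (perm_size pl) size_iota.
have [jj|jj] := boolP (jump M j); first by rewrite Hj ?sl.
rewrite leqNgt; apply/negP => gt.
have later q : j <= q -> q < n -> nth 0 M j < nth 0 l q.
  rewrite leq_eqVlt => /predU1P[<- //|jq qn].
  have [jq'|jq'] := boolP (jump M q); first by rewrite Hj ?sl //; exact: jump_lt H jq qn jq'.
  by apply: ltn_trans gt _; apply: Hf; rewrite ?sl.
have : size (iota 1 (nth 0 M j)) <= size (take j l).
  apply: uniq_leq_size; first exact: iota_uniq.
  move=> y; rewrite mem_iota add1n ltnS => /andP[y0 yM].
  have yl : y \in l.
    by rewrite (perm_mem pl) mem_iota y0 add1n ltnS (leq_trans yM (stair_le H jn)).
  have [lt|ge] := ltnP (index y l) j.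
    rewrite -(nth_index 0 yl) -(nth_take 0 lt) mem_nth //.
    by rewrite size_takel // sl ltnW.
  have := later _ ge; rewrite -sl index_mem nth_index // => /(_ yl).
  by rewrite ltnNge yM.
rewrite size_iota size_takel ?sl ?(ltnW jn) // leqNgt.
by rewrite (stair_ge H jn).
Qed.

Lemma fills_runmax n M l j : is_stair n M -> perm_eq l (iota 1 n) -> fills M l ->
  j < n -> runmax l j = nth 0 M j.
Proof.
move=> H pl Hl jn; have sl : size l = n by rewrite (perm_size pl) size_iota.
apply/eqP; rewrite eqn_leq; apply/andP; split.
  apply/bigmax_leqP => -[i /= ij] _; apply: leq_trans (fills_le H pl Hl _) _.
    exact: leq_ltn_trans jn.
  exact: (stair_mono H).
elim: j jn => [|j IH] jn.
  have j0 : jump M 0 by rewrite /jump /=; exact: stair_ge H _ jn.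
  by rewrite -(Hl.1 _ _ j0) ?sl //; exact: leq_runmax.
have [jj|] := boolP (jump M j.+1).
  by rewrite -(Hl.1 _ _ jj) ?sl //; exact: leq_runmax.
rewrite /jump /= -leqNgt => le; apply: leq_trans le _.
by rewrite runmaxS leq_max IH // ltnW.
Qed.

Definition avoids321 (l : seq nat) : Prop := forall i j k, i < j -> j < k ->
  k < size l -> ~~ ((nth 0 l j < nth 0 l i) && (nth 0 l k < nth 0 l j)).

(** Both the entries at the jumps and the other ones are increasing, so no
    three entries can be decreasing. *)
Lemma fills_avoids n M l : is_stair n M -> perm_eq l (iota 1 n) ->
  fills M l -> avoids321 l.
Proof.
move=> H pl Hl i j k ij jk; rewrite (perm_size pl) size_iota => kn.
have sl : size l = n by rewrite (perm_size pl) size_iota.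
have same a b : a < b -> b < n -> jump M a = jump M b -> nth 0 l a < nth 0 l b.
  move=> ab bn; case: (boolP (jump M a)) => ja /esym jb.
    rewrite Hl.1 ?sl ?(ltn_trans ab) // Hl.1 ?sl //.
    exact: jump_lt H ab bn jb.
  by apply: Hl.2; rewrite ?sl ?jb.
apply/negP => /andP[ji kj].
have Eij : jump M i != jump M j.
  by apply/eqP => /(same _ _ ij (ltn_trans jk kn)) /(ltn_trans ji); rewrite ltnn.
have Ejk : jump M j != jump M k.
  by apply/eqP => /(same _ _ jk kn) /(ltn_trans kj); rewrite ltnn.
have Eik : jump M i = jump M k by move: Eij Ejk; do 3!case: jump.
have ik := same _ _ (ltn_trans ij jk) kn Eik.
by have := ltn_trans (ltn_trans ik kj) ji; rewrite ltnn.
Qed.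

Lemma avoids_fills n l : perm_eq l (iota 1 n) -> avoids321 l ->
  is_stair n (mkseq (runmax l) n) /\ fills (mkseq (runmax l) n) l.
Proof.
move=> pl Al; have sl : size l = n by rewrite (perm_size pl) size_iota.
have ul : uniq l by rewrite (perm_uniq pl) iota_uniq.
have lmem i : i < n -> 0 < nth 0 l i <= n.
  move=> iN; have : nth 0 l i \in l by rewrite mem_nth ?sl.
  by rewrite (perm_mem pl) mem_iota add1n ltnS.
have mono i j : i <= j -> runmax l i <= runmax l j.
  move=> ij; apply/bigmax_leqP => -[k /= ki] _; apply: leq_runmax.
  by rewrite -ltnS (leq_trans ki).
split.
  split; rewrite ?size_mkseq //.
  - by move=> i j ij jn; rewrite !nth_mkseq ?(leq_ltn_trans ij jn) //; exact: mono.
  - move=> j jn; rewrite nth_mkseq //.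
    have : size (take j.+1 l) <= size (iota 1 (runmax l j)).
      apply: uniq_leq_size; first exact: take_uniq.
      move=> y /(nthP 0)[i]; rewrite size_takel ?sl // => ij; rewrite nth_take // => <-.
      rewrite mem_iota add1n ltnS leq_runmax // andbT.
      by case/andP: (lmem i (leq_trans ij jn)).
    by rewrite size_iota size_takel ?sl.
  move=> j jn; rewrite nth_mkseq //; apply/bigmax_leqP => -[i /= ij] _.
  by case/andP: (lmem i (leq_trans ij jn)).
split=> [[|j]|i j ij]; rewrite sl => jn.
- by rewrite nth_mkseq // /runmax big_ord1.
- rewrite /jump /= !nth_mkseq ?(ltnW jn) // runmaxS => lt.
  by move: lt; lia.
case: i ij => [|i] ij.
  by rewrite /jump /= nth_mkseq ?(leq_ltn_trans _ jn) // /runmax big_ord1;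
    case/andP: (lmem 0 (leq_ltn_trans (leq0n _) jn)) => ->.
move=> + _; rewrite /jump /= !nth_mkseq; [|lia|lia].
rewrite -leqNgt runmaxS geq_max => /andP[_ le].
have [k ki Ek] : exists2 k, k < i.+1 & nth 0 l k = runmax l i.
  exact: runmax_attained.
rewrite ltnNge; apply/negP => ge.
have lt1 : nth 0 l i.+1 < nth 0 l k.
  rewrite ltn_neqAle Ek le andbT -Ek nth_uniq ?sl //; lia.
have lt2 : nth 0 l j < nth 0 l i.+1.
  rewrite ltn_neqAle ge andbT nth_uniq ?sl //; lia.
by have := Al k i.+1 j ki ij; rewrite sl jn lt1 lt2 => /(_ isT).
Qed.

Lemma contains321 n (p : 'S_n) (s : 'S_3) :
  (s (inord 1) < s ord0) -> (s (inord 2) < s (inord 1)) ->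
  contains p s <-> ~ avoids321 (pword p).
Proof.
move=> s10 s21; rewrite contains3.
have -> : (s ord0 < s (inord 1)) = false by rewrite ltnNge (ltnW s10).
have -> : (s ord0 < s (inord 2)) = false by rewrite ltnNge (ltnW (ltn_trans s21 s10)).
have -> : (s (inord 1) < s (inord 2)) = false by rewrite ltnNge (ltnW s21).
have gt (i j : 'I_n) : i < j -> (p i < p j) = false -> p j < p i.
  move=> ij pij; rewrite ltn_neqAle leqNgt pij andbT.
  by rewrite (inj_eq val_inj) (inj_eq perm_inj) neq_ltn ij orbT.
split=> [[i0 [i1 [i2 [h1 h2 p01 p02 p12]]]] A|].
  have := A i0 i1 i2 h1 h2; rewrite size_pword !nth_pword !ltnS => /(_ (ltn_ord _)).
  by rewrite (gt _ _ h1 p01) (gt _ _ h2 p12).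
move=> nA; apply: contrapT => H; apply: nA => i j k ij jk.
rewrite size_pword => kn; have jn := ltn_trans jk kn; have iN := ltn_trans ij jn.
rewrite (nth_pword p (Ordinal kn)) (nth_pword p (Ordinal jn)) (nth_pword p (Ordinal iN)).
rewrite !ltnS; apply/negP => /andP[ji kj]; apply: H.
exists (Ordinal iN), (Ordinal jn), (Ordinal kn); split => //.
- by rewrite ltnNge (ltnW ji).
- by rewrite ltnNge (ltnW (ltn_trans kj ji)).
- by rewrite ltnNge (ltnW kj).
Qed.

(** By [fills_unique], there is at most one choice; the identity stands for the
    trees that do not have [n] edges. *)
Definition perm321 n (t : ptree) : 'S_n :=
  odflt 1%g [pick p : 'S_n | `[< fills (stairs t) (pword p) >]].

Lemma fills_perm321 n t : nodes t = n.+1 -> fills (stairs t) (pword (perm321 n t)).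
Proof.
case: t => s [sn]; rewrite /perm321; case: pickP => [p /asboolP //|H].
have := stairs_stair s; rewrite -[fsize s]/(sumn _) sn => /fills_exists[l pl Hl].
have [p Hp] := pword_onto pl.
by have /asboolP := H p; rewrite Hp.
Qed.

Lemma perm_Av321 n (s : 'S_3) :
  (s (inord 1) < s ord0) -> (s (inord 2) < s (inord 1)) ->
  perm_eq (map (perm321 n) (plane_trees n)) (enum (Av n s)).
Proof.
move=> s10 s21.
have stair t : nodes t = n.+1 -> is_stair n (stairs t).
  by case: t => f [<-]; exact: stairs_stair.
apply: uniq_perm; rewrite ?enum_uniq //.
  rewrite map_inj_in_uniq ?plane_trees_uniq // => t t'.
  rewrite !mem_plane_trees => /eqP tn /eqP tn' E.
  have F := fills_perm321 tn; have F' := fills_perm321 tn'; rewrite -E in F'.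
  have : stairs t = stairs t'.
    apply: (@eq_from_nth _ 0); rewrite (stair_size (stair _ tn)).
      by rewrite (stair_size (stair _ tn')).
    move=> j jn; rewrite -(fills_runmax (stair _ tn) (perm_pword _) F) //.
    by rewrite -(fills_runmax (stair _ tn') (perm_pword _) F').
  by case: t t' {tn tn' E F F'} => f [f'] /stairs_inj ->.
move=> p; rewrite mem_enum; apply/mapP/idP => [[t + ->]|/mem_Av].
  rewrite mem_plane_trees => /eqP tn; apply/mem_Av; rewrite contains321 //.
  by have := fills_avoids (stair _ tn) (perm_pword _) (fills_perm321 tn); tauto.
rewrite contains321 // => /contrapT A.
have [S F] := avoids_fills (perm_pword p) A.
have [f fn E] := stairs_onto S.
have tn : nodes (Node f) = n.+1 by rewrite nodesE fn.
exists (Node f); first by rewrite mem_plane_trees tn.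
apply: pword_inj; apply: fills_unique (perm_pword _) (perm_pword _) _ (fills_perm321 tn).
by rewrite E.
Qed.

(** * The maps read off from a neighbourhood of the root *)

Section local_structure.
Local Open Scope classical_set_scope.

(** Both maps that list the extreme vertices one by one are computed through an
    explicit list [l]: it suffices that [l] is sorted and that the rest of [A]
    comes after it. The list may start from an initial segment of [l]. *)
Lemma successive_sorted (pick : set word -> word) (r : rel word) (A : set word)
    (l : seq word) :
  (forall B x, B x -> (forall y, B y -> y = x \/ r x y) -> pick B = x) ->
  transitive r -> irreflexive r -> sorted r l -> (forall x, x \in l -> A x) ->
  (forall x y, x \in l -> A y -> y \notin l -> r x y) ->
  forall m i, m + i <= size l -> successive pick A (take m l) i = take (m + i) l.
Proof.
move=> Hp tr ir sl lA cl m; have ul := sorted_uniq tr ir sl.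
elim=> [|i IH]; first by rewrite addn0.
rewrite addnS => lt /=; rewrite IH ?(ltnW lt) // (take_nth [::]) //; congr rcons.
have nt x j : x \in l -> j <= size l -> (x \in take j l) = (index x l < j).
  move=> xl jl; apply/idP/idP => [xt|xj].
    by rewrite -[l](cat_take_drop j) index_cat xt -[j in _ < j](size_takel jl) index_mem.
  by rewrite -(nth_index [::] xl) -(nth_take _ xj) mem_nth // size_takel.
apply: Hp => [|y].
  split; first by apply: lA; exact: mem_nth.
  by apply/negP; rewrite nt ?mem_nth ?(ltnW lt) // index_uniq // ltnn.
move=> [Ay /= yn]; have [yl|yl] := boolP (y \in l); last first.
  by right; apply: cl => //; exact: mem_nth.
move/negP: yn; rewrite nt ?(ltnW lt) // -leqNgt leq_eqVlt => /predU1P[->|yi].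
  by left; rewrite nth_index.
right; rewrite -[y in r _ y](nth_index [::] yl).
by apply: (sorted_ltn_nth tr) => //; rewrite ?inE ?index_mem.
Qed.

Lemma lexmin_eq (B : set word) x : B x -> (forall y, B y -> y = x \/ lexlt x y) ->
  lexmin B = x.
Proof.
move=> Bx Hx; apply: xget_unique.
  by split => // v /Hx[->|]; rewrite lexle_eqVlt ?eqxx // => ->; rewrite orbT.
move=> y [By Hy]; case: (Hx y By) => // xy.
by have := Hy x Bx; rewrite lexleNgt xy.
Qed.

Lemma lexmax_eq (B : set word) x : B x -> (forall y, B y -> y = x \/ lexlt y x) ->
  lexmax B = x.
Proof.
move=> Bx Hx; apply: xget_unique.
  by split => // v /Hx[->|]; rewrite lexle_eqVlt ?eqxx // => ->; rewrite orbT.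
move=> y [By Hy]; case: (Hx y By) => // xy.
by have := Hy x Bx; rewrite lexleNgt xy.
Qed.

Lemma lexlt_total u v : u != v -> ~~ lexlt u v -> lexlt v u.
Proof. by move=> uv; rewrite -lexleNgt lexle_eqVlt eq_sym (negbTE uv). Qed.

Lemma last_take_nth (l : seq word) i : i < size l -> last [::] (take i.+1 l) = nth [::] l i.
Proof. by move=> lt; rewrite (take_nth [::]) // last_rcons. Qed.

Lemma vseq_segment (s : set word) (l : seq word) i :
  s [::] -> sorted lexlt l -> (forall x, x \in l -> s x) ->
  (forall x y, x \in l -> s y -> lexlt y x -> y \in l) ->
  i < size l -> vseq s i = nth [::] l i.
Proof.
move=> s0 sl ls cl lt; rewrite /vseq.
have l0 : take 1 l = [:: [::]].
  case: l sl ls cl lt => // x l sl ls cl _; rewrite /= take0; congr [:: _].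
  have := cl x [::] (mem_head _ _) s0; rewrite lexlt0.
  case: x sl {ls cl} => // i0 x sl /(_ isT); rewrite in_cons /= => n0.
  by have := allP (order_path_min lexlt_trans_rel sl) _ n0; rewrite lexltn0.
rewrite -l0 (@successive_sorted _ lexlt _ l) ?add1n ?last_take_nth //.
- exact: lexmin_eq.
- exact: lexlt_trans_rel.
- exact: lexltxx.
move=> x y xl sy; apply: contraR => xy; have [->//|ne] := eqVneq y x.
by apply: cl xl sy _; apply: lexlt_total xy; rewrite eq_sym.
Qed.

Lemma last_take_nth_pred (l : seq word) i : 0 < i <= size l ->
  last [::] (take i l) = nth [::] l i.-1.
Proof. by case: i => // i lt; exact: last_take_nth. Qed.

Lemma wseq_segment (s : set word) (l : seq word) i :
  sorted lexlt l -> (forall x, x \in l -> s x) ->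
  (forall x y, x \in l -> s y -> lexlt x y -> y \in l) ->
  0 < i <= size l -> wseq s i = nth [::] (rev l) i.-1.
Proof.
move=> sl ls cl /andP[i0 lt]; rewrite /wseq.
have := @successive_sorted lexmax (fun x y => lexlt y x) s (rev l) _ _ _ _ _ _ 0 i.
rewrite take0 add0n => ->; first by rewrite last_take_nth_pred // size_rev i0.
- exact: lexmax_eq.
- by move=> x y z xy yz; exact: lexlt_trans yz xy.
- exact: lexltxx.
- by rewrite rev_sorted.
- by move=> x; rewrite mem_rev; exact: ls.
- move=> x y; rewrite !mem_rev => xl sy; apply: contraR => xy.
  have [->//|ne] := eqVneq y x.
  by apply: cl xl sy _; exact: lexlt_total xy.
- by rewrite size_rev.
Qed.

Lemma lseq_segment (t : set word) (l : seq word) i :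
  sorted lexlt l -> (forall x, x \in l -> left_leaves t x) ->
  (forall x y, x \in l -> left_leaves t y -> lexlt y x -> y \in l) ->
  0 < i <= size l -> lseq t i = nth [::] l i.-1.
Proof.
move=> sl ls cl /andP[i0 lt]; rewrite /lseq.
have := @successive_sorted lexmin lexlt (left_leaves t) l _ _ _ _ _ _ 0 i.
rewrite take0 add0n => -> //; first by rewrite last_take_nth_pred // i0.
- exact: lexmin_eq.
- exact: lexlt_trans_rel.
- exact: lexltxx.
move=> x y xl sy; apply: contraR => xy; have [->//|ne] := eqVneq y x.
by apply: cl xl sy _; apply: lexlt_total xy; rewrite eq_sym.
Qed.

(** ** Trees that agree near the root *)

(** From some height [K] on, all vertices of [t] lie in the cone of [eta j]. If
    [s] agrees with [t] up to height [K], a vertex of [s] outside the cone cannot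
    be higher, since its ancestor of height [K] is a vertex of [t]. *)
Lemma good_agree (t : tree) eta j : good t eta -> exists K, forall k, K <= k ->
  forall s : tree, code k s = code k t ->
  (forall u, ~~ prefix (eta j) u -> vertices s u <-> vertices t u) /\
  (forall m, m <= k -> vertices s (eta m)).
Proof.
move=> g; have [K HK] := good_sep g j; exists (maxn K j) => k.
rewrite geq_max => /andP[Kk jk] s /code_eqP H; split.
  have short (r : tree) u : (forall v, size v <= k -> vertices r v <-> vertices t v) ->
      vertices r u -> ~~ prefix (eta j) u -> size u <= k.
    move=> Hr ru; rewrite leqNgt; apply: contraNN => ku.
    have sK : size (take K u) = K by rewrite size_takel // (leq_trans Kk) // ltnW.
    have tv : vertices t (take K u).
      by apply/Hr; rewrite ?sK //; apply: (@tree_prefix r _ (drop K u)); rewrite cat_take_drop.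
    rewrite -(HK _ tv) ?sK //; apply: (@prefix_trans _ (take K u)); exact: prefix_take.
  move=> u nu; split => [su|tu]; first by apply/H => //; exact: (short s).
  by apply/H => //; apply: (short t).
by move=> m mk; apply/H; rewrite ?(good_size g) //; exact: good_in.
Qed.

Lemma outside_cone (t : tree) eta j : good t eta ->
  exists2 l : seq word, sorted lexlt l &
    forall u, u \in l <-> vertices t u /\ ~~ prefix (eta j) u.
Proof.
move=> g; have [K HK] := good_sep g j.
exists [seq u <- preorder (code K t) | ~~ prefix (eta j) u].
  by apply: sorted_filter (sorted_preorder _); exact: lexlt_trans_rel.
move=> u; rewrite mem_filter mem_preorder; split.
  by move=> /andP[-> /(inpt_code _ _ (tree_treelike t))[]].
move=> [tu nu]; rewrite nu; apply/(inpt_code _ _ (tree_treelike t)); split => //.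
rewrite leqNgt; apply: contra nu => Ku.
by rewrite -(HK u tu (ltnW Ku)); exact: prefix_take.
Qed.

Lemma lexlt_nprefix (e u : word) : lexlt u e -> ~~ prefix e u.
Proof. by move=> ue; apply/negP => /lexle_prefix; rewrite lexleNgt ue. Qed.

Lemma prefix_comparable (u v w : word) : prefix u w -> prefix v w ->
  prefix u v || prefix v u.
Proof.
elim: w u v => [|x w IH] [|a u] [|b v] //=.
by move=> /andP[/eqP -> pu] /andP[/eqP -> pv]; rewrite eqxx /=; exact: IH.
Qed.

(** The vertices [eta 0, ..., eta j.-1] already make [j] of them. *)
Lemma left_segment (t : tree) eta j : good t eta ->
  exists l : seq word, [/\ sorted lexlt l,
    forall u, u \in l <-> vertices t u /\ lexlt u (eta j) & j <= size l].
Proof.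
move=> g; have [l sl Hl] := outside_cone j g.
exists [seq u <- l | lexlt u (eta j)].
have meml u : u \in [seq u <- l | lexlt u (eta j)] <-> vertices t u /\ lexlt u (eta j).
  rewrite mem_filter; split => [/andP[ul /Hl[]] //|[tu ul]].
  by rewrite ul; apply/Hl; split => //; exact: lexlt_nprefix.
split => //; first by apply: sorted_filter sl; exact: lexlt_trans_rel.
apply: leq_trans (_ : size (map eta (iota 0 j)) <= _).
  by rewrite size_map size_iota.
apply: uniq_leq_size.
  rewrite map_inj_uniq ?iota_uniq // => a b /(congr1 size).
  by rewrite !(good_size g).
move=> _ /mapP[m + ->]; rewrite mem_iota => /andP[_ mj]; apply/meml.
split; first exact: good_in g m.
have := lexle_prefix (good_prefix g (ltnW mj)); rewrite lexle_eqVlt => /predU1P[E|//].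
by have := good_size g m; rewrite E (good_size g) => E'; rewrite E' ltnn in mj.
Qed.

(** Moving [eta j] beyond one more occurrence of the pattern adds a vertex on
    the right. *)
Lemma right_segment (t : tree) eta m : good t eta ->
  exists j (l : seq word), [/\ sorted lexlt l,
    forall u, u \in l <-> [/\ vertices t u, lexlt (eta j) u & ~~ prefix (eta j) u] &
    m <= size l].
Proof.
move=> g.
have seg j : exists2 l : seq word, sorted lexlt l & forall u, u \in l <->
    [/\ vertices t u, lexlt (eta j) u & ~~ prefix (eta j) u].
  have [l sl Hl] := outside_cone j g.
  exists [seq u <- l | lexlt (eta j) u].
    by apply: sorted_filter sl; exact: lexlt_trans_rel.
  move=> u; rewrite mem_filter; split => [/andP[ul /Hl[]] //|[tu ul un]].
  by rewrite ul; apply/Hl.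
elim: m => [|m [j [l [sl Hl ml]]]].
  by have [l sl Hl] := seg 0; exists 0, l.
have [i ji [e1 ti _]] := good_pattern g j.
have [l' sl' Hl'] := seg i.+1; exists i.+1, l'; split => //.
pose x := rcons (eta i) (mkpos 2).
have pj := good_prefix g (leqW ji).
have xl : x \notin l.
  apply/negP => /Hl[_ _ /negP]; apply.
  apply: prefix_trans (good_prefix g ji) _; rewrite /x -cats1; exact: prefix_prefix.
apply: leq_trans (_ : size (x :: l) <= _); first by rewrite ltnS.
apply: uniq_leq_size.
  rewrite /= xl; apply: sorted_uniq sl; first exact: lexlt_trans_rel.
  exact: lexltxx.
move=> u; rewrite in_cons => /predU1P[->|/Hl[tu ul un]]; apply/Hl'; split => //.
- by rewrite e1 /x -!cats1 lexlt_cat.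
- rewrite e1 /x; apply/negP => /prefixP[v] /(congr1 (fun w => nth (mkpos 0) w i)).
  rewrite nth_cat !nth_rcons size_rcons !(good_size g) ltnn eqxx ltnSn.
  by move=> /mkpos_inj.
- exact: lexlt_prefix_r ul un pj.
- by apply: contra un => pu; exact: prefix_trans pu.
Qed.

End local_structure.

(** ** The maps for 231, 213, 312 and 132 *)

Section four_maps.
Local Open Scope classical_set_scope.

(** The value 0, which the maps do not take, is sent to infinity. *)
Definition fin_star (m : nat) : posnat_star :=
  if m is n.+1 then Some (mkpos n) else None.

Lemma to_star_fin m : to_posnat_star (Posz m)%:E%E = fin_star m.
Proof. by []. Qed.

Lemma star_addsub (i : posnat) (b : nat) (v : word) m :
  val i + b = m + size v ->
  to_posnat_star (zpos i + (Posz b)%:E - zlen v)%E = fin_star m.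
Proof.
rewrite /zpos /zlen; move: (val i) (size v) => a c.
move=> E; have H : (Posz a + Posz b - Posz c)%R = Posz m by lia.
by rewrite -to_star_fin -H.
Qed.

Lemma star_subadd (a : nat) (i : posnat) (v : word) m :
  a + size v = m + val i ->
  to_posnat_star ((Posz a)%:E - zpos i + zlen v)%E = fin_star m.
Proof.
rewrite /zpos /zlen; move: (val i) (size v) => b c.
move=> E; have H : (Posz a - Posz b + Posz c)%R = Posz m by lia.
by rewrite -to_star_fin -H.
Qed.

Lemma star_subaddsub (a : nat) (i : posnat) (c : nat) (v : word) m :
  a + c = m + val i + size v ->
  to_posnat_star ((Posz a)%:E - zpos i + (Posz c)%:E - zlen v)%E = fin_star m.
Proof.
rewrite /zpos /zlen; move: (val i) (size v) => b d.
move=> E; have H : (Posz a - Posz b + Posz c - Posz d)%R = Posz m by lia.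
by rewrite -to_star_fin -H.
Qed.

Lemma star_possubadd (i : posnat) (b : nat) (v : word) m :
  val i + size v = m + b ->
  to_posnat_star (zpos i - (Posz b)%:E + zlen v)%E = fin_star m.
Proof.
rewrite /zpos /zlen; move: (val i) (size v) => a c.
move=> E; have H : (Posz a - Posz b + Posz c)%R = Posz m by lia.
by rewrite -to_star_fin -H.
Qed.

Lemma nbhs_fin_star (U : set posnat_star) : nbhs (None : posnat_star) U ->
  U None /\ exists M, forall m, M <= m -> U (fin_star m).
Proof.
move=> /nbhs_infinity[UN [M HM]]; split => //; exists M.+1 => -[|m] //.
by rewrite ltnS => /HM.
Qed.

Lemma ext_card_fin (A : set word) : finite_set A -> ext_card A = (Posz (card A))%:E%E.
Proof. by rewrite /ext_card; case: asboolP. Qed.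

Lemma ext_card_inf (A : set word) : infinite_set A -> ext_card A = +oo%E.
Proof. by rewrite /ext_card; case: asboolP. Qed.

(** *** Finite trees *)

Lemma embed_permE n (p : 'S_n) (i : posnat) : val i <= n ->
  embed_perm p i = fin_star (nth 0 (pword p) (val i).-1).
Proof.
case: i => [[|i] i0] //= lt; rewrite /embed_perm /=.
by rewrite (nth_pword p (Ordinal lt)) /= insubT.
Qed.

Lemma rev_ordE n (i : 'I_n) : nat_of_ord (rev_ord i) = n - i.+1.
Proof. by []. Qed.

Lemma vseq_tree_of t i : i < nodes t -> vseq (tree_of t) i = nth [::] (preorder t) i.
Proof.
move=> lt; apply: vseq_segment; rewrite ?size_preorder ?tree_ofE //.
- exact: sorted_preorder.
- by move=> x; rewrite mem_preorder.
- by move=> x y _; rewrite mem_preorder.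
Qed.

Lemma wseq_tree_of t i : 0 < i <= nodes t ->
  wseq (tree_of t) i = nth [::] (preorder t) (nodes t - i).
Proof.
move=> /andP[i0 lt]; rewrite (@wseq_segment _ (preorder t)) ?size_preorder ?tree_ofE //.
- by rewrite nth_rev size_preorder ?prednK.
- exact: sorted_preorder.
- by move=> x; rewrite mem_preorder.
- by move=> x y _; rewrite mem_preorder.
- by rewrite i0.
Qed.

Lemma card_cofringe t u : card (vertices (tree_of t) `\` fringe (tree_of t) u) +
  card (fringe (tree_of t) u) = nodes t.
Proof.
rewrite -size_preorder -(count_predC (fun v => `[< fringe (tree_of t) u v >])).
rewrite addnC -!size_filter.
congr (_ + _); apply: card_seq; rewrite ?filter_uniq ?preorder_uniq // => v;
  rewrite mem_filter mem_preorder /= tree_ofE; split.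
- by move=> Hv; apply/andP; split; [apply/asboolP|case: Hv].
- by move=> /andP[/asboolP].
- by move=> [tv nv]; apply/andP; split => //; apply/asboolPn.
- by move=> /andP[/asboolPn nv tv].
Qed.

Lemma finite_fringe_tree_of t u : finite_set (fringe (tree_of t) u).
Proof. by apply: sub_finite_set (finite_tree_of t) => v []. Qed.

Section finite_tree.
Variables (n : nat) (t : ptree).
Hypothesis tn : nodes t = n.+1.

Let W (i : nat) : 0 < i <= n -> 0 < nth 0 (postranks t) i.-1 <= n.
Proof.
move=> /andP[i0 lt]; have : nth 0 (postranks t) i.-1 \in postranks t.
  by apply: mem_nth; have := size_postranks t; rewrite tn => -[->]; rewrite prednK.
by move/postranks_lt; rewrite tn ltnS.
Qed.

Lemma embed231 (i : posnat) : val i <= n ->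
  embed_perm (perm231 n t) i = Phi231 (tree_of t) i.
Proof.
case: i => i i0 /= lt; rewrite embed_permE // pword_perm231 // /Phi231.
rewrite vseq_tree_of ?tn ?ltnS // ext_card_fin; last exact: finite_fringe_tree_of.
apply/esym/star_addsub => /=.
have := @nth_postranks t i; rewrite tn i0 ltnS => /(_ lt); lia.
Qed.

Lemma embed213 (i : posnat) : val i <= n ->
  embed_perm (perm231 n t * rev_perm n)%g i = Phi213 (tree_of t) i.
Proof.
case: i => i i0 /= lt; rewrite embed_permE // /Phi213.
rewrite vseq_tree_of ?tn ?ltnS // ext_card_fin; last first.
  by apply: sub_finite_set (finite_tree_of t) => v [].
have lt' : i.-1 < n by rewrite prednK.
rewrite (nth_pword _ (Ordinal lt')) permM rev_permE rev_ordE -nth_pword pword_perm231 //.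
apply/esym/star_subadd => /=.
have := @nth_postranks t i; rewrite tn i0 ltnS => /(_ lt).
have i0n : 0 < i <= n by rewrite i0.
have := W i0n; have := card_cofringe t (nth [::] (preorder t) i); rewrite tn; lia.
Qed.

Lemma embed132 (i : posnat) : val i <= n ->
  embed_perm (rev_perm n * perm231 n t)%g i = Phi132 (tree_of t) i.
Proof.
case: i => i i0 /= lt; rewrite embed_permE // /Phi132.
rewrite wseq_tree_of ?tn ?i0 //; last exact: leqW.
rewrite !ext_card_fin; [|exact: finite_fringe_tree_of|exact: finite_tree_of].
have lt' : i.-1 < n by rewrite prednK.
have e : nat_of_ord (rev_ord (Ordinal lt')) = n - i by rewrite /= prednK.
rewrite (nth_pword _ (Ordinal lt')) permM rev_permE -nth_pword e pword_perm231 //.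
apply/esym/star_subaddsub => /=.
have ct : card (tree_of t) = n.+1.
  rewrite -tn -size_preorder; apply: card_seq (preorder_uniq t) _ => u.
  by rewrite tree_ofE mem_preorder.
have := @nth_postranks t (n.+1 - i); rewrite tn ct (_ : (n.+1 - i).-1 = n - i); last by lia.
lia.
Qed.

Lemma embed312 (i : posnat) : val i <= n ->
  embed_perm (rev_perm n * (perm231 n t * rev_perm n))%g i = Phi312 (tree_of t) i.
Proof.
case: i => i i0 /= lt; rewrite embed_permE // /Phi312.
rewrite wseq_tree_of ?tn ?i0 //; last exact: leqW.
rewrite ext_card_fin; last exact: finite_fringe_tree_of.
have lt' : i.-1 < n by rewrite prednK.
have e : nat_of_ord (rev_ord (Ordinal lt')) = n - i by rewrite /= prednK.
rewrite (nth_pword _ (Ordinal lt')) !permM !rev_permE rev_ordE -nth_pword e.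
rewrite pword_perm231 //.
apply/esym/star_possubadd => /=.
have := @nth_postranks t (n.+1 - i); rewrite tn (_ : (n.+1 - i).-1 = n - i); last by lia.
have i0n : 0 < n.+1 - i <= n by lia.
have := W i0n; rewrite (_ : (n.+1 - i).-1 = n - i); last by lia.
lia.
Qed.

End finite_tree.

(** *** Continuity *)

(** Continuity of [F] at [t], one argument at a time and along all trees that
    agree with [t] near the root, finite or infinite. *)
Definition cont_at (F : tree -> fun_space) (t : tree) : Prop :=
  forall (i : posnat) (U : set posnat_star), nbhs (F t i : posnat_star) U ->
  exists K, forall k, K <= k -> forall s : tree, code k s = code k t -> U (F s i).

Section at_good_tree.
Variables (t : tree) (eta : nat -> word).
Hypothesis g : good t eta.

(** The [i]-th vertex lies to the left of the spine below height [i.+1], or on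
    it, so it is seen in all nearby trees. *)
Lemma vseq_agree i :
  [/\ vertices t (vseq t i), lexlt (vseq t i) (eta i.+1) &
   exists K, forall k, K <= k -> forall s : tree, code k s = code k t ->
    vseq s i = vseq t i].
Proof.
have [l [sl Hl il]] := left_segment i.+1 g.
have V (s : tree) : (forall u, ~~ prefix (eta i.+1) u -> vertices s u <-> vertices t u) ->
    vseq s i = nth [::] l i.
  move=> Hs; apply: vseq_segment => //; first exact: tree_root.
    move=> x /Hl[tx xe]; apply/Hs => //; exact: lexlt_nprefix.
  move=> x y /Hl[_ xe] sy yx; have ye := lexlt_trans yx xe.
  by apply/Hl; split => //; apply/Hs => //; exact: lexlt_nprefix.
have Vt := V t (fun _ _ => conj id id).
have : nth [::] l i \in l by rewrite mem_nth.
rewrite -Vt => /Hl[tv ve]; split => //.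
have [K HK] := good_agree i.+1 g; exists K => k /HK Hk s /Hk[Hs _].
by rewrite (V s Hs) Vt.
Qed.

Lemma wseq_agree i : 0 < i -> exists j,
  [/\ vertices t (wseq t i), lexlt (eta j) (wseq t i), ~~ prefix (eta j) (wseq t i) &
   exists K, forall k, K <= k -> forall s : tree, code k s = code k t ->
    wseq s i = wseq t i].
Proof.
move=> i0; have [j [l [sl Hl il]]] := right_segment i g; exists j.
have i1 : 0 < i <= size l by rewrite i0.
have V (s : tree) : (forall u, ~~ prefix (eta j) u -> vertices s u <-> vertices t u) ->
    wseq s i = nth [::] (rev l) i.-1.
  move=> Hs; apply: wseq_segment => //.
    by move=> x /Hl[tx xe xn]; apply/Hs.
  move=> x y /Hl[_ xe xn] sy xy; have ye := lexlt_trans xe xy.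
  have yn : ~~ prefix (eta j) y.
    by apply/negP => /(lexlt_prefix_r xe xn) /(lexlt_trans xy); rewrite lexltxx.
  by apply/Hl; split => //; apply/Hs.
have Vt := V t (fun _ _ => conj id id).
have : nth [::] (rev l) i.-1 \in l by rewrite -mem_rev mem_nth // size_rev prednK.
rewrite -Vt => /Hl[tv ve vn]; split => //.
have [K HK] := good_agree j g; exists K => k /HK Hk s /Hk[Hs _].
by rewrite (V s Hs) Vt.
Qed.

Lemma finite_off_cone j (A : set word) :
  (forall u, A u -> vertices t u /\ ~~ prefix (eta j) u) -> finite_set A.
Proof.
move=> HA; have [l _ Hl] := outside_cone j g.
by apply: (@finite_set_seq _ _ l) => u /HA /Hl.
Qed.

Lemma fringe_agree j v (s : tree) :
  (forall u, ~~ prefix (eta j) u -> vertices s u <-> vertices t u) ->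
  (forall u, prefix v u -> ~~ prefix (eta j) u) -> fringe s v = fringe t v.
Proof.
move=> Hs Hv; apply/seteqP; split => u [su [w uw]]; (split; last by exists w);
  have pv : prefix v u by rewrite uw; exact: prefix_prefix.
  by apply/(Hs u (Hv u pv)).
by apply/(Hs u (Hv u pv)).
Qed.

(** A set that contains a long stretch of the spine is large. *)
Lemma big_card c k (A : set word) : (forall m, m <= k -> A (eta (c + m))) ->
  ext_card A = +oo%E \/ exists2 n, k < n & ext_card A = (Posz n)%:E%E.
Proof.
move=> HA; rewrite /ext_card; case: asboolP => fA; last by left.
right; exists (card A) => //.
rewrite -[k.+1](size_iota 0) -(size_map (fun m => eta (c + m))).
apply: size_leq_card => //.
  rewrite map_inj_uniq ?iota_uniq // => a b /(congr1 size).
  by rewrite !(good_size g) => /addnI.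
by move=> _ /mapP[m + ->]; rewrite mem_iota => /andP[_ mk]; exact: HA.
Qed.

(** If [vseq t i] is on the spine, its fringe subtree is infinite and nearby
    trees have a large one; otherwise it is finite and nearby trees have the
    same. *)
Lemma cont_Phi231 : cont_at Phi231 t.
Proof.
move=> i U; rewrite /Phi231 /=; set v := vseq t (val i).
have [tv ve [K1 HK1]] := vseq_agree (val i); rewrite -/v in tv ve.
have [K2 HK2] := good_agree (val i).+1 g.
have [pv|npv] := boolP (prefix v (eta (val i).+1)); last first.
  have off u : prefix v u -> ~~ prefix (eta (val i).+1) u.
    by move=> vu; apply: lexlt_nprefix; exact: lexlt_nprefix_l npv vu.
  move=> /nbhs_singleton UF; exists (maxn K1 K2) => k; rewrite geq_max => /andP[k1 k2] s sE.
  have [Hs _] := HK2 k k2 s sE.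
  by rewrite (HK1 k k1 s sE) -/v (fringe_agree Hs off).
have Ev : v = eta (size v).
  have vi : size v <= (val i).+1 by rewrite -(good_size g (val i).+1); exact: size_prefix.
  by rewrite -(good_take g vi); move: pv; rewrite prefixE => /eqP ->.
have fr (s : tree) m : vertices s (eta (size v + m)) -> fringe s v (eta (size v + m)).
  move=> se; split => //.
  have : prefix v (eta (size v + m)) by rewrite {1}Ev; apply: good_prefix g (leq_addr _ _).
  by move/prefixP => [w ->]; exists w.
rewrite ext_card_inf; last first.
  apply: unbounded_infinite => m; exists (eta (size v + m)).
    by apply: fr; exact: good_in g _.
  by rewrite (good_size g) leq_addl.
move=> /nbhs_fin_star[UN [M HM]].
exists (maxn (maxn K1 K2) (size v + (size v + M))) => k.
rewrite !geq_max => /andP[/andP[k1 k2] k3] s sE.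
rewrite (HK1 k k1 s sE) -/v; have [_ Hs] := HK2 k k2 s sE.
have := @big_card (size v) (size v + M) (fringe s v) _ => -[m mk||].
  by apply: fr; apply: Hs; apply: leq_trans k3; rewrite leq_add2l.
  by move=> ->.
move=> [c cM ->].
rewrite (@star_addsub _ _ _ (val i + c - size v)); last by lia.
by apply: HM; lia.
Qed.

(** Here the complement of the fringe subtree matters, so the two cases are
    exchanged. *)
Lemma cont_Phi213 : cont_at Phi213 t.
Proof.
move=> i U; rewrite /Phi213 /=; set v := vseq t (val i).
have [tv ve [K1 HK1]] := vseq_agree (val i); rewrite -/v in tv ve.
have [K2 HK2] := good_agree (val i).+1 g.
have [pv|npv] := boolP (prefix v (eta (val i).+1)).
  move=> /nbhs_singleton UF; exists (maxn K1 K2) => k; rewrite geq_max => /andP[k1 k2] s sE.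
  have [Hs _] := HK2 k k2 s sE.
  rewrite (HK1 k k1 s sE) -/v.
  suff -> : vertices s `\` fringe s v = vertices t `\` fringe t v by [].
  have notin (r : tree) u : vertices r u -> ~ fringe r v u -> ~~ prefix (eta (val i).+1) u.
    move=> ru nu; apply/negP => /(prefix_trans pv) /prefixP[w uw].
    by apply: nu; split => //; exists w.
  apply/seteqP; split => u [su nsu]; (split; first by apply/Hs => //; exact: notin nsu);
    by move=> [_ uw]; apply: nsu.
have off m : ~~ prefix v (eta m).
  apply/negP => vm; have [mi|im] := leqP m (val i).+1.
    by case/negP: npv; apply: prefix_trans vm (good_prefix g mi).
  have := prefix_comparable vm (good_prefix g (ltnW im)).
  by rewrite (negbTE npv) /= => /lexle_prefix; rewrite lexleNgt ve.
have nfr (s : tree) m : vertices s (eta m) -> (vertices s `\` fringe s v) (eta m).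
  move=> se; split => // -[_ [w E]]; case/negP: (off m); rewrite E; exact: prefix_prefix.
rewrite ext_card_inf; last first.
  apply: unbounded_infinite => m; exists (eta m); last by rewrite (good_size g).
  by apply: nfr; exact: good_in g _.
move=> /nbhs_fin_star[UN [M HM]].
exists (maxn (maxn K1 K2) (val i + M)) => k.
rewrite !geq_max => /andP[/andP[k1 k2] k3] s sE.
rewrite (HK1 k k1 s sE) -/v; have [_ Hs] := HK2 k k2 s sE.
have := @big_card 0 k (vertices s `\` fringe s v) (fun m mk => nfr s m (Hs m mk)).
move=> [->//|[c cM ->]].
rewrite (@star_subadd _ _ _ (c - val i + size v)); last by lia.
by apply: HM; lia.
Qed.

(** The [i]-th vertex from the right is off the spine, so its descendants avoid
    the cone of some vertex of the spine. *)
Lemma fringe_wseq_agree i : 0 < i ->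
  finite_set (fringe t (wseq t i)) /\
  exists K, forall k, K <= k -> forall s : tree, code k s = code k t ->
    [/\ wseq s i = wseq t i, fringe s (wseq t i) = fringe t (wseq t i) &
        forall m, m <= k -> vertices s (eta m)].
Proof.
move=> i0; have [j [tw we wn [K1 HK1]]] := wseq_agree i0.
have [K2 HK2] := good_agree j g.
have off u : prefix (wseq t i) u -> ~~ prefix (eta j) u.
  move=> wu; apply/negP => eu; have := prefix_comparable wu eu.
  rewrite (negbTE wn) orbF => /lexle_prefix; by rewrite lexleNgt we.
split.
  apply: (@finite_off_cone j) => u [tu [w E]]; split => //.
  by apply: off; rewrite E; exact: prefix_prefix.
exists (maxn K1 K2) => k; rewrite geq_max => /andP[k1 k2] s sE.
have [Hs He] := HK2 k k2 s sE; split => //; first exact: HK1 k1 s sE.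
exact: fringe_agree Hs off.
Qed.

Lemma cont_Phi312 : cont_at Phi312 t.
Proof.
move=> i U; rewrite /Phi312 /= => /nbhs_singleton UF.
have [_ [K HK]] := fringe_wseq_agree (val_posnat_gt0 i).
by exists K => k /HK Hk s /Hk[-> -> _].
Qed.

Lemma infinite_good : infinite_set t.
Proof.
apply: unbounded_infinite => m; exists (eta m); last by rewrite (good_size g).
exact: good_in g _.
Qed.

Lemma cont_Phi132 : cont_at Phi132 t.
Proof.
move=> i U; rewrite /Phi132 /=.
have [fw [K HK]] := fringe_wseq_agree (val_posnat_gt0 i).
rewrite (ext_card_inf infinite_good) (ext_card_fin fw).
set w := wseq t (val i) => /nbhs_fin_star[UN [M HM]].
exists (maxn K (val i + size w + M)) => k; rewrite geq_max => /andP[k1 k2] s sE.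
have [-> -> Hs] := HK k k1 s sE; rewrite (ext_card_fin fw) -/w.
have := @big_card 0 k s Hs => -[->//|[c cM ->]].
rewrite (@star_subaddsub _ _ _ _ (c - val i + card (fringe t w) - size w)); last by lia.
by apply: HM; lia.
Qed.

End at_good_tree.
End four_maps.

(** ** The map for 321 *)

Section fills_of_sets.

(** The relation [J] prescribes the values at some positions; away from them,
    [f] is the increasing bijection onto the remaining positive values. Positions
    are restricted to [B], an initial segment of the integers, so that the same
    notion covers finite permutations and the limit map. *)
Record is_fill (B : nat -> Prop) (J : nat -> nat -> Prop) (f : nat -> nat) : Prop :=
  IsFill {
  fill_J : forall j i, B j -> J j i -> f j = i;
  fill_mono : forall x y, B y -> (forall i, ~ J x i) -> (forall i, ~ J y i) ->
    x < y -> f x < f y;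
  fill_val : forall x, B x -> (forall i, ~ J x i) -> 0 < f x /\ forall j, ~ J j (f x);
  fill_onto : forall y, 0 < y -> B y.-1 -> (forall j, ~ J j y) ->
    exists x, [/\ B x, forall i, ~ J x i & f x = y] }.

(** Two fills agree below [x] if they have the same prescribed pairs up to the
    position [x] and the value [f x]: by induction, at each free position both
    take the least free value that is not yet taken. *)
Lemma fill_eq (B B' : nat -> Prop) J J' f f' x :
  (forall a b, a <= b -> B b -> B a) -> (forall a b, a <= b -> B' b -> B' a) ->
  is_fill B J f -> is_fill B' J' f' ->
  (forall j i, j <= x \/ i <= f x -> J j i <-> J' j i) ->
  B x -> B' x -> B (f x).-1 -> B' (f x).-1 -> f' x = f x.
Proof.
move=> dB dB' F F' JJ Bx Bx' Bf Bf'.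
have [[i Ji]|nJ] := pselect (exists i, J x i).
  rewrite (fill_J F Bx Ji); apply: (fill_J F' Bx'); apply/JJ => //.
  by left.
have {}nJ i : ~ J x i by move=> Ji; apply: nJ; exists i.
have nJ' i : ~ J' x i by move=> H; apply: (nJ i); apply/JJ => //; left.
have key : forall w, w <= x -> (forall i, ~ J w i) -> f' w = f w.
  elim/ltn_ind => w IH wx nw.
  have Bw := dB _ _ wx Bx; have Bw' := dB' _ _ wx Bx'.
  have nw' i : ~ J' w i by move=> H; apply: (nw i); apply/JJ => //; left.
  have fwx : f w <= f x.
    move: wx; rewrite leq_eqVlt => /predU1P[->//|wx].
    exact: ltnW (fill_mono F Bx nw nJ wx).
  have Jw j i : j <= w \/ i <= f w -> J j i <-> J' j i.
    by move=> h; apply: JJ; case: h => h; [left; exact: leq_trans h wx|right; exact: leq_trans h fwx].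
  have fw1 : (f w).-1 <= (f x).-1 by rewrite -!subn1 leq_sub2r.
  have [fw0 nEw] := fill_val F Bw nw.
  have nEw' j : ~ J' j (f w) by move=> H; apply: (nEw j); apply/Jw => //; right.
  have [v [Bv nv fv]] := fill_onto F' fw0 (dB' _ _ fw1 Bf') nEw'.
  case: (ltngtP v w) => [vw|wv|vw]; last by rewrite -{1}vw.
    have nv0 i : ~ J v i by move=> H; apply: (nv i); apply/Jw => //; left; exact: ltnW.
    have := fill_mono F Bw nv0 nw vw.
    by rewrite -(IH v vw (leq_trans (ltnW vw) wx) nv0) fv ltnn.
  have lt := fill_mono F' Bv nw' nv wv; rewrite fv in lt.
  have [z0 nz] := fill_val F' Bw' nw'.
  have nz0 j : ~ J j (f' w) by move=> H; apply: (nz j); apply/Jw => //; right; exact: ltnW.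
  have zx : (f' w).-1 <= (f x).-1.
    by apply: leq_trans fw1; rewrite -!subn1 leq_sub2r // ltnW.
  have [q [Bq nq fq]] := fill_onto F z0 (dB _ _ zx Bf) nz0.
  have qw : q < w.
    rewrite ltnNge leq_eqVlt; apply/negP => /predU1P[wq|wq].
      by move: lt; rewrite -fq -wq ltnn.
    by have := fill_mono F Bq nw nq wq; rewrite fq ltnNge (ltnW lt).
  have nq' i : ~ J' q i by move=> H; apply: (nq i); apply/Jw => //; left; exact: ltnW.
  have := fill_mono F' Bw' nq' nw' qw.
  by rewrite (IH q qw (leq_trans (ltnW qw) wx) nq) fq ltnn.
exact: key.
Qed.

Lemma increasing_enum (A : nat -> Prop) : (forall m, exists2 y, m <= y & A y) ->
  exists e : nat -> nat, (forall r s, r < s -> e r < e s) /\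
    (forall y, A y <-> exists r, e r = y).
Proof.
move=> HA.
have /choice[next Hn] : forall m, exists y, [/\ m <= y, A y &
    forall z, A z -> m <= z -> y <= z].
  move=> m; have [y0 my0 Ay0] := HA m.
  have ex : exists y, (m <= y) && `[< A y >].
    by exists y0; rewrite my0; apply/asboolP.
  case: (ex_minnP ex) => y /andP[my /asboolP Ay] ymin; exists y; split => // z Az mz.
  by apply: ymin; rewrite mz; apply/asboolP.
pose fix e r := if r is r'.+1 then next (e r').+1 else next 0.
have eA r : A (e r) by case: r => [|r] /=; [case: (Hn 0)|case: (Hn (e r).+1)].
have eS r : e r < e r.+1 by rewrite /=; case: (Hn (e r).+1).
have em r s : r < s -> e r < e s.
  elim: s => // s IH; rewrite ltnS leq_eqVlt => /predU1P[->//|/IH h].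
  exact: ltn_trans h (eS s).
exists e; split => // y; split => [Ay|[r <-] //].
have eid r : r <= e r.
  by elim: r => // r IH; apply: leq_ltn_trans IH (eS r).
have ex : exists r, y <= e r by exists y.
case: (ex_minnP ex) => -[|r] yr rmin.
  exists 0; apply/eqP; rewrite eqn_leq yr andbT.
  by case: (Hn 0) => _ _; apply.
exists r.+1; apply/eqP; rewrite eqn_leq yr andbT /=.
case: (Hn (e r).+1) => _ _; apply => //.
by rewrite ltnNge; apply/negP => /rmin; rewrite ltnn.
Qed.

(** The free positions and the free values, enumerated in increasing order, are
    matched with each other. *)
Lemma fill_exists (J : nat -> nat -> Prop) :
  (forall j i i', J j i -> J j i' -> i = i') ->
  (forall m, exists2 y, m <= y & forall i, ~ J y i) ->
  (forall m, exists2 y, m <= y & forall j, ~ J j y) ->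
  exists f, is_fill (fun=> True) J f.
Proof.
move=> Jf HD HE.
have [d [dm dA]] := increasing_enum HD.
have HE' m : exists2 y, m <= y & 0 < y /\ forall j, ~ J j y.
  by have [y my ny] := HE m.+1; exists y; [exact: ltnW|split => //; exact: leq_ltn_trans my].
have [e [em eA]] := increasing_enum HE'.
have /choice[f Hf] : forall x, exists y, (forall i, J x i -> y = i) /\
    (forall r, d r = x -> y = e r).
  move=> x; have [[i Ji]|nJ] := pselect (exists i, J x i).
    exists i; split => [i' Ji'|r dr]; first exact: Jf Ji Ji'.
    by have /dA := ex_intro (fun r => d r = x) r dr; move=> /(_ i).
  have /dA[r dr] : forall i, ~ J x i by move=> i Ji; apply: nJ; exists i.
  exists (e r); split => [i Ji|r' dr']; first by case: nJ; exists i.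
  case: (ltngtP r r') => [/dm|/dm|-> //]; by rewrite dr dr' ltnn.
exists f; split.
- by move=> j i _; case: (Hf j) => H _; exact: H.
- move=> x y _ /dA[r dr] /dA[r' dr'] xy.
  rewrite (proj2 (Hf x) r dr) (proj2 (Hf y) r' dr'); apply: em.
  rewrite ltnNge leq_eqVlt; apply/negP => /predU1P[E|/dm].
    by move: xy; rewrite -dr -dr' E ltnn.
  by rewrite dr dr' ltnNge (ltnW xy).
- move=> x _ /dA[r dr]; rewrite (proj2 (Hf x) r dr).
  by have /eA := ex_intro (fun q => e q = e r) r erefl.
- move=> y y0 _ ny; have /eA[r er] := conj y0 ny.
  exists (d r); split => //; first by apply/dA; exists r.
  by rewrite (proj2 (Hf (d r)) r erefl).
Qed.

End fills_of_sets.

Section leaves.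
Local Open Scope classical_set_scope.

(** In a depth-first traversal, [preds] collects the vertices discovered before
    [u] and [lefts] those already completed by then, that is, all of them but
    the ancestors of [u]. *)
Definition preds (s : set word) (u : word) : set word :=
  [set v | s v /\ lexlt v u].
Definition lefts (s : set word) (u : word) : set word :=
  [set v | s v /\ lexlt v u && ~~ prefix v u].

Definition idx s u := card (preds s u).
Definition posl s u := card (lefts s u).

Lemma finite_lefts s u : finite_set (preds s u) -> finite_set (lefts s u).
Proof. by apply: sub_finite_set => v [sv /andP[vu _]]. Qed.

Lemma idx_posl (s : tree) u : vertices s u -> finite_set (preds s u) ->
  idx s u = posl s u + size u.
Proof.
move=> su fu; have [l ul Hl] := card_enum (finite_lefts fu).
rewrite /posl (card_seq ul Hl).
pose a := [seq take m u | m <- iota 0 (size u)].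
have sa : size a = size u by rewrite size_map size_iota.
rewrite -sa -size_cat /idx; apply: card_seq.
  rewrite cat_uniq ul /=; apply/andP; split.
    apply/hasPn => _ /mapP[m _ ->]; apply/negP => /Hl[_ /andP[_ /negP]]; apply.
    exact: prefix_take.
  rewrite map_inj_in_uniq ?iota_uniq // => m m'.
  rewrite !mem_iota !add0n => /andP[_ mu] /andP[_ mu'] /(congr1 size).
  by rewrite !size_takel // ltnW.
move=> v; rewrite mem_cat; split.
  move=> [sv vu]; have [pv|npv] := boolP (prefix v u).
    rewrite (_ : v \in a) ?orbT //; apply/mapP; exists (size v).
      rewrite mem_iota add0n /= ltn_neqAle size_prefix // andbT.
      apply/eqP => E; move: pv vu; rewrite prefixE E take_size => /eqP ->.
      by rewrite lexltxx.
    by move: pv; rewrite prefixE => /eqP.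
  by rewrite (_ : v \in l) //; apply/Hl; split => //; rewrite vu.
move=> /orP[/Hl[sv /andP[vu _]] //|/mapP[m +->]].
rewrite mem_iota add0n => /andP[_ mu]; split.
  by apply: (@tree_prefix s _ (drop m u)); rewrite cat_take_drop.
have := lexle_prefix (prefix_take u m); rewrite lexle_eqVlt => /predU1P[E|//].
by have := congr1 size E; rewrite size_takel ?(ltnW mu) // => E'; rewrite E' ltnn in mu.
Qed.

Lemma leafE (s : tree) u : leaf s u <-> vertices s u /\ forall i, ~ vertices s (rcons u i).
Proof.
have ts := tree_treelike s; split=> [[su]|[su H]].
  rewrite degE // => -[a0]; split => // i /(childE u i ts).
  by rewrite a0 leqNgt val_posnat_gt0.
split => //; rewrite degE //; congr Posz; apply: arity_eq => i; split; first by move/H.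
by rewrite leqNgt val_posnat_gt0.
Qed.

Lemma leaf_prefix (s : tree) u v : leaf s u -> vertices s v -> prefix u v -> u = v.
Proof.
move=> /leafE[su H] sv /prefixP[[|i w] E]; first by rewrite E cats0.
by case: (H i); apply: (@tree_prefix s _ w); rewrite cat_rcons -E.
Qed.

(** The leaves reached by the traversal after finitely many steps; in a good
    tree they are the leaves to the left of the spine. *)
Definition cleaf (s : set word) (u : word) : Prop :=
  [/\ leaf s u, u != [::] & finite_set (preds s u)].

(** The pairs [(s_i - p_i, s_i)] of the definition of the map for 321, with
    positions counted from 0. Stated without the enumeration of the leaves, they
    make sense in finite and infinite trees alike. *)
Definition leaf_pairs (s : set word) (j i : nat) : Prop :=
  exists u, [/\ cleaf s u, posl s u = j & idx s u = i].

Lemma preds_sub s u v : lexlt u v -> preds s u `<=` preds s v.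
Proof. by move=> uv w [sw wu]; split => //; exact: lexlt_trans wu uv. Qed.

Lemma lefts_sub s u v : lexlt u v -> lefts s u `<=` lefts s v.
Proof.
move=> uv w [sw /andP[wu nw]]; split => //; rewrite (lexlt_trans wu uv).
by apply/negP => /(lexlt_nprefix_l wu nw) /(lexlt_trans uv); rewrite lexltxx.
Qed.

Lemma card_lt (A B : set word) x : finite_set B -> A `<=` B -> B x -> ~ A x ->
  card A < card B.
Proof.
move=> fB AB Bx nAx; have fA := sub_finite_set AB fB.
have [l ul Hl] := card_enum fA; rewrite (card_seq ul Hl).
apply: (@size_leq_card _ _ (x :: l)) => //.
  by rewrite /= ul andbT; apply/negP => /Hl.
by move=> y; rewrite in_cons => /predU1P[->//|/Hl /AB].
Qed.

Lemma idx_lt s u v : s u -> lexlt u v -> finite_set (preds s v) -> idx s u < idx s v.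
Proof.
move=> su uv fv; apply: (@card_lt _ _ u) => //; first exact: preds_sub.
by move=> [_]; rewrite lexltxx.
Qed.

Lemma posl_lt (s : tree) u v : leaf s u -> vertices s v -> lexlt u v ->
  finite_set (preds s v) -> posl s u < posl s v.
Proof.
move=> lu sv uv fv; apply: (@card_lt _ _ u).
- exact: finite_lefts.
- exact: lefts_sub.
- split; first by case/leafE: lu.
  by rewrite uv; apply/negP => /(leaf_prefix lu sv) E; rewrite E lexltxx in uv.
- by move=> [_]; rewrite lexltxx.
Qed.

Lemma leaf_pairs_fun (s : tree) j i i' : leaf_pairs s j i -> leaf_pairs s j i' -> i = i'.
Proof.
move=> [u [[lu un fu] pu <-]] [v [[lv vn fv] pv <-]].
have [-> //|uv] := eqVneq u v.
have [su _] := proj1 (leafE s u) lu; have [sv _] := proj1 (leafE s v) lv.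
have [h|h] := boolP (lexlt u v).
  by have := posl_lt lu sv h fv; rewrite pu pv ltnn.
by have := posl_lt lv su (lexlt_total uv h) fu; rewrite pu pv ltnn.
Qed.

(** *** Finite trees *)

Lemma finite_preds_tree_of t u : finite_set (preds (tree_of t) u).
Proof. by apply: sub_finite_set (finite_tree_of t) => v []. Qed.

Lemma inpt_subp t u : inpt t u -> forall i, inpt t (rcons u i) =
  ((val i).-1 < size (kids (subp t u))).
Proof. by move=> tu i; rewrite -cats1 inpt_cat tu /= andbT. Qed.

Lemma leaf_tree_of t u : leaf (tree_of t) u <-> inpt t u /\ kids (subp t u) = [::].
Proof.
rewrite leafE tree_ofE /mkset; split => -[tu H]; split => //.
  by apply/size0nil/eqP; rewrite -leqn0 leqNgt -(inpt_subp tu (mkpos 0)); apply/negP/H.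
by move=> i; rewrite inpt_subp // H.
Qed.

Lemma idx_tree_of t i : i < nodes t -> idx (tree_of t) (nth [::] (preorder t) i) = i.
Proof.
move=> it; have st := sorted_preorder t.
have -> : idx (tree_of t) (nth [::] (preorder t) i) = size (take i (preorder t)).
  apply: card_seq; first exact: take_uniq (preorder_uniq t).
  move=> u; rewrite /preds tree_ofE /mkset; split.
    move=> [+ ui]; rewrite -mem_preorder => ut.
    have iu : index u (preorder t) < i.
      rewrite ltnNge leq_eqVlt; apply/negP => /predU1P[E|lt].
        by move: ui; rewrite E nth_index // lexltxx.
      have := sorted_ltn_nth lexlt_trans_rel [::] st i (index u (preorder t)).
      rewrite !inE index_mem size_preorder => /(_ it ut lt).
      by rewrite nth_index // => /(lexlt_trans ui); rewrite lexltxx.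
    by rewrite -(nth_index [::] ut) -(nth_take [::] iu) mem_nth // size_takel // size_preorder ltnW.
  move=> /(nthP [::])[m]; rewrite size_takel ?size_preorder ?(ltnW it) // => mi.
  rewrite nth_take // => <-; split.
    by rewrite -mem_preorder mem_nth // size_preorder (ltn_trans mi).
  apply: (sorted_ltn_nth lexlt_trans_rel) => //; rewrite inE size_preorder //.
  exact: ltn_trans mi it.
by rewrite size_takel // size_preorder ltnW.
Qed.

Lemma leaf_pairs_tree_of t j i : j.+1 < nodes t -> leaf_pairs (tree_of t) j i <->
  [/\ 0 < i < nodes t, jump (stairs t) j & nth 0 (stairs t) j = i].
Proof.
move=> jt; split.
  move=> [u [[/leaf_tree_of[tu ku] un fu] pu iu]].
  have ut : u \in preorder t by rewrite mem_preorder.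
  have it : index u (preorder t) < nodes t by rewrite -size_preorder index_mem.
  have Ei : index u (preorder t) = i by rewrite -iu -{2}(nth_index [::] ut) idx_tree_of.
  have i0 : 0 < i.
    rewrite lt0n -Ei; apply: contra un => /eqP E0; move: (nth_index [::] ut).
    by rewrite E0; case: t {tu ku fu pu iu ut it Ei E0 jt} => s /= <-.
  have Hi : 0 < i < nodes t by rewrite i0 -Ei.
  have tu' : vertices (tree_of t) u by rewrite tree_ofE.
  have E2 : i = j + size u by rewrite -pu -iu idx_posl.
  have nu : nth [::] (preorder t) i = u by rewrite -Ei nth_index.
  have := leaf_jump Hi jt; rewrite nu ku eqxx -E2 eqxx.
  by move=> /esym/andP[jj /eqP Mj]; split.
move=> [Hi jj /eqP Mj]; have := leaf_jump Hi jt; rewrite jj Mj => /andP[/eqP ku /eqP Ei].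
set u := nth [::] (preorder t) i in ku Ei.
have /andP[i0 it] := Hi.
have tu : inpt t u by rewrite -mem_preorder mem_nth // size_preorder.
have iu : idx (tree_of t) u = i by exact: idx_tree_of.
exists u; split => //.
  split; [exact/leaf_tree_of| |exact: finite_preds_tree_of].
  apply/eqP => u0; move: iu; rewrite u0 /idx (_ : preds _ _ = set0).
    by rewrite /Defs.card fset_set0 => E; rewrite -E in i0.
  by apply/seteqP; split => v // -[_]; rewrite lexltn0.
have tu' : vertices (tree_of t) u by rewrite tree_ofE.
by have := idx_posl tu' (@finite_preds_tree_of t u); rewrite iu Ei => /addIn.
Qed.

Lemma idx_le_tree_of t j i : leaf_pairs (tree_of t) j i ->
  0 < i < nodes t /\ j.+1 < nodes t.
Proof.
move=> [u [[/leaf_tree_of[tu ku] un fu] pu iu]].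
have ut : u \in preorder t by rewrite mem_preorder.
have it : index u (preorder t) < nodes t by rewrite -size_preorder index_mem.
have Ei : index u (preorder t) = i by rewrite -iu -{2}(nth_index [::] ut) idx_tree_of.
have tu' : vertices (tree_of t) u by rewrite tree_ofE.
have := idx_posl tu' fu; rewrite iu pu.
have : 0 < size u by rewrite lt0n size_eq0.
lia.
Qed.

Lemma fill_perm321 n t : nodes t = n.+1 ->
  is_fill (fun j => j < n) (leaf_pairs (tree_of t)) (nth 0 (pword (perm321 n t))).
Proof.
move=> tn; set l := pword _; have [H1 H2] := fills_perm321 tn; rewrite -/l in H1 H2.
have pl : perm_eq l (iota 1 n) by exact: perm_pword.
have sl : size l = n by exact: size_pword.
have ul : uniq l by rewrite (perm_uniq pl) iota_uniq.
have stn : is_stair n (stairs t) by case: (t) tn => s [<-]; exact: stairs_stair.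
have Jn j : j < n -> (forall i, ~ leaf_pairs (tree_of t) j i) -> ~~ jump (stairs t) j.
  move=> jn nJ; apply/negP => jj; apply: (nJ (nth 0 (stairs t) j)).
  apply/leaf_pairs_tree_of; rewrite ?tn ?ltnS //; split => //.
  by rewrite (stair_le stn jn) (leq_ltn_trans _ (stair_ge stn jn)).
have lmem j : j < n -> 0 < nth 0 l j <= n.
  move=> jn; have : nth 0 l j \in l by rewrite mem_nth ?sl.
  by rewrite (perm_mem pl) mem_iota add1n ltnS.
split.
- move=> j i jn /leaf_pairs_tree_of; rewrite tn ltnS => /(_ jn)[_ jj <-].
  by apply: H1; rewrite ?sl.
- move=> x y yn nx ny xy; have xn := ltn_trans xy yn.
  by apply: H2; rewrite ?sl //; exact: Jn.
- move=> x xn nx; have /andP[l0 _] := lmem x xn; split => // j jp.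
  have [_] := idx_le_tree_of jp; rewrite tn ltnS => jn.
  move/leaf_pairs_tree_of: (jp); rewrite tn ltnS => /(_ jn)[_ jj Mj].
  have : j = x.
    by apply/eqP; rewrite -(nth_uniq 0 _ _ ul) ?sl // H1 ?sl // Mj.
  by move=> E; have := Jn x xn nx; rewrite -E jj.
- move=> y y0 yn ny; have yl : y \in l.
    by rewrite (perm_mem pl) mem_iota y0 add1n ltnS -(prednK y0).
  have qn : index y l < n by rewrite -sl index_mem.
  exists (index y l); split; rewrite ?nth_index // => i ip.
  move/leaf_pairs_tree_of: (ip); rewrite tn ltnS => /(_ qn)[_ jj Mj].
  apply: (ny (index y l)); rewrite -[y in leaf_pairs _ _ y](nth_index 0 yl).
  by rewrite H1 ?sl // Mj.
Qed.

End leaves.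

(** ** Leaves to the left of the spine of a good tree *)

Section left_leaves_of_good_trees.
Local Open Scope classical_set_scope.

Lemma lexlt_split (u e : word) : lexlt u e -> ~~ prefix u e ->
  exists p i j w w', [/\ u = p ++ i :: w, e = p ++ j :: w' & val i < val j].
Proof.
elim: u e => [|a u IH] [|b e] //; rewrite lexlt_cons /=.
have [<-|ab] := eqVneq a b.
  rewrite ltnn /= => ue nu; have [p [i [j [w [w' [-> -> ij]]]]]] := IH e ue nu.
  by exists (a :: p), i, j, w, w'.
by rewrite orbF => lt _; exists [::], a, b, u, e.
Qed.

Variables (t : tree) (eta : nat -> word).
Hypothesis g : good t eta.

Lemma lexlt_eta i j : i < j -> lexlt (eta i) (eta j).
Proof.
move=> ij; have := lexle_prefix (good_prefix g (ltnW ij)).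
rewrite lexle_eqVlt => /predU1P[/(congr1 size)|//].
by rewrite !(good_size g) => E; rewrite E ltnn in ij.
Qed.

Lemma finite_preds_eta j : finite_set (preds t (eta j)).
Proof.
by apply: (finite_off_cone g (j := j)) => u [tu uj]; split => //; exact: lexlt_nprefix.
Qed.

Lemma finite_preds_left j u : lexlt u (eta j) -> finite_set (preds t u).
Proof. by move=> uj; apply: sub_finite_set (finite_preds_eta j); exact: preds_sub. Qed.

Lemma eta_not_leaf (s : tree) j : vertices s (eta j.+1) -> ~ leaf s (eta j).
Proof.
move=> sj /leaf_prefix /(_ sj (good_prefix g (leqnSn j))) /(congr1 size).
by rewrite !(good_size g) => /n_Sn.
Qed.

Lemma cleaf_left u : cleaf t u -> exists j, lexlt u (eta j).
Proof.
move=> [lu _ fu]; apply: contrapT => H.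
have all_preds j : preds t u (eta j).
  split; first exact: good_in g j.
  apply: lexlt_total; last by apply/negP => uj; apply: H; exists j.
  by apply/eqP => uj; apply: (@eta_not_leaf t j); [exact: good_in g _|rewrite -uj].
by apply: unbounded_infinite fu => n; exists (eta n); rewrite ?(good_size g).
Qed.

Lemma left_leavesP u : left_leaves t u <-> cleaf t u.
Proof.
split=> [[lu [eta' s' [a [ta [k [i [j [aE eE ij]]]]] [w uE]]]]|cu].
  have E := good_spine_unique g s'; subst eta'.
  have uk : lexlt u (eta k.+1).
    by rewrite uE aE eE -!cats1 -catA lexlt_cat /= lexlt_cons ij.
  split => //; last exact: finite_preds_left uk.
  by rewrite uE aE -cats1 -catA -size_eq0 size_cat /= addnS.
have [j uj] := cleaf_left cu; have [lu _ _] := cu.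
split => //; exists eta; first exact: good_spine.
have np : ~~ prefix u (eta j).
  apply/negP => /(leaf_prefix lu (good_in g j)) E.
  by rewrite E lexltxx in uj.
have [p [a [b [w [w' [uE eE ab]]]]]] := lexlt_split uj np.
have sj : size p < j by rewrite -(good_size g j) eE size_cat /= addnS ltnS leq_addr.
have pE : eta (size p) = p by rewrite -(good_take g (ltnW sj)) eE take_size_cat.
have qE : eta (size p).+1 = rcons p b.
  rewrite -(good_take g sj) eE -cat_rcons take_size_cat // size_rcons.
  by [].
exists (rcons p a); last by exists w; rewrite uE cat_rcons.
split; last by exists (size p), a, b; rewrite pE qE.
by apply: (@tree_prefix t _ w); rewrite cat_rcons -uE; case/leafE: lu.
Qed.

(** The recurrent pattern provides a leaf [u] to the left of the spine whose
    parent [c] has no other descendant. *)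
Lemma pattern_leaf i : eta i.+1 = rcons (eta i) (mkpos 1) ->
  (forall v, vertices t (rcons (eta i) (mkpos 0) ++ v) <-> v \in [:: [::]; [:: mkpos 0]]) ->
  let c := rcons (eta i) (mkpos 0) in let u := rcons c (mkpos 0) in
  [/\ vertices t c, cleaf t u, lexlt u (eta i.+1), lexlt c (eta i.+1) &
      forall v, vertices t v -> prefix c v -> v \in [:: c; u]].
Proof.
move=> e1 H c u.
have ltc v : prefix c v -> lexlt v (eta i.+1).
  by move=> /prefixP[w ->]; rewrite e1 /c -!cats1 -catA lexlt_cat lexlt_cons.
have pu : prefix c u by rewrite /u -cats1; exact: prefix_prefix.
have tc : vertices t c by rewrite -[c]cats0; apply/H; rewrite inE eqxx.
have tu : vertices t u by rewrite /u -cats1; apply/H; rewrite !inE eqxx orbT.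
have cone v : vertices t v -> prefix c v -> v \in [:: c; u].
  move=> tv /prefixP[w E]; move: tv; rewrite E => /H; rewrite !inE.
  by move=> /orP[] /eqP ->; rewrite ?cats0 ?cats1 eqxx ?orbT.
have lu : lexlt u (eta i.+1) by exact: ltc.
split => //; last by apply: ltc; exact: prefix_refl.
split; [apply/leafE; split => // a ta|by rewrite -size_eq0 size_rcons|exact: finite_preds_left lu].
have pa : prefix c (rcons u a) by apply: prefix_trans pu _; rewrite -cats1; exact: prefix_prefix.
have := cone _ ta pa; rewrite !inE => /orP[] /eqP /(congr1 size);
  by rewrite !size_rcons; lia.
Qed.

Lemma left_leaf_list j : exists2 l : seq word, sorted lexlt l &
  forall u, u \in l <-> left_leaves t u /\ lexlt u (eta j).
Proof.
have [l [sl Hl _]] := left_segment j g.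
exists [seq u <- l | `[< leaf t u >] && (u != [::])].
  by apply: sorted_filter sl; exact: lexlt_trans_rel.
move=> u; rewrite mem_filter left_leavesP; split.
  move=> /andP[/andP[/asboolP lu un] /Hl[tu uj]]; split => //; split => //.
  exact: finite_preds_left uj.
move=> [[lu un _] uj]; rewrite un andbT; apply/andP; split; first exact/asboolP.
by apply/Hl; split => //; case/leafE: lu.
Qed.

Lemma many_left_leaves m : exists j (l : seq word), [/\ sorted lexlt l,
  forall u, u \in l <-> left_leaves t u /\ lexlt u (eta j) & m <= size l].
Proof.
elim: m => [|m [j [l [sl Hl ml]]]].
  by have [l sl Hl] := left_leaf_list 0; exists 0, l.
have [i ji [e1 _ H]] := good_pattern g j.
have [tc cu ui ci _] := pattern_leaf e1 H.
have [l' sl' Hl'] := left_leaf_list i.+1; exists i.+1, l'; split => //.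
set u := rcons _ _ in cu ui.
have pu : prefix (eta j) u.
  by apply: prefix_trans (good_prefix g ji) _; rewrite /u -!cats1 -catA; exact: prefix_prefix.
have ul : u \notin l.
  by apply/negP => /Hl[_ /lexlt_nprefix]; rewrite pu.
apply: leq_trans (_ : size (u :: l) <= _); first by rewrite ltnS.
apply: uniq_leq_size.
  rewrite /= ul; apply: sorted_uniq sl; first exact: lexlt_trans_rel.
  exact: lexltxx.
move=> v; rewrite in_cons => /predU1P[->|/Hl[lv vj]]; apply/Hl'; split => //.
  exact/left_leavesP.
by apply: lexlt_trans vj _; apply: lexlt_eta.
Qed.

Lemma lseq_list j (l : seq word) i : sorted lexlt l ->
  (forall u, u \in l <-> left_leaves t u /\ lexlt u (eta j)) ->
  0 < i <= size l -> lseq t i = nth [::] l i.-1.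
Proof.
move=> sl Hl; apply: lseq_segment => //; first by move=> x /Hl[].
by move=> x y /Hl[_ xj] ly yx; apply/Hl; split => //; exact: lexlt_trans yx xj.
Qed.

Lemma lseqP u : cleaf t u <-> exists2 i, 0 < i & lseq t i = u.
Proof.
rewrite -left_leavesP; split=> [lu|[i i0 <-]].
  have [j uj] := cleaf_left ((left_leavesP u).1 lu).
  have [l sl Hl] := left_leaf_list j; have ul : u \in l by apply/Hl.
  exists (index u l).+1 => //; rewrite (lseq_list sl Hl) ?index_mem //=.
  exact: nth_index.
have [j [l [sl Hl il]]] := many_left_leaves i.
have i1 : 0 < i <= size l by rewrite i0.
by rewrite (lseq_list sl Hl i1); apply: (proj1 (proj1 (Hl _) _)); rewrite mem_nth // prednK.
Qed.

(** ** Free positions and values *)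

Lemma leq_idx_eta j : j <= idx t (eta j).
Proof.
rewrite (idx_posl (good_in g j) (finite_preds_eta j)) (good_size g).
exact: leq_addl.
Qed.

Lemma posl_eta_unbounded m : exists j, m <= posl t (eta j).
Proof.
elim: m => [|m [j mj]]; first by exists 0.
have [i ji [e1 _ H]] := good_pattern g j.
have [tc _ _ ci _] := pattern_leaf e1 H.
exists i.+1; apply: leq_ltn_trans mj _.
apply: (@card_lt _ _ (rcons (eta i) (mkpos 0))).
- by apply: finite_lefts; exact: finite_preds_eta.
- by apply: lefts_sub; apply: lexlt_eta.
- split => //; rewrite ci e1 /=; apply/negP => /prefixP[w].
  move=> /(congr1 (fun w => nth (mkpos 0) w i)).
  rewrite nth_cat !nth_rcons size_rcons !(good_size g) ltnn eqxx ltnSn.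
  by move=> /mkpos_inj.
move=> [_ /andP[/lexlt_nprefix]]; rewrite (prefix_trans (good_prefix g ji)) //.
by rewrite -cats1; exact: prefix_prefix.
Qed.

Lemma posl_eta_mono i j : i <= j -> posl t (eta i) <= posl t (eta j).
Proof.
rewrite leq_eqVlt => /predU1P[-> //|ij]; apply: leq_card_set.
  by apply: finite_lefts; exact: finite_preds_eta.
exact/lefts_sub/lexlt_eta.
Qed.

(** The leaf of a pattern and its parent are both completed before the next leaf
    is discovered, so the position after that of the leaf is skipped. *)
Lemma free_positions m : exists2 y, m <= y & forall i, ~ leaf_pairs t y i.
Proof.
have [j mj] := posl_eta_unbounded m.
have [i ji [e1 _ H]] := good_pattern g j.
have [tc cu ui ci cone] := pattern_leaf e1 H.
set c := rcons (eta i) _ in tc cu ui ci cone; set u := rcons c _ in cu ui cone.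
have [lu un fu] := cu; have [tu _] := proj1 (leafE t u) lu.
have pc : prefix c u by rewrite /u -cats1; exact: prefix_prefix.
have pe : prefix (eta i) u.
  by apply: prefix_trans pc; rewrite /c -cats1; exact: prefix_prefix.
exists (posl t u).+1.
  apply: leqW; apply: leq_trans mj (leq_trans (posl_eta_mono ji) _).
  apply: leq_card_set; first exact: finite_lefts.
  move=> v [tv /andP[vi nv]]; split => //; rewrite (lexlt_prefix_l vi pe).
  apply/negP => pv; have := lexlt_nprefix_l vi nv pv.
  by move/lexlt_nprefix; rewrite pe.
move=> k [u' [[lu' un' fu'] pu' _]]; have [tu' _] := proj1 (leafE t u') lu'.
have [E|ne] := eqVneq u u'; first by move: pu'; rewrite -E => /n_Sn.
have [uu'|uu'] := boolP (lexlt u u'); last first.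
  have := posl_lt lu' tu (lexlt_total ne uu') fu; rewrite pu'; lia.
have lt1 : posl t u < card (lefts t u `|` [set u]).
  apply: (@card_lt _ _ u).
  - by rewrite finite_setU; split; [exact: finite_lefts|exact: finite_set1].
  - by move=> v; left.
  - by right.
  - by move=> [_]; rewrite lexltxx.
have nc : ~~ prefix c u'.
  apply/negP => /(cone u' tu'); rewrite !inE => /orP[] /eqP E; last by rewrite E eqxx in ne.
  by move: uu'; rewrite E => /lexlt_nprefix; rewrite pc.
have lt2 : card (lefts t u `|` [set u]) < posl t u'.
  apply: (@card_lt _ _ c).
  - exact: finite_lefts.
  - move=> v [|->]; first exact: lefts_sub.
    split => //; rewrite uu'; apply/negP => /(leaf_prefix lu tu') E.
    by rewrite E eqxx in ne.
  - split => //; rewrite nc andbT; apply: lexlt_trans uu'.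
    have := lexle_prefix pc; rewrite lexle_eqVlt => /predU1P[/(congr1 size)|//].
    by rewrite (size_rcons c (mkpos 0)) => E; case: (n_Sn _ E).
  - move=> [[_ /andP[_ /negP]]|/(congr1 size)]; first by apply.
    by rewrite (size_rcons c (mkpos 0)) => E; case: (n_Sn _ E).
by move: lt1 lt2; rewrite pu'; lia.
Qed.

(** The vertices of the spine are not leaves, so their indices are free. *)
Lemma free_values m : exists2 y, m <= y & forall j, ~ leaf_pairs t j y.
Proof.
exists (idx t (eta m)); first exact: leq_idx_eta.
move=> j [u [[lu un fu] _ iu]]; have [tu _] := proj1 (leafE t u) lu.
have [E|ne] := eqVneq u (eta m).
  by apply: (@eta_not_leaf t m); [exact: good_in g _|rewrite -E].
have [um|um] := boolP (lexlt u (eta m)).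
  by have := idx_lt tu um (finite_preds_eta m); rewrite iu ltnn.
by have := idx_lt (good_in g m) (lexlt_total ne um) fu; rewrite iu ltnn.
Qed.

(** ** The defining properties of the map *)

Lemma idx_gt0 u : cleaf t u -> 0 < idx t u.
Proof.
move=> [_ un fu]; apply: (@size_leq_card _ _ [:: [::]]) => // v; rewrite inE => /eqP ->.
by split; [exact: tree_root|rewrite lexlt0].
Qed.

Lemma leaf_pairs_pos (x : posnat) i : 0 < i ->
  Posz (val x) = (Posz (sseq t i) - Posz (pseq t i) + 1)%R <->
  posl t (lseq t i) = (val x).-1.
Proof.
move=> i0; have cu : cleaf t (lseq t i) by apply/lseqP; exists i.
have [lu un fu] := cu; have [tu _] := proj1 (leafE t _) lu.
have := idx_posl tu fu; rewrite /idx -[card (preds _ _)]/(sseq t i) -/(pseq t i) => ->.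
case: x => x x0 /=; split; lia.
Qed.

Lemma free_positionP (x : posnat) :
  ~ (exists2 i, 1 <= i & Posz (val x) = (Posz (sseq t i) - Posz (pseq t i) + 1)%R) <->
  forall i, ~ leaf_pairs t (val x).-1 i.
Proof.
split=> [nD i [u [/lseqP[k k0 uk] pu iu]]|nJ [k k0 /(leaf_pairs_pos x k0) pk]].
  by apply: nD; exists k => //; apply/leaf_pairs_pos => //; rewrite uk.
by apply: (nJ (idx t (lseq t k))); exists (lseq t k); split => //; apply/lseqP; exists k.
Qed.

Lemma free_valueP (y : posnat) : ~ (exists2 i, 1 <= i & val y = sseq t i) <->
  forall j, ~ leaf_pairs t j (val y).
Proof.
split=> [nE j [u [/lseqP[k k0 uk] pu iu]]|nJ [k k0 yk]].
  by apply: nE; exists k => //; rewrite -iu -uk.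
apply: (nJ (posl t (lseq t k))); exists (lseq t k); split => //.
by apply/lseqP; exists k.
Qed.

Lemma is_Phi321_fill f : is_Phi321 t f ->
  is_fill (fun=> True) (leaf_pairs t) (fun j => val (f (mkpos j))).
Proof.
move=> [H1 H2 H3].
set D := [set x : posnat | _] in H2 H3; set E := [set y : posnat | _] in H2.
have DE : forall x, (~` D) x <-> _ := free_positionP.
have EE : forall y, (~` E) y <-> _ := free_valueP.
have [Hf Hi Hs] := H2.
split.
- move=> j i _ [u [/lseqP[k k0 uk] pu iu]].
  by rewrite (H1 k) //; [rewrite -iu -uk|apply/leaf_pairs_pos => //; rewrite uk].
- move=> x y _ nx ny xy; apply: H3 => //; exact/DE.
- move=> x _ nx; split; first exact: val_posnat_gt0.
  by apply/EE; apply: Hf; apply/DE.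
- move=> y y0 _ ny; have Ey : (~` E) (mkpos y.-1) by apply/EE; rewrite /= prednK.
  have [x /DE nx fx] := Hs _ Ey; exists (val x).-1; split => //.
  by rewrite mkposK fx /= prednK.
Qed.

Lemma fill_is_Phi321 f : is_fill (fun=> True) (leaf_pairs t) f ->
  is_Phi321 t (fun x => mkpos (f (val x).-1).-1).
Proof.
move=> F.
set f' := fun x : posnat => _; rewrite /is_Phi321.
set D := [set x : posnat | _]; set E := [set y : posnat | _].
have DE : forall x, (~` D) x <-> _ := free_positionP.
have EE : forall y, (~` E) y <-> _ := free_valueP.
have vf x : (~` D) x -> val (f' x) = f (val x).-1.
  by move=> /DE nx; have [f0 _] := fill_val F I nx; rewrite /= prednK.
split.
- move=> i x i0 /(leaf_pairs_pos x i0) px.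
  have ci : cleaf t (lseq t i) by apply/lseqP; exists i.
  have J : leaf_pairs t (val x).-1 (sseq t i) by exists (lseq t i).
  by rewrite /= (fill_J F I J) prednK //; exact: (idx_gt0 ci).
- split.
  + move=> x nDx; apply/EE => j; rewrite vf // => Jj.
    by have [_ /(_ j)] := fill_val F I ((DE x).1 nDx).
  + move=> x y /set_mem nx /set_mem ny /(congr1 val).
    rewrite !vf // => E1; have Dx := (DE x).1 nx; have Dy := (DE y).1 ny.
    rewrite -[x]mkposK -[y]mkposK; congr mkpos.
    case: (ltngtP (val x).-1 (val y).-1) => // lt.
      by have := fill_mono F I Dx Dy lt; rewrite E1 ltnn.
    by have := fill_mono F I Dy Dx lt; rewrite E1 ltnn.
  + move=> y /EE ny; have [||x [_ nx fx]] := fill_onto F (val_posnat_gt0 y) => //.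
    exists (mkpos x); first exact/DE.
    by rewrite /f' /= fx mkposK.
move=> x y nx ny xy; rewrite !vf //; apply: (fill_mono F I) => //; try exact/DE.
by case: x y xy {nx ny} => [x x0] [y y0] /=; lia.
Qed.

Lemma fill_Phi321 :
  is_fill (fun=> True) (leaf_pairs t) (fun j => val (Phi321_fun t (mkpos j))).
Proof.
apply: is_Phi321_fill; rewrite /Phi321_fun.
have [f F] := fill_exists (@leaf_pairs_fun t) free_positions free_values.
exact: (xgetI _ (fill_is_Phi321 F)).
Qed.

(** ** Continuity *)

(** Choose [j0] so large that [eta j0] has position and index at least [m]. The
    leaves before it are the same in all nearby trees, and those after it only
    contribute pairs beyond [m]. *)
Lemma leaf_pairs_agree m : exists K, forall k, K <= k -> forall s : tree,
  code k s = code k t -> forall j i, j < m \/ i < m ->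
  leaf_pairs s j i <-> leaf_pairs t j i.
Proof.
have [j1 mj1] := posl_eta_unbounded m; pose j0 := maxn m j1.
have mp : m <= posl t (eta j0).
  by apply: leq_trans mj1 (posl_eta_mono _); exact: leq_maxr.
have mi : m <= idx t (eta j0) by apply: leq_trans (leq_maxl m j1) (leq_idx_eta _).
have [K HK] := good_agree j0 g; exists (maxn K j0) => k.
rewrite geq_max => /andP[Kk jk] s sE.
have [Hs He] := HK k Kk s sE.
have same u : lexlt u (eta j0) -> vertices s u <-> vertices t u.
  by move=> uj; apply: Hs; exact: lexlt_nprefix.
have predsE u : lexlt u (eta j0) \/ u = eta j0 -> preds s u = preds t u.
  move=> uj; have vj v : lexlt v u -> lexlt v (eta j0).
    by case: uj => [uj vu|-> //]; exact: lexlt_trans vu uj.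
  by apply/seteqP; split => v [sv vu]; split => //; apply/same => //; exact: vj.
have leftsE u : lexlt u (eta j0) \/ u = eta j0 -> lefts s u = lefts t u.
  move=> uj; have vj v : lexlt v u -> lexlt v (eta j0).
    by case: uj => [uj vu|-> //]; exact: lexlt_trans vu uj.
  by apply/seteqP; split => v [sv /andP[vu nv]]; (split; last by rewrite vu);
    apply/same => //; exact: vj.
have np (r : tree) u : leaf r u -> vertices r (eta j0) -> lexlt u (eta j0) -> ~~ prefix u (eta j0).
  by move=> lu rj uj; apply/negP => /(leaf_prefix lu rj) E; rewrite E lexltxx in uj.
have child u i : lexlt u (eta j0) -> ~~ prefix u (eta j0) -> lexlt (rcons u i) (eta j0).
  move=> uj nu; apply: lexlt_nprefix_l uj nu _; rewrite -cats1; exact: prefix_prefix.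
have leafE' u : lexlt u (eta j0) -> leaf s u <-> leaf t u.
  move=> uj; split=> lu.
    have nu := np s u lu (He _ jk) uj; move/leafE: lu => [su nc].
    by apply/leafE; split; [exact/same|move=> i ti; apply: (nc i); apply/same => //; exact: child].
  have nu := np t u lu (good_in g j0) uj; move/leafE: lu => [su nc].
  by apply/leafE; split; [exact/same|move=> i ti; apply: (nc i); apply/same => //; exact: child].
have far (r : tree) u : preds r (eta j0) = preds t (eta j0) ->
    lefts r (eta j0) = lefts t (eta j0) -> cleaf r u -> ~~ lexlt u (eta j0) ->
    m <= posl r u /\ m <= idx r u.
  move=> pE lE [lu _ fu] nuj; have [E|ne] := eqVneq u (eta j0).
    by rewrite E /posl /idx pE lE.
  have ju := lexlt_total ne nuj; split.
    apply: leq_trans mp _; rewrite /posl -lE; apply: leq_card_set; first exact: finite_lefts.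
    exact: lefts_sub.
  apply: leq_trans mi _; rewrite /idx -pE; apply: leq_card_set => //.
  exact: preds_sub.
move=> j i ji.
have near (r : tree) u : preds r (eta j0) = preds t (eta j0) ->
    lefts r (eta j0) = lefts t (eta j0) -> cleaf r u -> posl r u = j -> idx r u = i ->
    lexlt u (eta j0).
  move=> pE lE cu pu iu; apply/negPn/negP => nuj.
  have [] := far r u pE lE cu nuj; rewrite pu iu; lia.
have jj : lexlt (eta j0) (eta j0) \/ eta j0 = eta j0 by right.
split=> -[u [cu pu iu]].
  have uj := near s u (predsE _ jj) (leftsE _ jj) cu pu iu.
  have [lu un fu] := cu; exists u; rewrite -pu -iu /posl /idx predsE ?leftsE; try by left.
  by split => //; split => //; [exact/leafE'|exact: finite_preds_left uj].
have uj := near t u erefl erefl cu pu iu.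
have [lu un fu] := cu; exists u; rewrite -pu -iu /posl /idx predsE ?leftsE; try by left.
split => //; split => //; first exact/leafE'.
by rewrite predsE //; left.
Qed.

End left_leaves_of_good_trees.

Lemma nodes_gt (u : ptree) k (eta : nat -> word) : (forall m, size (eta m) = m) ->
  (forall m, m <= k -> inpt u (eta m)) -> k < nodes u.
Proof.
move=> es H; rewrite -size_preorder -[k.+1](size_iota 0) -(size_map eta).
apply: uniq_leq_size.
  by rewrite map_inj_uniq ?iota_uniq // => a b /(congr1 size); rewrite !es.
by move=> _ /mapP[m + ->]; rewrite mem_iota ltnS mem_preorder => /andP[_ /H].
Qed.

Section continuity321.
Local Open Scope classical_set_scope.
Variables (t : tree) (eta : nat -> word).
Hypothesis g : good t eta.

(** The limit map and the permutation are fills of the pairs of their trees,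
    which agree near [i], so [fill_eq] applies to both. *)
Lemma Phi321_agree (i : posnat) : exists K, forall k, K <= k -> forall s : tree,
  code k s = code k t ->
  (forall eta', good s eta' -> Phi321_fun s i = Phi321_fun t i) /\
  (forall n u, nodes u = n.+1 -> s = tree_of u ->
    nth 0 (pword (perm321 n u)) (val i).-1 = val (Phi321_fun t i)).
Proof.
pose y := val (Phi321_fun t i); pose x := (val i).-1.
have [K HK] := leaf_pairs_agree g (x + y).+1.
have [K' HK'] := good_agree 0 g.
exists (maxn (maxn K K') (x + y).+1) => k; rewrite !geq_max => /andP[/andP[k1 k2] k3] s sE.
have HJ := HK k k1 s sE.
have fx : val (Phi321_fun t (mkpos x)) = y by rewrite /x mkposK.
have HJ' j i' : j <= x \/ i' <= val (Phi321_fun t (mkpos x)) ->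
    leaf_pairs t j i' <-> leaf_pairs s j i'.
  rewrite fx => h; apply: iff_sym; apply: HJ.
  by case: h => h; [left|right]; rewrite ltnS; apply: leq_trans h _; rewrite ?leq_addr ?leq_addl.
split=> [eta' g'|n u un su].
  apply: val_inj; rewrite -/y -fx -[i in LHS]mkposK.
  exact: (@fill_eq (fun=> True) (fun=> True) _ _ _ _ x _ _
    (fill_Phi321 g) (fill_Phi321 g') HJ').
have kn : k <= n.
  rewrite -ltnS -un; apply: (nodes_gt (good_size g)) => m mk.
  by have [_ Hs] := HK' k k2 s sE; have := Hs m mk; rewrite su tree_ofE.
have Fu := fill_perm321 un; rewrite -su in Fu.
rewrite -/y -fx; apply: (@fill_eq (fun=> True) (fun j => j < n) _ _ _ _ x _ _
    (fill_Phi321 g) Fu HJ') => //.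
- by move=> a b; exact: leq_ltn_trans.
- by lia.
- by rewrite fx; lia.
Qed.

End continuity321.

(** * The six patterns *)

Section six_patterns.
Local Open Scope classical_set_scope.

(** A bijection from plane trees with [n] edges to the permutations of size [n]
    that avoid the pattern is local if it extends continuously, by [Phi], to good
    trees: at a good tree [t], both the values of [Phi] and those of permutations
    that come from large finite trees are close to the value of [Phi] as soon as
    the trees agree with [t] near the root. *)
Record local_encoding (sigma : 'S_3) (f : forall n, ptree -> 'S_n) : Prop :=
  LocalEncoding {
  encoding_bij : forall n,
    perm_eq [seq f n t | t <- plane_trees n] (enum (Av n sigma));
  encoding_cont : forall (t : tree) eta, good t eta ->
    forall (i : posnat) (U : set posnat_star),
    nbhs (Phi sigma t i : posnat_star) U ->
    exists K, forall k, K <= k ->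
      (forall (s : tree) eta', good s eta' -> code k s = code k t ->
         U (Phi sigma s i)) /\
      (forall n u, nodes u = n.+1 -> truncp k u = code k t ->
         U (embed_perm (f n u) i)) }.

(** A finite tree that agrees with [t] up to height [k] contains a stretch of the
    spine of length [k]. *)
Lemma nodes_gt_agree (t : tree) eta : good t eta -> exists K, forall k, K <= k ->
  forall n u, nodes u = n.+1 -> truncp k u = code k t -> k <= n.
Proof.
move=> g; have [K HK] := good_agree 0 g; exists K => k Kk n u un E.
rewrite -ltnS -un; apply: (nodes_gt (good_size g)) => m mk.
have [|_ Hs] := HK k Kk (tree_of u); first by rewrite code_tree_of.
by have := Hs m mk; rewrite tree_ofE.
Qed.

(** For four of the patterns, the permutation of a finite tree is given by the
    same formula [F] as the limit map. *)
Lemma local_encoding_cont sigma f (F : tree -> fun_space) :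
  (forall n, perm_eq [seq f n t | t <- plane_trees n] (enum (Av n sigma))) ->
  (forall (t : tree) eta, good t eta -> cont_at F t) ->
  (forall n t i, nodes t = n.+1 -> val i <= n ->
     embed_perm (f n t) i = F (tree_of t) i) ->
  Phi sigma = F -> local_encoding sigma f.
Proof.
move=> bij FC fF sF; split => // t eta g i U; rewrite sF => /(FC _ _ g)[K HK].
have [K' HK'] := nodes_gt_agree g.
exists (maxn (maxn K K') (val i)) => k; rewrite !geq_max => /andP[/andP[k1 k2] k3].
split => [s eta' _|n u un E]; first exact: HK k k1 s.
rewrite fF //; first by apply: (HK k k1); rewrite code_tree_of.
exact: leq_trans k3 (HK' k k2 n u un E).
Qed.

Lemma local_encoding321 sigma :
  (forall n, perm_eq [seq perm321 n t | t <- plane_trees n] (enum (Av n sigma))) ->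
  Phi sigma = Phi321 -> local_encoding sigma perm321.
Proof.
move=> bij sF; split => // t eta g i U; rewrite sF => /nbhs_singleton UF.
have [K HK] := Phi321_agree g i; have [K' HK'] := nodes_gt_agree g.
exists (maxn (maxn K K') (val i)) => k; rewrite !geq_max => /andP[/andP[k1 k2] k3].
split => [s eta' g' sE|n u un E].
  by have [/(_ _ g') Es _] := HK k k1 s sE; move: UF; rewrite /Phi321 Es.
have uE : code k (tree_of u) = code k t by rewrite code_tree_of.
have [_ /(_ n u un erefl) Eu] := HK k k1 _ uE.
rewrite embed_permE; last exact: leq_trans k3 (HK' k k2 n u un E).
by rewrite Eu; move: UF; rewrite /Phi321 -[Phi321_fun t i]mkposK.
Qed.

(** The values of the permutation for 321 have a limit, so those of its
    complement tend to infinity. *)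
Lemma local_encoding123 sigma :
  (forall n, perm_eq [seq (perm321 n t * rev_perm n)%g | t <- plane_trees n]
     (enum (Av n sigma))) ->
  Phi sigma = Phi123 ->
  local_encoding sigma (fun n t => perm321 n t * rev_perm n)%g.
Proof.
move=> bij sF.
have inf (s : tree) eta (g : good s eta) i : Phi123 s i = None.
  by rewrite /Phi123 (ext_card_inf (infinite_good g)).
split => // t eta g i U; rewrite sF (inf t eta g) => /nbhs_fin_star[UN [M HM]].
have [K HK] := Phi321_agree g i; have [K' HK'] := nodes_gt_agree g.
set y := val (Phi321_fun t i) in HK.
exists (maxn (maxn K K') (val i + y + M)) => k.
rewrite !geq_max => /andP[/andP[k1 k2] k3].
split => [s eta' g' sE|n u un E]; first by rewrite (inf s eta' g').
have uE : code k (tree_of u) = code k t by rewrite code_tree_of.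
have [_ /(_ n u un erefl) Eu] := HK k k1 _ uE.
have kn := HK' k k2 n u un E.
have i0 := val_posnat_gt0 i; have lt : (val i).-1 < n by lia.
rewrite embed_permE; last by lia.
rewrite (nth_pword _ (Ordinal lt)) permM rev_permE rev_ordE.
have := nth_pword (perm321 n u) (Ordinal lt); rewrite [nat_of_ord (Ordinal lt)]/= Eu => <-.
by apply: HM; rewrite -/y; lia.
Qed.

Lemma one_line3 (s : 'S_3) :
  one_line s = [:: (s ord0).+1; (s (inord 1)).+1; (s (inord 2)).+1].
Proof.
rewrite /one_line (_ : enum 'I_3 = [:: ord0; inord 1; inord 2]) //.
by apply: (inj_map val_inj); rewrite val_enum_ord /= !inordK.
Qed.

Lemma perm_map_rev n (s : 'S_3) (f : ptree -> 'S_n) l :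
  perm_eq [seq f t | t <- l] (enum (Av n s)) ->
  perm_eq [seq (rev_perm n * f t)%g | t <- l] (enum (Av n (rev_perm 3 * s)%g)).
Proof. by move/perm_Av_rev; rewrite -map_comp. Qed.

Lemma perm_map_compl n (s : 'S_3) (f : ptree -> 'S_n) l :
  perm_eq [seq f t | t <- l] (enum (Av n s)) ->
  perm_eq [seq (f t * rev_perm n)%g | t <- l] (enum (Av n (s * rev_perm 3)%g)).
Proof. by move/perm_Av_compl; rewrite -map_comp. Qed.

Lemma local_encoding_exists sigma : exists f, local_encoding sigma f.
Proof.
have o1 : rev_ord (inord 1 : 'I_3) = inord 1 by apply: val_inj; rewrite /= !inordK.
have o2 : rev_ord (inord 2 : 'I_3) = ord0 by apply: val_inj; rewrite /= !inordK.
have o0 : rev_ord (ord0 : 'I_3) = inord 2 by apply: val_inj; rewrite /= !inordK.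
have rr : forall q : 'S_3, (rev_perm 3 * (rev_perm 3 * q))%g = q.
  by move=> q; rewrite mulgA rev_permK mul1g.
have rl : forall q : 'S_3, (q * rev_perm 3 * rev_perm 3)%g = q.
  by move=> q; rewrite -mulgA rev_permK mulg1.
have PhiE : forall a b c, sigma ord0 = a :> nat -> sigma (inord 1) = b :> nat ->
    sigma (inord 2) = c :> nat -> Phi sigma = match [:: a.+1; b.+1; c.+1] with
  | [:: 2; 3; 1] => Phi231
  | [:: 2; 1; 3] => Phi213
  | [:: 3; 1; 2] => Phi312
  | [:: 1; 3; 2] => Phi132
  | [:: 3; 2; 1] => Phi321
  | _ => Phi123
  end by move=> a b c <- <- <-; rewrite /Phi one_line3.
have ne (i j : 'I_3) : i != j -> sigma i != sigma j :> nat.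
  by rewrite (inj_eq val_inj) (inj_eq perm_inj).
have n01 := ne ord0 (inord 1); rewrite -val_eqE /= inordK // in n01.
have n02 := ne ord0 (inord 2); rewrite -val_eqE /= inordK // in n02.
have n12 := ne (inord 1) (inord 2); rewrite -val_eqE /= !inordK // in n12.
have := ltn_ord (sigma ord0); have := ltn_ord (sigma (inord 1)).
have := ltn_ord (sigma (inord 2)) => l2 l1 l0.
have {n01}n01 := n01 isT; have {n02}n02 := n02 isT; have {n12}n12 := n12 isT.
have [lt01|lt10|e01] := ltngtP (sigma ord0) (sigma (inord 1)); last by lia.
  have [lt02|lt20|e02] := ltngtP (sigma ord0) (sigma (inord 2)); last by lia.
    have [lt12|lt21|e12] := ltngtP (sigma (inord 1)) (sigma (inord 2)); last by lia.
      exists (fun n t => perm321 n t * rev_perm n)%g; apply: local_encoding123.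
        move=> n; rewrite -[sigma]rl; apply/perm_map_compl.
        apply: perm_Av321; rewrite !permM !rev_permE !rev_ordE; lia.
      by apply: (PhiE 0 1 2); lia.
    exists (fun n t => rev_perm n * perm231 n t)%g.
    apply: (@local_encoding_cont _ _ Phi132); last by apply: (PhiE 0 2 1); lia.
    - move=> n; rewrite -[sigma]rr; apply/perm_map_rev.
      by apply: perm_Av231; rewrite !permM !rev_permE ?o0 ?o1 ?o2.
    - by move=> t eta; exact: cont_Phi132.
    - by move=> n t i tn; exact: (embed132 tn).
  exists perm231; apply: (@local_encoding_cont _ _ Phi231).
  - by move=> n; exact: perm_Av231.
  - by move=> t eta; exact: cont_Phi231.
  - by move=> n t i tn; exact: (embed231 tn).
  - by apply: (PhiE 1 2 0); lia.
have [lt02|lt20|e02] := ltngtP (sigma ord0) (sigma (inord 2)); last by lia.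
  exists (fun n t => perm231 n t * rev_perm n)%g.
  apply: (@local_encoding_cont _ _ Phi213); last by apply: (PhiE 1 0 2); lia.
  - move=> n; rewrite -[sigma]rl; apply/perm_map_compl.
    by apply: perm_Av231; rewrite !permM !rev_permE !rev_ordE; lia.
  - by move=> t eta; exact: cont_Phi213.
  - by move=> n t i tn; exact: (embed213 tn).
have [lt12|lt21|e12] := ltngtP (sigma (inord 1)) (sigma (inord 2)); last by lia.
  exists (fun n t => rev_perm n * (perm231 n t * rev_perm n))%g.
  apply: (@local_encoding_cont _ _ Phi312); last by apply: (PhiE 2 0 1); lia.
  - move=> n; rewrite -[sigma]rr -[X in (rev_perm 3 * X)%g]rl.
    apply/perm_map_rev.
    apply/perm_map_compl; apply: perm_Av231;
      rewrite !permM !rev_permE !rev_ordE ?o0 ?o1 ?o2; lia.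
  - by move=> t eta; exact: cont_Phi312.
  - by move=> n t i tn; exact: (embed312 tn).
exists perm321; apply: local_encoding321; last by apply: (PhiE 2 1 0); lia.
by move=> n; exact: perm_Av321.
Qed.

End six_patterns.

(** * Convergence of expectations from lower bounds on cells *)

Section expectation.
Variable R : realType.
Local Open Scope ring_scope.
Local Open Scope classical_set_scope.

Section one_space.
Variables (d : measure_display) (Om : measurableType d) (Q : probability Om R).
Variables (X : eqType) (C : X -> set Om).
Hypothesis mC : forall x, measurable (C x).
Hypothesis disjC : forall x y w, C x w -> C y w -> x = y.

(** Negative lower bounds [a x] are harmless, as [Z] is nonnegative. *)
Lemma sum_le_integral (Z : Om -> \bar R) (F : seq X) (a q : X -> R) (D : set Om) :
  measurable D -> measurable_fun setT Z -> (forall w, 0 <= Z w)%E -> uniq F ->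
  (forall x, x \in F -> C x `<=` D) ->
  (forall x, x \in F -> 0 <= q x) ->
  (forall x, x \in F -> (q x)%:E <= Q (C x))%E ->
  (forall x w, x \in F -> C x w -> (a x)%:E <= Z w)%E ->
  ((\sum_(x <- F) a x * q x)%:E <= \int[Q]_(w in D) Z w)%E.
Proof.
move=> mD mZ Z0; elim: F D mD => [|x F IH] D mD.
  by move=> *; rewrite big_nil integral_ge0.
move=> /= /andP[xF uF] CD q0 qC aZ; rewrite big_cons EFinD.
have xxF := mem_head x F; have sF y : y \in F -> y \in x :: F.
  by rewrite in_cons => ->; rewrite orbT.
rewrite -(setDUK (CD _ xxF)) ge0_integral_setU //; last 3 first.
- exact: measurableD.
- exact: measurable_funTS.
- by rewrite disj_set2E setDIK.
apply: leeD.
  have [a0|a0] := leP 0 (a x); last first.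
    apply: (@le_trans _ _ 0%E); last exact: integral_ge0.
    by rewrite lee_fin mulr_le0_ge0 ?q0 // ltW.
  apply: (@le_trans _ _ ((a x)%:E * Q (C x))%E).
    by rewrite EFinM lee_wpmul2l ?lee_fin // qC.
  rewrite -integral_cst //; apply: ge0_le_integral => //.
  - exact: measurable_funTS.
  - by move=> w Cw; exact: aZ.
apply: IH => //.
- exact: measurableD.
- move=> y yF w Cy; split; first exact: (CD y (sF _ yF)).
  by move=> Cx; case/negP: xF; rewrite (disjC Cx Cy).
- by move=> y /sF /q0.
- by move=> y /sF /qC.
- by move=> y w /sF yF; exact: aZ.
Qed.

Lemma expectation_approx_cells (Z : Om -> R) (M e : R) (F : seq X) (c q : X -> R) :
  measurable_fun setT Z -> (forall w, `|Z w| <= M) -> 0 <= e -> uniq F ->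
  (forall x, x \in F -> 0 <= q x) ->
  (forall x, x \in F -> (q x)%:E <= Q (C x))%E ->
  (forall x w, x \in F -> C x w -> `|Z w - c x| <= e) ->
  exists2 z, ('E_Q[Z] = z%:E)%E &
    `|z - \sum_(x <- F) c x * q x| <= M * (1 - \sum_(x <- F) q x) + e.
Proof.
move=> mZ ZM e0 uF q0 qC Zc.
have Qfin : (Q setT < +oo)%E by rewrite probability_setT ltry.
have iZ : Q.-integrable setT (EFin \o Z).
  apply: measurable_bounded_integrable => //.
  by exists M; split; [exact: num_real|move=> y /ltW My w _; exact: le_trans My].
have iM : Q.-integrable setT (EFin \o cst M).
  apply: measurable_bounded_integrable => //.
  by exists `|M|; split; [exact: num_real|move=> y /ltW My w _].
pose z := Rintegral Q setT Z.
have zE : ('E_Q[Z] = z%:E)%E.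
  by rewrite unlock /z /Rintegral fineK //; exact: integrable_fin_num.
exists z => //; set S := \sum_(x <- F) c x * q x; set s := \sum_(x <- F) q x.
have intM : (\int[Q]_w M%:E = M%:E)%E.
  rewrite (integral_cst Q measurableT M%:E) [X in (_ * X)%E](_ : _ = 1%E).
    by rewrite mule1.
  exact: probability_setT.
have intZ : (\int[Q]_w (Z w)%:E = z%:E)%E by rewrite -zE unlock.
have s1 : s <= 1.
  have : (\sum_(x <- F) Q (C x) <= Q setT)%E.
    by apply: sum_le_measure => // x y w _ _; exact: disjC.
  rewrite probability_setT -lee_fin; apply: le_trans.
  by rewrite -sumEFin big_seq [leRHS]big_seq; apply: lee_sum => x /qC.
have lo : (M - e) * s + S <= M + z.
  rewrite -lee_fin [leRHS]EFinD -intM -intZ -integralD //.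
  rewrite mulr_sumr -big_split /=.
  under eq_bigr do rewrite -mulrDl.
  apply: sum_le_integral => //.
  - by apply: emeasurable_funD; apply/measurable_EFinP.
  - move=> w; rewrite -EFinD lee_fin; have := ZM w; rewrite ler_norml; lra.
  - move=> x w xF Cw; rewrite -EFinD lee_fin.
    by have := Zc x w xF Cw; rewrite ler_norml; lra.
have hi : (M - e) * s - S <= M - z.
  rewrite -lee_fin [leRHS]EFinB -intM -intZ -integralB //.
  rewrite mulr_sumr -sumrN -big_split /=.
  under eq_bigr do rewrite -mulrBl.
  apply: sum_le_integral => //.
  - have mB : measurable_fun setT (fun w => M - Z w) by apply: measurable_funB.
    by move/measurable_EFinP: mB.
  - move=> w; rewrite -EFinB lee_fin; have := ZM w; rewrite ler_norml; lra.
  - move=> x w xF Cw; rewrite -EFinB lee_fin.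
    by have := Zc x w xF Cw; rewrite ler_norml; lra.
by rewrite ler_norml; apply/andP; split; nra.
Qed.
End one_space.

(** The indices [F] and the values [c] can be compared between different
    probability spaces, while the cells [C] belong to one of them. *)
Definition cells d (Om : measurableType d) (Q : probability Om R) (X : eqType)
    (Z : Om -> R) (F : seq X) (c q : X -> R) (e : R) : Prop :=
  exists C : X -> set Om,
  [/\ (forall x, measurable (C x)), (forall x y w, C x w -> C y w -> x = y),
      (forall x, x \in F -> 0 <= q x),
      (forall x, x \in F -> (q x)%:E <= Q (C x))%E &
      (forall x w, x \in F -> C x w -> `|Z w - c x| <= e)].

(** Lower bounds on the masses of disjoint cells that nearly exhaust the space
    pin down the expectation of a function that is nearly constant on each
    cell: apply the lower bound for nonnegative functions to [M + Z] and to
    [M - Z]. *)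
Lemma expectation_approx d (Om : measurableType d) (Q : probability Om R)
    (X : eqType) (Z : Om -> R) (M e : R) (F : seq X) (c q : X -> R) :
  measurable_fun setT Z -> (forall w, `|Z w| <= M) -> 0 <= e -> uniq F ->
  cells Q Z F c q e ->
  exists2 z, ('E_Q[Z] = z%:E)%E &
    `|z - \sum_(x <- F) c x * q x| <= M * (1 - \sum_(x <- F) q x) + e.
Proof.
by move=> mZ ZM e0 uF [C [mC dC q0 qC ZC]]; apply: (@expectation_approx_cells _ _ Q _ C).
Qed.

(** Convergence in law follows from the convergence of the masses of finitely
    many cells that nearly exhaust the limit space: as the total mass is 1, no
    mass can escape. *)
Lemma cvg_expectation (X : eqType)
    (dn : nat -> measure_display) (Omn : forall n, measurableType (dn n))
    (Pn : forall n, probability (Omn n) R) (Zn : forall n, Omn n -> R)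
    (d : measure_display) (Om : measurableType d) (P : probability Om R)
    (Z : Om -> R) (M : R) :
  0 <= M -> (\forall n \near \oo, measurable_fun setT (@Zn n)) ->
  (forall n w, `|Zn n w| <= M) -> measurable_fun setT Z -> (forall w, `|Z w| <= M) ->
  (forall e, 0 < e -> exists (F : seq X) c q qn,
     [/\ uniq F, 1 - e <= \sum_(x <- F) q x, cells P Z F c q e,
        (\forall n \near \oo, cells (Pn n) (@Zn n) F c (qn n) e) &
        forall x, x \in F -> qn n x @[n --> \oo] --> q x]) ->
  ('E_(Pn n)[@Zn n] @[n --> \oo] --> 'E_P[Z])%E.
Proof.
move=> M0 mZn ZnM mZ ZM H.
have [F0 [c0 [q0 [qn0 [uF0 _ C0 Cn0 _]]]]] := H 1 ltr01.
have [z zE _] := expectation_approx mZ ZM ler01 uF0 C0.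
rewrite zE; apply/fine_cvgP; split.
  near=> n.
  have [||||zn -> //] := @expectation_approx _ _ (Pn n) X (@Zn n) M 1 F0 c0 (qn0 n) _ _ _ uF0.
  - by near: n.
  - exact: ZnM.
  - exact: ler01.
  - by near: n.
apply/cvgrPdist_le => e e0; pose del := e / (3 * (1 + M)).
have M1 : 0 < 3 * (1 + M) by lra.
have d0 : 0 < del by rewrite divr_gt0.
have eE : e = 3 * (1 + M) * del by rewrite /del mulrC divfK // gt_eqF.
have [F [c [q [qn [uF s1 CZ Cn qE]]]]] := H del d0.
have [z' zE' zS] := expectation_approx mZ ZM (ltW d0) uF CZ.
have {}zE' : z' = z by move: zE'; rewrite zE => -[].
rewrite {}zE' in zS.
have cS : \sum_(x <- F) c x * qn n x @[n --> \oo] --> \sum_(x <- F) c x * q x.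
  rewrite big_seq; under eq_fun do rewrite big_seq.
  apply: cvg_big => [|x xF]; first exact: add_continuous.
  by apply: cvgM (qE x xF); exact: cvg_cst.
have cs : \sum_(x <- F) qn n x @[n --> \oo] --> \sum_(x <- F) q x.
  rewrite big_seq; under eq_fun do rewrite big_seq.
  by apply: cvg_big => [|x xF]; [exact: add_continuous|exact: qE].
move/cvgrPdist_le/(_ _ d0) : cS => cS; move/cvgrPdist_le/(_ _ d0) : cs => cs.
near=> n.
have [||||zn zne znS] := @expectation_approx _ _ (Pn n) X (@Zn n) M del F c (qn n) _ _ _ uF.
- by near: n.
- exact: ZnM.
- exact: ltW.
- by near: n.
have h1 : `|\sum_(x <- F) c x * q x - \sum_(x <- F) c x * qn n x| <= del by near: n.
have h2 : `|\sum_(x <- F) q x - \sum_(x <- F) qn n x| <= del by near: n.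
rewrite /= zne /= eE.
move: zS znS h1 h2; rewrite !ler_norml => /andP[a1 a2] /andP[a3 a4] /andP[a5 a6] /andP[a7 a8].
set S := \sum_(x <- F) c x * q x in a1 a2 a5 a6.
set s := \sum_(x <- F) q x in s1 a1 a2 a7 a8.
set Sn := \sum_(x <- F) c x * qn n x in a3 a4 a5 a6.
set sn := \sum_(x <- F) qn n x in a3 a4 a7 a8.
have b1 : M * (1 - s) <= M * del by apply: ler_wpM2l => //; lra.
have b2 : M * (1 - sn) <= M * (del + del) by apply: ler_wpM2l => //; lra.
by apply/andP; split; nra.
Unshelve. all: by end_near. Qed.

End expectation.

(** * Plane trees with a prescribed beginning *)

Section counting.
Variable R : realType.
Local Open Scope ring_scope.

(** A vertex below height [k] with [c] children has weight [2 ^ - (c + 1)], and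
    the numbers of children add up to [nodes t - 1]: the weight only depends on
    the numbers of vertices at height [k] and below it. *)
Lemma wt_closed k t : low k.+1 t ->
  wt R k t = 2 ^+ (lev k t) / 2 / 4 ^+ (nodes t).-1.
Proof.
move=> lt; suff H : wt R k t * 4 ^+ nodes t = 2 ^+ (lev k t).+1.
  have n4 n : (4 ^+ n : R) != 0 by rewrite expf_neq0 // pnatr_eq0.
  apply: (mulIf (n4 (nodes t))); rewrite H -{2}(prednK (nodes_gt0 t)) !exprS.
  by field; exact: n4.
elim: k t lt => [|k IH] [s] lt.
  have -> : s = [::] by move: lt => /=; case: s.
  by rewrite /=; field.
rewrite [wt _ _ _]/= [lev _ _]/= nodesE.
have {IH} : \prod_(x <- s) wt R k x * 4 ^+ (fsize s) =
    2 ^+ (sumn (map (lev k) s) + size s).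
  elim: s {lt}(allP lt : forall x, x \in s -> low k.+1 x) => [|x s IHs] H.
    by rewrite big_nil mul1r.
  rewrite big_cons fsize_cons exprD mulrACA IH ?H ?mem_head // IHs.
    by rewrite -exprD /= addnS addSn addnA.
  by move=> y ys; apply: H; rewrite in_cons ys orbT.
rewrite [4 ^+ _.+1]exprS mulrACA => ->; rewrite exprVn exprD !exprS.
have n2 n : (2 ^+ n : R) != 0 by rewrite expf_neq0 // pnatr_eq0.
by field.
Qed.

Definition prefix_class n k (t0 : ptree) : seq ptree :=
  [seq u <- plane_trees n | truncp k u == t0].

(** Graft the forests on the highest vertices of [t0]. *)
Lemma size_prefix_class n k t0 : low k.+1 t0 -> (nodes t0 <= n.+1)%N ->
  (ballot (lev k t0) (n - (nodes t0).-1) <= size (prefix_class n k t0))%N.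
Proof.
move=> lt tn; have t00 := nodes_gt0 t0.
set E := (n - _)%N; rewrite /ballot -(size_map (graft k t0)); apply: uniq_leq_size.
  rewrite map_inj_in_uniq ?forests_uniq // => l l'; rewrite !mem_forests.
  by move=> /andP[/eqP sl _] /andP[/eqP sl' _]; exact: graft_inj.
move=> _ /mapP[l + ->]; rewrite mem_forests => /andP[/eqP sl /eqP fl].
rewrite mem_filter truncp_graft // eqxx mem_plane_trees.
by have := nodes_graft lt sl; rewrite fl /E => H; apply/eqP; lia.
Qed.

(** The limiting proportion of these trees is at least the size-biased mass of
    the cylinder of [t0]. *)
Lemma cvg_prefix_ratio k t0 : low k.+1 t0 ->
  ((ballot (lev k t0) (n - (nodes t0).-1))%:R / (ballot 1 n)%:R @[n --> \oo]
   --> (lev k t0)%:R * wt R k t0)%classic.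
Proof.
move=> lt; rewrite wt_closed // !mulrA; exact: cvg_ballot_shift.
Qed.

End counting.

(** * Convergence in distribution *)

Section convergence.
Local Open Scope ring_scope.
Local Open Scope classical_set_scope.

Section encoding.
Variables (sigma : 'S_3) (f : forall n, ptree -> 'S_n).
Hypothesis hf : local_encoding sigma f.

(** The functions that come from a good tree, through [Phi], or from a finite
    tree, through its permutation, with shape [c] up to height [k]. *)
Definition allowed k (c : ptree) : set fun_space :=
  [set h | (exists (s : tree) eta, [/\ good s eta, code k s = c & h = Phi sigma s]) \/
           (exists n u, [/\ nodes u = n.+1, truncp k u = c & h = embed_perm (f n u)])].

Lemma allowed_mono k k' (t : tree) : (k <= k')%N ->
  allowed k' (code k' t) `<=` allowed k (code k t).
Proof.
move=> kk' h [[s [eta [g E ->]]]|[n [u [un E ->]]]]; [left|right].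
  by exists s, eta; split => //; exact: code_le kk' E.
exists n, u; split => //; rewrite -code_tree_of; apply: code_le kk' _.
by rewrite code_tree_of.
Qed.

Lemma allowed_cvg (t : tree) eta : good t eta ->
  forall W, nbhs (Phi sigma t) W -> exists k, allowed k (code k t) `<=` W.
Proof.
move=> g; apply: (@agree_cvg_fun_space _ (fun k => allowed k (code k t)) id).
  by move=> k k'; exact: allowed_mono.
move=> i U /(encoding_cont hf g) [K HK]; exists K => h.
have [H1 H2] := HK K (leqnn K).
by move=> [[s [eta' [gs E ->]]]|[n [u [un E ->]]]]; [exact: H1 gs E|exact: H2].
Qed.

Lemma f_inj n u v : u \in plane_trees n -> v \in plane_trees n ->
  f n u = f n v -> u = v.
Proof.
move=> ut vt; have : uniq (map (f n) (plane_trees n)).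
  by rewrite (perm_uniq (encoding_bij hf n)) enum_uniq.
move=> un E; rewrite -(nth_index u ut) -(nth_index u vt); congr nth; apply/eqP.
rewrite -(nth_uniq (f n u) _ _ un) ?(size_map (f n)) ?index_mem //.
by rewrite !(nth_map u) ?index_mem // !nth_index // E.
Qed.

Lemma card_Av n : #|Av n sigma| = ballot 1 n.
Proof.
by rewrite cardE -(perm_size (encoding_bij hf n)) size_map size_plane_trees.
Qed.

Variable R : realType.

Section permutations.
Variables (n : nat) (d : measure_display) (Om : measurableType d).
Variables (P : probability Om R) (X : Om -> 'S_n).
Hypothesis hX : uniform_on P X (Av n sigma).

Lemma measurable_uniform (B : set 'S_n) : measurable (X @^-1` B).
Proof.
rewrite (_ : X @^-1` B = \bigcup_(p in B) (X @^-1` [set p])).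
  apply: fin_bigcup_measurable => [|p _]; first exact: finite_finset.
  by have [] := hX p.
by apply/seteqP; split => [w Bw|w [p Bp Xw]]; [exists (X w)|rewrite /preimage /= Xw].
Qed.

Lemma uniform_ge (l : seq 'S_n) : uniq l -> {subset l <= Av n sigma} ->
  (((size l)%:R / (ballot 1 n)%:R)%:E <= P (X @^-1` [set` l]))%E.
Proof.
move=> ul lA; have : (\sum_(p <- l) P (X @^-1` [set p]) <= P (X @^-1` [set` l]))%E.
  apply: sum_le_measure => //.
  - exact: measurable_uniform.
  - by move=> p _; exact: measurable_uniform.
  - by move=> p pl w /= Xw; rewrite Xw.
  - by move=> p q w _ _ Xp Xq; rewrite -[p]Xp -[q]Xq.
apply: le_trans; rewrite (eq_big_seq (fun=> ((ballot 1 n)%:R^-1 : R)%:E)); last first.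
  by move=> p /lA pA; have [_ ->] := hX p; rewrite pA card_Av.
by rewrite sumEFin big_const_seq count_predT iter_addr_0 -[X in (_ <= X%:E)%E]mulr_natl.
Qed.

(** The cell of a shape [x] consists of the permutations that come from plane
    trees which begin with [x]. *)
Lemma uniform_cells k (g : fun_space -> R) (F : seq ptree) (c : ptree -> R) e :
  (forall x, x \in F -> low k.+1 x /\ (nodes x <= n.+1)%N) ->
  (forall x h, x \in F -> allowed k x h -> `|g h - c x| <= e) ->
  cells P (fun w => g (embed_perm (X w))) F c
    (fun x => (ballot (lev k x) (n - (nodes x).-1))%:R / (ballot 1 n)%:R) e.
Proof.
move=> Flow gc; exists (fun x => X @^-1` [set` map (f n) (prefix_class n k x)]).
have mem_pre x u : u \in prefix_class n k x -> u \in plane_trees n /\ truncp k u = x.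
  by rewrite mem_filter => /andP[/eqP].
split.
- by move=> x; exact: measurable_uniform.
- move=> x y w /mapP[u /mem_pre[un ux] Xu] /mapP[v /mem_pre[vn vy] Xv].
  by rewrite -ux -vy (f_inj un vn) // -Xu -Xv.
- by move=> x _; rewrite divr_ge0.
- move=> x /Flow[lx nx]; apply: (le_trans _ (uniform_ge _ _)).
  + rewrite lee_fin ler_wpM2r ?invr_ge0 // ler_nat size_map.
    exact: size_prefix_class.
  + rewrite map_inj_in_uniq ?filter_uniq ?plane_trees_uniq //.
    by move=> u v /mem_pre[un _] /mem_pre[vn _]; exact: f_inj.
  + move=> _ /mapP[u /mem_pre[un _] ->].
    by rewrite -mem_enum -(perm_mem (encoding_bij hf n)) map_f.
- move=> x w xF /mapP[u /mem_pre[un ux] Xw]; apply: gc => //; right.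
  by exists n, u; split; rewrite // ?Xw //; apply/eqP; rewrite -mem_plane_trees.
Qed.

End permutations.
Section limit.
Variables (d : measure_display) (Om : measurableType d) (P : probability Om R).
Variables (T : {RV P >-> borel tree}) (hT : is_GW (@geometric_half R) T).
Variables (d' : measure_display) (Om' : measurableType d') (P' : probability Om' R).
Variables (T' : {RV P' >-> borel tree}) (hT' : is_size_biased T T').

Let G := good_event T'.

(** Off the almost sure event [G], where the tree may fail to be in [Tinfty], a
    constant value keeps the map measurable. *)
Definition limit_map (w : Om') : fun_space :=
  if `[< G w >] then Phi sigma (T' w) else point.

Lemma limit_mapE w : G w -> limit_map w = Phi sigma (T' w).
Proof. by rewrite /limit_map => /asboolT ->. Qed.

(** By continuity, whether [Phi] at a good tree lies in an open set is decided
    by the shape of the tree up to some height, and shapes are countably many. *)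
Lemma measurable_limit_map : measurable_fun setT (limit_map : Om' -> borel fun_space).
Proof.
apply: (@measurability _ _ Om' (borel fun_space) setT limit_map (@open fun_space)) => //.
move=> _ [V oV <-]; rewrite setTI.
pose B k := [set w | forall (s : tree) eta, good s eta ->
  code k s = code k (T' w : tree) -> V (Phi sigma s)].
have mB k : measurable (B k).
  exact: (@measurable_code _ _ _ P' T' k [set c | forall (s : tree) eta, good s eta ->
    code k s = c -> V (Phi sigma s)]).
have mG : measurable G by exact: measurable_good_event.
have GV : G `&` limit_map @^-1` V = G `&` \bigcup_k B k.
  apply/seteqP; split => w [Gw].
    rewrite /preimage /= (limit_mapE Gw) => Vw; split => //.
    have [eta g] := good_event_good Gw.
    have [k Hk] := allowed_cvg g (open_nbhs_nbhs (conj oV Vw)).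
    by exists k => // s eta' gs E; apply: Hk; left; exists s, eta'.
  move=> [k _ Bw]; split => //; rewrite /preimage /= (limit_mapE Gw).
  by have [eta g] := good_event_good Gw; exact: Bw g _.
have -> : limit_map @^-1` V =
    (G `&` limit_map @^-1` V) `|` (~` G `&` [set w | V point]).
  apply/seteqP; split => w.
    have [Gw|nGw] := pselect (G w); first by left.
    by rewrite /preimage /= {1}/limit_map asboolF //; right.
  by move=> [[] //|[nGw /= Vp]]; rewrite /preimage /= /limit_map asboolF.
rewrite GV; apply: measurableU.
  by apply: measurableI => //; exact: bigcupT_measurable.
apply: measurableI; first exact: measurableC.
have [Vp|nVp] := pselect (V point).
  by rewrite (_ : [set _ | _] = setT) //; apply/seteqP; split.
by rewrite (_ : [set _ | _] = set0) //; apply/seteqP; split.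
Qed.

Lemma measurable_continuous (g : fun_space -> R) : continuous g ->
  measurable_fun setT (g \o limit_map).
Proof.
move=> cg; apply: (@measurableT_comp _ _ _ _ _ _ (g : borel fun_space -> R)); last first.
  exact: measurable_limit_map.
apply: (@measurability _ _ (borel fun_space) R setT g (@RGenOInfty.G R)).
  exact: RGenOInfty.measurableE.
move=> _ [_ [x ->] <-]; rewrite setTI; apply: sub_sigma_algebra.
by apply: open_comp; [move=> y _; exact: cg|rewrite set_itvE; exact: open_gt].
Qed.

(** By continuity at good trees, the event that the shape up to height [k]
    determines [g] up to [e] increases to an almost sure event; for a large [k]
    it has mass close to 1, most of it carried by finitely many shapes. *)
Lemma good_shapes (g : fun_space -> R) e : continuous g -> 0 < e ->
  exists k (F : seq ptree), [/\ uniq F, all (low k.+1) F,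
    1 - e <= \sum_(x <- F) (lev k x)%:R * wt R k x &
    forall x h h', x \in F -> allowed k x h -> allowed k x h' -> `|g h - g h'| <= e].
Proof.
move=> cg e0; pose del := e / 2; have d0 : 0 < del by rewrite divr_gt0.
pose A k : set ptree := [set c | forall h h', allowed k c h -> allowed k c h' ->
  `|g h - g h'| <= e].
pose E k : set Om' := [set w | A k (code k (T' w : tree))].
have mE k : measurable (E k) by exact: measurable_code.
have mUE : measurable (\bigcup_k E k) by exact: bigcupT_measurable.
have mG : measurable G by exact: measurable_good_event.
have GE : G `<=` \bigcup_k E k.
  move=> w /good_event_good[eta gw].
  have [|k Hk] := allowed_cvg gw (W := [set h | `|g (Phi sigma (T' w)) - g h| <= del]).
    by have /cvgrPdist_le/(_ _ d0) := cg (Phi sigma (T' w)).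
  exists k => // h h' /Hk Hh /Hk Hh'.
  rewrite (le_trans (ler_distD (g (Phi sigma (T' w))) _ _)) // [leRHS](splitr e).
  by rewrite lerD // distrC.
have P1 : P' (\bigcup_k E k) = 1%:E.
  apply/eqP; rewrite eq_le probability_le1 //=.
  apply: (@le_trans _ _ (P' G)); last by apply: le_measure; rewrite ?inE.
  have := probability_setC P' mG; rewrite (good_event_full hT hT').
  move=> H; have fG : P' G \is a fin_num by apply: fin_num_measure.
  by rewrite -(fineK fG) lee_fin; move: H; rewrite -(fineK fG) -EFinB => -[]; lra.
have cE : P' (E k) @[k --> \oo] --> 1%:E.
  rewrite -P1; apply: nondecreasing_cvg_mu => // k k' kk'.
  apply/subsetPset => w Ew h h' /(allowed_mono kk') Hh /(allowed_mono kk') Hh'.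
  exact: Ew.
have [k Hk] : exists k, (P' (~` E k) <= del%:E)%E.
  have /fine_cvgP[_ /cvgrPdist_le/(_ _ d0)[k _ /(_ k (leqnn k)) Hk]] := cE.
  exists k; rewrite probability_setC //; have fE := fin_num_measure P' _ (mE k).
  rewrite -(fineK fE) -EFinB lee_fin; apply: le_trans Hk; exact: ler_norm.
have [F0 [uF0 /allP lF0 sF0]] := @mass_ge_lev R k del d0.
pose p x := (lev k x)%:R * wt R k x.
exists k, [seq x <- F0 | `[< A k x >]]; split.
- exact: filter_uniq.
- by apply/allP => x; rewrite mem_filter => /andP[_ /lF0].
- rewrite big_filter; move: sF0; rewrite -/p.
  rewrite [X in _ <= X](bigID (fun x => `[< A k x >])) /= => sF0.
  have : \sum_(x <- F0 | ~~ `[< A k x >]) p x <= del.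
    rewrite -lee_fin; apply: le_trans Hk; rewrite -sumEFin.
    apply: (@le_trans _ _ (\sum_(x <- F0 | ~~ `[< A k x >]) P' (cyl T' k x))%E).
      rewrite -big_filter -[leRHS]big_filter big_seq [leRHS]big_seq; apply: lee_sum => x.
      by rewrite mem_filter => /andP[_ /lF0]; exact: (size_biased_cyl_ge hT hT').
    rewrite -big_filter; apply: sum_le_measure.
    + exact: filter_uniq.
    + exact: measurableC.
    + by move=> x _; exact: measurable_cyl.
    + move=> x; rewrite mem_filter => /andP[/asboolPn nA _] w.
      by rewrite /cyl /E /= => wx; rewrite wx.
    + by move=> x y w _ _; rewrite /cyl /= => <-.
  by move: sF0; rewrite /del; lra.
- by move=> x h h'; rewrite mem_filter => /andP[/asboolP Ax _]; exact: Ax.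
Qed.

Lemma limit_cells k (g : fun_space -> R) (F : seq ptree) (c : ptree -> R) e :
  (forall x, x \in F -> low k.+1 x) ->
  (forall x h, x \in F -> allowed k x h -> `|g h - c x| <= e) ->
  cells P' (g \o limit_map) F c (fun x => (lev k x)%:R * wt R k x) e.
Proof.
move=> Flow gc; have mG : measurable G by exact: measurable_good_event.
exists (fun x => cyl T' k x `&` G); split.
- by move=> x; apply: measurableI => //; exact: measurable_cyl.
- by move=> x y w [+ _] [+ _]; rewrite /cyl /= => <-.
- by move=> x _; rewrite mulr_ge0 // wt_ge0.
- move=> x /Flow lx; apply: le_trans (size_biased_cyl_ge hT hT' lx) _.
  have mC := measurable_cyl T' k x.
  rewrite -[cyl T' k x in leLHS](setUIDK _ G) measureU //; last first.
  + by apply/seteqP; split => // w [[_ ?] [_]].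
  + exact: measurableD.
  + exact: measurableI.
  rewrite [X in (_ + X)%E](_ : _ = 0%E) ?adde0 //.
  apply/eqP; rewrite eq_le measure_ge0 andbT -(good_event_full hT hT').
  by apply: le_measure; rewrite ?inE; [exact: measurableD|exact: measurableC|move=> w []].
- move=> x w xF [wx Gw]; apply: gc => //; left.
  have [eta gw] := good_event_good Gw.
  by exists (T' w : tree), eta; rewrite /= (limit_mapE Gw).
Qed.

End limit.
End encoding.
End convergence.

Theorem theorem9 (R : realType) (sigma : 'S_3)
  (dn : nat -> measure_display) (Omn : forall n, measurableType (dn n))
  (Pn : forall n, probability (Omn n) R)
  (Pi : forall n, Omn n -> 'S_n)
  (hPi : forall n, (4 <= n)%N -> uniform_on (Pn n) (@Pi n) (Av n sigma))
  (d : measure_display) (Om : measurableType d) (P : probability Om R)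
  (T : {RV P >-> borel tree})
  (hT : is_GW (@geometric_half R) T)
  (d' : measure_display) (Om' : measurableType d') (P' : probability Om' R)
  (T' : {RV P' >-> borel tree})
  (hT' : is_size_biased T T') :
  exists Y : {RV P' >-> borel fun_space},
    {ae P', forall w, Tinfty (T' w) /\ Y w = Phi sigma (T' w)} /\
    cvg_in_distribution (X := fun_space) Pn
      (fun n w => embed_perm (Pi n w)) P' Y.
Proof.
have [f hf] := local_encoding_exists sigma.
pose mY := isMeasurableFun.Build _ _ _ _ _ (measurable_limit_map hf T').
pose Y : {RV P' >-> borel fun_space} := HB.pack (limit_map sigma T') mY.
exists Y; split.
  exists (setC (good_event T')); split.
  - by apply: measurableC; exact: measurable_good_event.
  - exact: (good_event_full hT hT').
  - move=> w /= nw Gw; apply: nw; have [eta gw] := good_event_good Gw.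
    by split; [exact: good_Tinfty gw|exact: limit_mapE].
move=> g cg [M [_ gM]].
have {}gM h : (`|g h| <= `|M| + 1)%R by apply: gM => //; rewrite ltr_pwDr ?ler_norm.
apply: (@cvg_expectation R ptree dn Omn Pn (fun n w => g (embed_perm (Pi n w)))
  _ _ P' (g \o limit_map sigma T') (`|M| + 1)%R) => //.
- by exists 4 => // n /hPi /measurable_uniform mPi _ B _; rewrite setTI;
    exact: (mPi (fun p => B (g (embed_perm p)))).
- exact: (measurable_continuous hf T' cg).
- by move=> w; exact: gM.
move=> e e0; have [k [F [uF /allP lF sF gF]]] := good_shapes hf hT hT' cg e0.
pose c x := g (xget point (allowed sigma f k x)).
have gc x h : x \in F -> allowed sigma f k x h -> (`|g h - c x| <= e)%R.
  by move=> xF ah; apply: (gF x _ _ xF ah); exact: (xgetI point ah).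
exists F, c, (fun x => (lev k x)%:R * wt R k x)%R,
  (fun n x => (ballot (lev k x) (n - (nodes x).-1))%:R / (ballot 1 n)%:R)%R; split => //.
- exact: (limit_cells hT hT' lF gc).
- exists (maxn 4 (\max_(x <- F) nodes x)) => // n; rewrite /= geq_max => /andP[n4 nF].
  apply: (uniform_cells hf (hPi n n4)) gc => x xF; split; first exact: lF.
  apply: leqW; apply: leq_trans nF; rewrite (big_rem x) //=; exact: leq_maxl.
- by move=> x /lF; exact: cvg_prefix_ratio.
Qed.
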